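(* Let $\nu$ be a finite (complex) Borel measure on $\mathbb{T}$ and suppose that the Cauchy integral $$\mathcal{C}_\nu(z)=\int_{\mathbb{T}}\frac{1}{1-\overline{x}z}\,d\nu(x)=\sum_{n\ge0}\nu_n z^n,\quad z\in\mathbb{D},$$ satisfies $\sup_{n\ge0}|\nu_n|e^{c\sqrt n}<\infty$ for some $c>0$. Then $\nu$ is absolutely continuous with respect to $m$, $d\nu=g\,dm$ with $g\in L^1(\mathbb{T})$, and there exists an open set $U\subset\mathbb{T}$ which differs from $\{x\in\mathbb{T}:|g(x)|>0\}$ only by a set of $m$-measure zero, with the property that for each $x\in U$ there is an arc $I\subset U$ containing $x$ such that $\int_I\log|g|\,dm>-\infty$.
   Context: $\mathbb{D}$ is the open unit disk, $\mathbb{T}$ the unit circle, $m$ normalized arc-length measure on $\mathbb{T}$. The $\nu_n$ are the Fourier coefficients $\nu_n=\int_{\mathbb{T}}\overline{x}^n\,d\nu(x)$, $n\ge0$. *)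

(* Defs.v *)
From HB Require Import structures.
From mathcomp Require Import all_boot all_order all_algebra.
From mathcomp Require Import all_classical all_reals all_analysis.
Set Implicit Arguments. Unset Strict Implicit. Unset Printing Implicit Defensive.
Import Order.TTheory GRing.Theory Num.Theory.
Import numFieldNormedType.Exports.
Local Open Scope classical_set_scope.
Local Open Scope ring_scope.

(* The circle T is parametrized by t in [0,1) via t |-> exp(2 pi i t);
   normalized arc length m becomes Lebesgue measure on [0,1). *)
Definition Tpar {R : realType} : set R := `[0, 1[.

Definition frac {R : realType} (t : R) : R := t - (Num.floor t)%:~R.

Definition T_open {R : realType} (U : set R) : Prop :=
  U `<=` Tpar /\ open (frac @^-1` U).

Definition Tarc {R : realType} (a b : R) : set R := frac @` `]a, b[.

(* a finite complex Borel measure nu on T, given as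
   nu = (mu1 - mu2) + i (mu3 - mu4) with finite positive Borel measures
   mu_k on R concentrated on [0,1). *)
Record cmeasure (R : realType) := CMeasure {
  cm1 : {finite_measure set (measurableTypeR R) -> \bar R};
  cm2 : {finite_measure set (measurableTypeR R) -> \bar R};
  cm3 : {finite_measure set (measurableTypeR R) -> \bar R};
  cm4 : {finite_measure set (measurableTypeR R) -> \bar R};
  cm_supp1 : cm1 (~` Tpar) = 0%E;
  cm_supp2 : cm2 (~` Tpar) = 0%E;
  cm_supp3 : cm3 (~` Tpar) = 0%E;
  cm_supp4 : cm4 (~` Tpar) = 0%E }.

Definition rint {R : realType} (mu : {finite_measure set (measurableTypeR R) -> \bar R})
  (f : R -> R) : R := fine (\int[mu]_(t in Tpar) (f t)%:E).

Definition cm_re {R : realType} (nu : cmeasure R) (A : set R) : R :=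
  fine (cm1 nu A) - fine (cm2 nu A).
Definition cm_im {R : realType} (nu : cmeasure R) (A : set R) : R :=
  fine (cm3 nu A) - fine (cm4 nu A).

(* Fourier coefficient nu_n = \int conj(x)^n dnu(x), x = exp(2 pi i t):
   conj(x)^n = cos(2 pi n t) - i sin(2 pi n t). *)
Definition ccos {R : realType} (n : nat) (t : R) : R := cos (2 * pi * n%:R * t).
Definition csin {R : realType} (n : nat) (t : R) : R := sin (2 * pi * n%:R * t).

Definition fcoef_re {R : realType} (nu : cmeasure R) (n : nat) : R :=
  (rint (cm1 nu) (ccos n) - rint (cm2 nu) (ccos n))
  + (rint (cm3 nu) (csin n) - rint (cm4 nu) (csin n)).
Definition fcoef_im {R : realType} (nu : cmeasure R) (n : nat) : R :=
  (rint (cm3 nu) (ccos n) - rint (cm4 nu) (ccos n))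
  - (rint (cm1 nu) (csin n) - rint (cm2 nu) (csin n)).

Definition fcoef_abs {R : realType} (nu : cmeasure R) (n : nat) : R :=
  Num.sqrt (fcoef_re nu n ^+ 2 + fcoef_im nu n ^+ 2).

Definition cabs {R : realType} (g1 g2 : R -> R) (t : R) : R :=
  Num.sqrt (g1 t ^+ 2 + g2 t ^+ 2).

(* Main.v *)
Require Import Defs.
From HB Require Import structures.
From mathcomp Require Import all_boot all_order all_algebra.
From mathcomp Require Import all_classical all_reals all_analysis.
From mathcomp Require Import measurable_realfun complex.
From mathcomp Require Import ring lra.
Import Order.TTheory GRing.Theory Num.Theory.
Import numFieldNormedType.Exports.
Import Normc.
Local Open Scope classical_set_scope.
Local Open Scope ring_scope.
Set Implicit Arguments. Unset Strict Implicit. Unset Printing Implicit Defensive.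

(* A polynomial p = (1 + S/M)^M imitates exp S, where S is the (truncated)
   Herglotz transform of a real weight w, so that |p| is about exp w on the
   circle.  If |S(z)| <= e / (1 - |z|) in the disc, Cauchy's estimate bounds the
   coefficients of p - 1 by a multiple of e exp(c' sqrt n), with c' < c, which
   the decay of the nu_n absorbs: the integral of conj(p) against nu is close to
   nu_0 = nu(T).  Such a bound on S holds when w has mean zero on every arc of a
   fine partition.  When moreover w lives near a closed set K, is very negative
   on K, and exp w is small in L^1(|nu|) near K, then p is almost 0 on K and
   almost 1 away from K, so that nu(K) = 0.

   If K is a null set, w close to -N on K has negligible mass and nothing has to
   be balanced: nu is absolutely continuous.  If K avoids the union U of the arcs
   on which log |g| is integrable, every arc that K meets in positive measure
   carries weights W >= 0 of any mass with exp(W) |g| <= 1 + |g|, and these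
   balance -N on K.  So nu vanishes off U, and g = 0 almost everywhere there. *)

(** The depth [N] and the width [d] of the neighbourhood of K are fixed by [e]; only afterwards are
    the cell length 1/n and the L^1 error made small. This order is possible because the oscillation
    of the Herglotz kernel over an arc of length s is at most a constant times s / (1 - |z|) times a
    Poisson kernel of integral 1: a balanced weight of total mass 2 N contributes O(N / n) / (1 -
    |z|), however large N is. Polynomials stand for the exponential and for the Herglotz transform
    so that the pairing with nu is a finite sum of coefficients nu_n, n >= 0. The circle is cut at
    0. A weight that vanishes near the cut is continuous on the circle as soon as it is on the line;
    hence sets are exhausted by closed sets inside [b, 1 - b], and the point 0 gets an explicit
    polynomial of its own. Only the real part of nu is studied, i nu giving the other part. The
    estimates need exp w small for each of the four positive measures representing nu. These may be
    much larger than |nu|, so once densities exist, nu is represented anew by their positive and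
    negative parts, which |g| dominates. *)

Section complex_norm.
Variable R : realType.
Implicit Types x y u : R[i].

Lemma normc_real x : `|x| = (normc x)%:C%C.
Proof. by []. Qed.

Lemma normc_ge0 x : 0 <= normc x.
Proof. by case: x => a b; exact: sqrtr_ge0. Qed.

Lemma ler_normcD x y : normc (x + y) <= normc x + normc y.
Proof. by have := ler_normD x y; rewrite !normc_real -rmorphD lecR. Qed.

Lemma normcN x : normc (- x) = normc x.
Proof. by case: x => a b /=; rewrite !sqrrN. Qed.

Lemma ler_normcB x y : normc (x - y) <= normc x + normc y.
Proof. by rewrite -(normcN y); exact: ler_normcD. Qed.

Lemma normcBC x y : normc (x - y) = normc (y - x).
Proof. by rewrite -normcN opprB. Qed.

Lemma lerB_normc x y : normc x - normc y <= normc (x - y).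
Proof. by rewrite lerBlDr; apply: le_trans (ler_normcD _ _); rewrite subrK. Qed.

Lemma normcX x n : normc (x ^+ n) = normc x ^+ n.
Proof. by elim: n => [|n IH]; rewrite ?expr0 ?normc1// !exprS normcM IH. Qed.

Lemma normc_realE (a : R) : normc a%:C%C = `|a|.
Proof. by rewrite /= expr0n addr0 sqrtr_sqr. Qed.

Lemma normc_nat n : normc (n%:R : R[i]) = n%:R.
Proof. by rewrite -(rmorph_nat (real_complex R)) normc_realE normr_nat. Qed.

Lemma ler_normc_sum (I : Type) (s : seq I) (P : pred I) (F : I -> R[i]) :
  normc (\sum_(i <- s | P i) F i) <= \sum_(i <- s | P i) normc (F i).
Proof.
elim/big_ind2: _ => [|a b c d h1 h2|//]; first by rewrite normc0.
exact: le_trans (ler_normcD _ _) (lerD h1 h2).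
Qed.

Lemma ReD x y : complex.Re (x + y) = complex.Re x + complex.Re y.
Proof. by case: x => a b; case: y. Qed.

Lemma ReN x : complex.Re (- x) = - complex.Re x.
Proof. by case: x. Qed.

Lemma ReB x y : complex.Re (x - y) = complex.Re x - complex.Re y.
Proof. by rewrite ReD ReN. Qed.

Lemma Re_sum (I : Type) (s : seq I) (P : pred I) (F : I -> R[i]) :
  complex.Re (\sum_(i <- s | P i) F i) = \sum_(i <- s | P i) complex.Re (F i).
Proof. by elim/big_ind2: _ => // a b c d <- <-; rewrite ReD. Qed.

Lemma ReM x y : complex.Re (x * y) =
  complex.Re x * complex.Re y - complex.Im x * complex.Im y.
Proof. by case: x => a b; case: y. Qed.

Lemma normc_sqr x : normc x ^+ 2 = complex.Re x ^+ 2 + complex.Im x ^+ 2.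
Proof. by case: x => a b /=; rewrite sqr_sqrtr// addr_ge0// sqr_ge0. Qed.

Lemma normr_Re_le x : `|complex.Re x| <= normc x.
Proof.
rewrite -(ler_pXn2r (n:=2))// ?nnegrE ?normc_ge0// normc_sqr real_normK ?num_real//.
by rewrite lerDl sqr_ge0.
Qed.

Lemma normr_Im_le x : `|complex.Im x| <= normc x.
Proof.
rewrite -(ler_pXn2r (n:=2))// ?nnegrE ?normc_ge0// normc_sqr real_normK ?num_real//.
by rewrite lerDr sqr_ge0.
Qed.

Lemma Re_le_normc x : complex.Re x <= normc x.
Proof. exact: le_trans (ler_norm _) (normr_Re_le _). Qed.

Lemma normc_Re_dual x : exists2 u, normc u = 1 & complex.Re (u * x) = normc x.
Proof.
have [->|x0] := eqVneq x 0; first by exists 1; rewrite ?normc1 // mulr0 normc0.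
have nx0 : normc x != 0 by apply: contra x0 => /eqP/eq0_normc ->.
exists ((complex.Re x / normc x) -i* (complex.Im x / normc x))%C; last first.
  rewrite ReM /= mulNr opprK mulrAC [X in _ + X]mulrAC -mulrDl.
  by rewrite -!expr2 -normc_sqr expr2 mulfK.
apply/eqP; rewrite -(eqrXn2 (n:=2)) ?normc_ge0// normc_sqr /= sqrrN !expr_div_n.
by rewrite -mulrDl -normc_sqr divff ?expr1n ?sqrf_eq0.
Qed.

(** All integrals below are real valued; a complex integral is bounded through the real parts of its
    rotations, which is why many integral estimates carry a unimodular factor [u]. *)
Lemma normc_le_Re x B : (forall u, normc u = 1 -> complex.Re (u * x) <= B) ->
  normc x <= B.
Proof. by have [u u1 <-] := normc_Re_dual x => /(_ _ u1). Qed.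

End complex_norm.

(** * Characters of the circle and the Herglotz kernel *)

Section cexp_kernel.
Variable R : realType.
Implicit Types (s t : R) (x y z : R[i]).

Definition cexp t : R[i] := (cos (2 * pi * t) +i* sin (2 * pi * t))%C.

Lemma cexpD s t : cexp (s + t) = cexp s * cexp t.
Proof.
rewrite /cexp mulrDr cosD sinD; apply/eqP; rewrite eq_complex /=.
by apply/andP; split; apply/eqP; ring.
Qed.

Lemma cexp0 : cexp 0 = 1.
Proof. by rewrite /cexp mulr0 cos0 sin0. Qed.

Lemma cexpNK t : cexp (- t) * cexp t = 1.
Proof. by rewrite -cexpD addNr cexp0. Qed.

Lemma normc_cexp t : normc (cexp t) = 1.
Proof. by rewrite /= cos2Dsin2 sqrtr1. Qed.

Lemma cexpX t n : cexp t ^+ n = cexp (n%:R * t).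
Proof.
elim: n => [|n IH]; first by rewrite expr0 mul0r cexp0.
by rewrite exprSr IH -cexpD -natr1 mulrDl mul1r.
Qed.

Lemma ler_cos_sub s t : `|cos s - cos t| <= `|s - t|.
Proof.
wlog st : s t / t < s => [H|].
  have [|/H//|->] := ltgtP s t; last by rewrite !subrr.
  by rewrite (distrC (cos s)) (distrC s); exact: H.
have [c _ ->] := @MVT R cos (fun v => - sin v) t s st (fun v _ => is_derive_cos v)
  (continuous_subspaceT (@continuous_cos R)).
by rewrite normrM normrN ler_piMl// ler_norml sin_geN1 sin_le1.
Qed.

Lemma ler_sin_sub s t : `|sin s - sin t| <= `|s - t|.
Proof.
wlog st : s t / t < s => [H|].
  have [|/H//|->] := ltgtP s t; last by rewrite !subrr.
  by rewrite (distrC (sin s)) (distrC s); exact: H.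
have [c _ ->] := @MVT R sin cos t s st (fun v _ => is_derive_sin v)
  (continuous_subspaceT (@continuous_sin R)).
by rewrite normrM ler_piMl// ler_norml cos_geN1 cos_le1.
Qed.

Lemma pi_le4 : pi <= 4 :> R.
Proof. by have /andP[_] := pihalf_02 R; lra. Qed.

Lemma normc_le_ReIm x : normc x <= `|complex.Re x| + `|complex.Im x|.
Proof.
rewrite -(ler_pXn2r (n:=2))// ?nnegrE ?normc_ge0 ?addr_ge0// normc_sqr sqrrD.
by rewrite !real_normK ?num_real// -addrA lerD2l lerDr mulrn_wge0// mulr_ge0.
Qed.

Lemma cexp_lip s t : normc (cexp s - cexp t) <= 16 * `|s - t|.
Proof.
apply: (le_trans (normc_le_ReIm _)) => /=.
have h1 := ler_cos_sub (2 * pi * s) (2 * pi * t).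
have h2 := ler_sin_sub (2 * pi * s) (2 * pi * t).
have : `|2 * pi * s - 2 * pi * t| <= 8 * `|s - t|.
  rewrite -mulrBr normrM ler_wpM2r// ger0_norm ?mulr_ge0 ?pi_ge0//.
  by have := pi_le4; lra.
move: h1 h2; lra.
Qed.

(** The real part of [1 - cexp s] is 1 - cos (2 pi s), and the cosine decreases on a half period;
    values of |s| above 1/2 are reflected by s -> 1 - s. *)
Lemma cexp_far (d : R) : 0 < d <= 1/2 -> exists2 c : R, 0 < c &
  forall s, d <= `|s| <= 1 - d -> c <= normc (1 - cexp s).
Proof.
move=> /andP[d0 d12]; have pi0 := pi_gt0 R.
have ple : 2 * pi * d <= pi by rewrite -[leRHS]mulr1 -mulrA mulrCA ler_pM2l//; lra.
exists (1 - cos (2 * pi * d)).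
  rewrite subr_gt0 -[ltRHS]cos0 ltr_cos ?in_itv/= ?lexx ?pi_ge0 ?ple ?andbT//.
  - by rewrite !mulr_gt0.
  - by rewrite !mulr_ge0// ltW.
move=> s /andP[ds s1].
apply: le_trans (le_trans (ler_norm _) (normr_Re_le _)); rewrite /= lerD2l lerN2.
have -> : cos (2 * pi * s) = cos (2 * pi * `|s|).
  by have [//|_] := ger0P s; rewrite mulrN cosN.
have [v vE] : exists v : R, v = `|s| by exists `|s|.
rewrite -vE in ds s1 *; move: v ds s1 {s vE} => s ds s1.
have main u : d <= u -> u <= 1/2 -> cos (2 * pi * u) <= cos (2 * pi * d).
  move=> du u1; have pu : 2 * pi * u <= pi.
    by rewrite -[leRHS]mulr1 -mulrA mulrCA ler_pM2l//; lra.
  have [->//|du'] := eqVneq d u; apply/ltW.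
  have u0 : 0 <= u by lra.
  rewrite ltr_cos ?in_itv/= ?ple ?pu ?andbT; [|by rewrite !mulr_ge0// ltW..].
  by rewrite ltr_pM2l ?mulr_gt0// lt_neqAle du' du.
have [/main->//|s2] := leP s (1/2).
have -> : cos (2 * pi * s) = cos (2 * pi * (1 - s)).
  rewrite mulrBr mulr1 cosB mulr_natl cos2pi.
  by rewrite (_ : sin (pi *+ 2) = 0) ?mul1r ?mul0r ?addr0// mulr2n sinDpi sinpi oppr0.
by apply: main; lra.
Qed.

(* The Herglotz kernel [1 + 2 sum_k x^k] and its Taylor polynomials. *)
Definition herg x := (1 + x) / (1 - x).
Definition herg_coef (k : nat) : R[i] := if k == 0%N then 1 else 2.
Definition hergt D x : R[i] := \sum_(k < D.+1) herg_coef k * x ^+ k.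

Lemma hergtE D x : (1 - x) * hergt D x = 1 + x - 2 * x ^+ D.+1.
Proof.
rewrite /hergt; elim: D => [|D IH].
  by rewrite big_ord_recr big_ord0 /= /herg_coef /= expr0 expr1; ring.
rewrite big_ord_recr /= mulrDr IH /herg_coef /= [x ^+ D.+2]exprS; ring.
Qed.

Lemma normc_1B x : 1 - normc x <= normc (1 - x).
Proof. by have := lerB_normc 1 x; rewrite normc1. Qed.

Lemma sub1_neq0 x : normc x < 1 -> 1 - x != 0.
Proof.
move=> x1; apply/negP => /eqP h; have := normc_1B x; rewrite h normc0; lra.
Qed.

(** By [hergtE] the error is exactly - 2 x^(D+1) / (1 - x). *)
Lemma herg_trunc D x r : normc x <= r -> r < 1 ->
  normc (hergt D x - herg x) <= 2 * r ^+ D.+1 / (1 - r).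
Proof.
move=> xr r1; have x1 : 1 - x != 0 by apply: sub1_neq0; lra.
have -> : hergt D x - herg x = - (2 * x ^+ D.+1) / (1 - x).
  apply: (mulfI x1); rewrite mulrBr hergtE /herg; field; exact: x1.
rewrite normcM normcN normcM normcV normcX normc_nat.
have nx := normc_ge0 x.
apply: ler_pM; rewrite ?mulr_ge0 ?exprn_ge0 ?invr_ge0 ?normc_ge0//.
  by rewrite ler_pM2l// lerXn2r// nnegrE// (le_trans nx).
by rewrite lef_pV2 ?posrE; have := normc_1B x; lra.
Qed.

Lemma hergB x y : normc x < 1 -> normc y < 1 ->
  normc (herg x - herg y) = 2 * normc (x - y) / (normc (1 - x) * normc (1 - y)).
Proof.
move=> /sub1_neq0 x1 /sub1_neq0 y1.
have -> : herg x - herg y = 2 * (x - y) / ((1 - x) * (1 - y)).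
  by rewrite /herg; field; rewrite x1 y1.
by rewrite !normcM normcV normcM normc_nat.
Qed.

Lemma herg_le x : normc x < 1 -> normc (herg x) <= 2 / normc (1 - x).
Proof.
move=> x1; rewrite normcM normcV ler_wpM2r// ?invr_ge0 ?normc_ge0//.
by apply: (le_trans (ler_normcD _ _)); rewrite normc1; lra.
Qed.

(** This is the Poisson kernel: its positivity in the disc turns pointwise bounds on the oscillation
    of [herg] into bounds that integrate well. *)
Lemma Re_herg x :
  complex.Re (herg x) = (1 - normc x ^+ 2) / normc (1 - x) ^+ 2.
Proof. by rewrite /herg !normc_sqr; case: x => a b /=; ring. Qed.

End cexp_kernel.

(** * Bounded measurable functions and their integrals *)

Section bounded_measurable.
Variable R : realType.
Implicit Types f g : R -> R.

(** Boundedness on the whole line makes integrability automatic on any set of finite measure, for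
    all the measures that occur. *)
Definition bm f := measurable_fun [set: R] f /\ exists M, forall x, `|f x| <= M.

Lemma bm_bound f : bm f -> exists2 M, 0 < M & forall x, `|f x| <= M.
Proof.
move=> [_ [M fM]]; exists (`|M| + 1) => [|x]; first by rewrite ltr_wpDl.
by rewrite (le_trans (fM x))// (le_trans (ler_norm _))// lerDl.
Qed.

Lemma bm_cst (r : R) : bm (fun=> r).
Proof. by split; [exact: measurable_cst|exists `|r|]. Qed.

Lemma bmD f g : bm f -> bm g -> bm (fun x => f x + g x).
Proof.
move=> [mf [M fM]] [mg [N gN]]; split; first exact: measurable_funD.
by exists (M + N) => x; rewrite (le_trans (ler_normD _ _))// lerD.
Qed.

Lemma bmM f g : bm f -> bm g -> bm (fun x => f x * g x).
Proof.
move=> [mf [M fM]] [mg [N gN]]; split; first exact: measurable_funM.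
by exists (M * N) => x; rewrite normrM ler_pM.
Qed.

Lemma bmN f : bm f -> bm (fun x => - f x).
Proof.
move=> [mf [M fM]]; split; last by exists M => x; rewrite normrN.
exact: measurableT_comp.
Qed.

Lemma bmB f g : bm f -> bm g -> bm (fun x => f x - g x).
Proof. by move=> bf bg; apply: bmD => //; exact: bmN. Qed.

Lemma bm_norm f : bm f -> bm (fun x => `|f x|).
Proof.
move=> [mf [M fM]]; split; last by exists M => x; rewrite normr_id.
exact: measurableT_comp.
Qed.

Lemma bm_expR f : bm f -> bm (fun x => expR (f x)).
Proof.
move=> [mf [M fM]]; split; first exact: measurableT_comp.
exists (expR M) => x; rewrite ger0_norm ?expR_ge0// ler_expR.
exact: le_trans (ler_norm _) (fM x).
Qed.

Lemma bm_sum (I : Type) (s : seq I) (F : I -> R -> R) :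
  (forall i, bm (F i)) -> bm (fun x => \sum_(i <- s) F i x).
Proof.
move=> bF; elim: s => [|i s IH].
  by under eq_fun do rewrite big_nil; exact: bm_cst.
by under eq_fun do rewrite big_cons; exact: bmD.
Qed.

Lemma bm_indic (A : set R) : measurable A -> bm (\1_A : R -> R).
Proof.
move=> mA; split; first exact: measurable_indic.
by exists 1 => x; rewrite indicE normr_nat; case: (_ \in _).
Qed.

Lemma bm_continuous f : continuous f -> (exists M, forall x, `|f x| <= M) -> bm f.
Proof. by move=> cf bf; split => //; exact: continuous_measurable_fun. Qed.

Lemma bm_cos (a : R) : bm (fun x => cos (a * x)).
Proof.
apply: bm_continuous => [x|].
  apply: continuous_comp; last exact: continuous_cos.
  exact: mulrl_continuous.
by exists 1 => x; rewrite ler_norml cos_geN1 cos_le1.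
Qed.

Lemma bm_sin (a : R) : bm (fun x => sin (a * x)).
Proof.
apply: bm_continuous => [x|].
  apply: continuous_comp; last exact: continuous_sin.
  exact: mulrl_continuous.
by exists 1 => x; rewrite ler_norml sin_geN1 sin_le1.
Qed.

Section integral.
Variables (mu : {measure set (measurableTypeR R) -> \bar R}) (A : set R).
Hypotheses (mA : measurable A) (fA : (mu A < +oo)%E).

Lemma bm_integrable f : bm f -> mu.-integrable A (EFin \o f).
Proof.
move=> [mf [M fM]]; apply: measurable_bounded_integrable => //.
  exact: measurable_funTS.
exists M; split; rewrite ?num_real// => x Mx y _.
exact: le_trans (fM y) (ltW Mx).
Qed.

Lemma bm_RintD f g : bm f -> bm g ->
  \int[mu]_(x in A) (f x + g x) = \int[mu]_(x in A) f x + \int[mu]_(x in A) g x.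
Proof. by move=> bf bg; rewrite RintegralD//; exact: bm_integrable. Qed.

Lemma bm_RintB f g : bm f -> bm g ->
  \int[mu]_(x in A) (f x - g x) = \int[mu]_(x in A) f x - \int[mu]_(x in A) g x.
Proof. by move=> bf bg; rewrite RintegralB//; exact: bm_integrable. Qed.

Lemma bm_RintZl (r : R) f : bm f ->
  \int[mu]_(x in A) (r * f x) = r * \int[mu]_(x in A) f x.
Proof. by move=> bf; rewrite RintegralZl//; exact: bm_integrable. Qed.

Lemma bm_Rint_sum (I : Type) (s : seq I) (F : I -> R -> R) :
  (forall i, bm (F i)) ->
  \int[mu]_(x in A) (\sum_(i <- s) F i x) = \sum_(i <- s) \int[mu]_(x in A) F i x.
Proof.
move=> bF; elim: s => [|i s IH].
  rewrite big_nil; transitivity (\int[mu]_(x in A) (0 : R)).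
    by apply: eq_Rintegral => x _; rewrite big_nil.
  by rewrite Rintegral_cst// mul0r.
rewrite big_cons -IH -bm_RintD//; last exact: bm_sum.
by apply: eq_Rintegral => x _; rewrite big_cons.
Qed.

Lemma bm_le_Rint f g : bm f -> bm g -> (forall x, A x -> f x <= g x) ->
  \int[mu]_(x in A) f x <= \int[mu]_(x in A) g x.
Proof. by move=> bf bg fg; apply: le_Rintegral => //; exact: bm_integrable. Qed.

Lemma bm_Rint_norm f : bm f ->
  `|\int[mu]_(x in A) f x| <= \int[mu]_(x in A) `|f x|.
Proof. by move=> bf; apply: le_normr_Rintegral => //; exact: bm_integrable. Qed.

Lemma bm_Rint_norm_le f g : bm f -> bm g -> (forall x, A x -> `|f x| <= g x) ->
  `|\int[mu]_(x in A) f x| <= \int[mu]_(x in A) g x.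
Proof.
move=> bf bg fg; apply: le_trans (bm_Rint_norm bf) _.
by apply: bm_le_Rint => //; exact: bm_norm.
Qed.

End integral.

Lemma bm_RintU (mu : {measure set (measurableTypeR R) -> \bar R}) (A B : set R) f :
  measurable A -> measurable B -> (mu A < +oo)%E -> (mu B < +oo)%E ->
  A `&` B = set0 -> bm f ->
  \int[mu]_(x in A `|` B) f x = \int[mu]_(x in A) f x + \int[mu]_(x in B) f x.
Proof.
move=> mA mB fA fB AB bf; apply: Rintegral_setU => //; last by apply/disj_setPS; rewrite AB.
apply: bm_integrable => //; first exact: measurableU.
by rewrite (le_lt_trans (measureU2 mu mA mB))// lte_add_pinfty.
Qed.

Lemma finite_measure_lty (tau : {finite_measure set (measurableTypeR R) -> \bar R})
  (A : set R) : measurable A -> (tau A < +oo)%E.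
Proof. by move=> mA; rewrite ltey_eq fin_num_measure. Qed.

End bounded_measurable.

(** * Fourier coefficients, Herglotz polynomials and Cauchy's estimate *)

Section fourier.
Variable R : realType.
Implicit Types (f g w F : R -> R) (c u z : R[i]) (a r : R).
Local Notation leb := (@lebesgue_measure R).
Local Open Scope complex_scope.

Definition intT f : R := \int[leb]_(x in Tpar) f x.

Lemma measurable_Tpar : measurable (Tpar : set R).
Proof. exact: measurable_itv. Qed.

Lemma leb_Tpar : leb Tpar = 1%E.
Proof. by rewrite /Tpar lebesgue_measure_itv/= lte_fin ltr01 sube0. Qed.

Lemma leb_Tpar_lty : (leb Tpar < +oo)%E.
Proof. by rewrite leb_Tpar ltry. Qed.

Hint Resolve measurable_Tpar leb_Tpar_lty : core.

Lemma intTD f g : bm f -> bm g -> intT (fun x => f x + g x) = intT f + intT g.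
Proof. exact: bm_RintD. Qed.

Lemma intTB f g : bm f -> bm g -> intT (fun x => f x - g x) = intT f - intT g.
Proof. exact: bm_RintB. Qed.

Lemma intTZl a f : bm f -> intT (fun x => a * f x) = a * intT f.
Proof. exact: bm_RintZl. Qed.

Lemma intT_sum (I : Type) (s : seq I) (G : I -> R -> R) :
  (forall i, bm (G i)) -> intT (fun x => \sum_(i <- s) G i x) = \sum_(i <- s) intT (G i).
Proof. exact: bm_Rint_sum. Qed.

Lemma intT_cst a : intT (fun=> a) = a.
Proof. by rewrite /intT Rintegral_cst// [X in fine X]leb_Tpar mulr1. Qed.

Lemma le_intT f g : bm f -> bm g -> (forall x, Tpar x -> f x <= g x) -> intT f <= intT g.
Proof. exact: bm_le_Rint. Qed.

Lemma intT_norm_le f g : bm f -> bm g -> (forall x, Tpar x -> `|f x| <= g x) ->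
  `|intT f| <= intT g.
Proof. exact: bm_Rint_norm_le. Qed.

Lemma intT_ge0 f : (forall x, Tpar x -> 0 <= f x) -> 0 <= intT f.
Proof. by move=> f0; rewrite /intT Rintegral_ge0. Qed.

Lemma eq_intT f g : f =1 g -> intT f = intT g.
Proof. by move=> fg; apply: eq_Rintegral => x _. Qed.

Lemma intT_derive_periodic F f : (forall x : R, is_derive x (1 : R) F (f x)) ->
  continuous f -> bm f -> F 0 = F 1 -> intT f = 0.
Proof.
move=> dF cf bf F01; rewrite /intT /Tpar Rintegral_itv_bndo_bndc; last first.
  by apply: bm_integrable.
have cF x : F t @[t --> x] --> F x.
  by have [dx _] := dF x; apply/differentiable_continuous/derivable1_diffP.
rewrite /Rintegral (@continuous_FTC2 _ f F)//.
- by rewrite F01 subee.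
- exact: continuous_subspaceT.
- split; first by move=> x _; have [] := dF x.
    exact: cvg_at_right_filter (cF 0).
  exact: cvg_at_left_filter (cF 1).
- by move=> x _; rewrite derive1E; have [_ ->] := dF x.
Qed.

Lemma bm_Re_cexp c a : bm (fun y => complex.Re (c * cexp (a * y))).
Proof.
case: c => p q; rewrite /cexp /=.
by apply: bmB; apply: bmM; try exact: bm_cst;
  under eq_fun do rewrite mulrA; [exact: bm_cos|exact: bm_sin].
Qed.

Lemma cexp_nat n : cexp (n%:R : R) = 1.
Proof.
suff h : cexp (1 : R) = 1 by rewrite -[_%:R]mulr1 -cexpX h expr1n.
rewrite /cexp mulr1 mulr_natl cos2pi (_ : sin (pi *+ 2) = 0)//.
by rewrite mulr2n sinDpi sinpi oppr0.
Qed.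

Lemma cvg_cosM (t x : R) : cos (t * y) @[y --> x] --> cos (t * x).
Proof.
apply: (@continuous_comp _ _ _ ( *%R t) cos); first exact: mulrl_continuous.
exact: continuous_cos.
Qed.

Lemma cvg_sinM (t x : R) : sin (t * y) @[y --> x] --> sin (t * x).
Proof.
apply: (@continuous_comp _ _ _ ( *%R t) sin); first exact: mulrl_continuous.
exact: continuous_sin.
Qed.

Lemma intT_cexp c a n : (0 < n)%N -> a = n%:R \/ a = - n%:R ->
  intT (fun y => complex.Re (c * cexp (a * y))) = 0.
Proof.
move=> n0 an; have a0 : a != 0.
  by case: an => ->; rewrite ?oppr_eq0 pnatr_eq0 -lt0n.
have ea : cexp a = 1.
  case: an => ->; first exact: cexp_nat.
  by rewrite -[LHS]mulr1 -[X in _ * X](cexp_nat n) cexpNK.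
have t0 : 2 * pi * a != 0 by rewrite !mulf_neq0// gt_eqF// pi_gt0.
case: c => p q.
pose t := 2 * pi * a.
pose F y := t^-1 * (p * sin (t * y) + q * cos (t * y)).
apply: (@intT_derive_periodic F).
- move=> x.
  have dm : is_derive x 1 ( *%R t) t.
    have := is_deriveZ t (is_derive_id x (1 : R)).
    by rewrite /GRing.scale /= mulr1.
  have ds := @is_derive1_comp _ sin ( *%R t) x _ _ (is_derive_sin _) dm.
  have dc := @is_derive1_comp _ cos ( *%R t) x _ _ (is_derive_cos _) dm.
  rewrite /cexp /= !mulrA -/t.
  apply: is_derive_eq (is_deriveZ t^-1 (is_deriveD (is_deriveZ p ds) (is_deriveZ q dc))) _.
  have sE (v v' : R) : v *: v' = v * v' by [].
  by rewrite !sE; field; exact: t0.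
- have -> : (fun y => complex.Re ((p +i* q) * cexp (a * y))) =
      (fun y => p * cos (t * y) - q * sin (t * y)).
    by apply/funext => y; rewrite /cexp /= !mulrA.
  move=> x; apply: cvgB; apply: cvgM; try exact: cvg_cst.
    exact: cvg_cosM.
  exact: cvg_sinM.
- exact: bm_Re_cexp.
- rewrite /F mulr1 mulr0 sin0 cos0; move: ea; rewrite /cexp -/t => -[-> ->].
  by [].
Qed.

(** The Fourier coefficient, the integral of [w y * cexp (- (k y))], assembled from two real
    integrals. *)
Definition weight_coef w k : R[i] :=
  intT (fun y => w y * cos (2 * pi * (k%:R * y))) -i*
  intT (fun y => w y * sin (2 * pi * (k%:R * y))).

Lemma Re_coefk w c k : bm w -> complex.Re (c * weight_coef w k) =
  intT (fun y => w y * complex.Re (c * cexp (- (k%:R * y)))).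
Proof.
move=> bw; have bc : bm (fun y => w y * cos (2 * pi * (k%:R * y))).
  by apply: bmM => //; under eq_fun do rewrite mulrA; exact: bm_cos.
have bs : bm (fun y => w y * sin (2 * pi * (k%:R * y))).
  by apply: bmM => //; under eq_fun do rewrite mulrA; exact: bm_sin.
case: c => p q; rewrite /weight_coef /= mulrN opprK -!intTZl// -intTD; last 2 first.
  by apply: bmM => //; exact: bm_cst.
  by apply: bmM => //; exact: bm_cst.
by apply: eq_intT => y; rewrite mulrN cosN sinN; ring.
Qed.

(** The Herglotz transform of [w], dilated by [r] and cut at degree [D]: its value at z is the
    integral of [w] against the kernel [hergt D (r z cexp (- y))], as [Re_herg_poly] records. *)
Definition herg_poly w r D : {poly R[i]} :=
  \poly_(k < D.+1) (herg_coef R k * r%:C ^+ k * weight_coef w k).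

Lemma hergt_cexp D c y : hergt D (c * cexp (- y)) =
  \sum_(k < D.+1) herg_coef R k * c ^+ k * cexp (- (k%:R * y)).
Proof.
by apply: eq_bigr => k _; rewrite exprMn cexpX mulrN mulrA.
Qed.

Lemma bm_hergt u D c : bm (fun y => complex.Re (u * hergt D (c * cexp (- y)))).
Proof.
under eq_fun do rewrite hergt_cexp mulr_sumr Re_sum.
apply: bm_sum => k; under eq_fun do rewrite mulrA -mulNr; exact: bm_Re_cexp.
Qed.

Lemma Re_herg_poly w r D u z : bm w -> complex.Re (u * (herg_poly w r D).[z]) =
  intT (fun y => w y * complex.Re (u * hergt D (r%:C * z * cexp (- y)))).
Proof.
move=> bw; rewrite horner_poly mulr_sumr Re_sum.
transitivity (\sum_(k < D.+1) intT (fun y => w y * complex.Re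
   (u * herg_coef R k * (r%:C * z) ^+ k * cexp (- (k%:R * y))))).
  apply: eq_bigr => k _; rewrite -Re_coefk//; congr complex.Re.
  by rewrite exprMn; ring.
rewrite -intT_sum => [|k]; last first.
  by apply: bmM => //; under eq_fun do rewrite -mulNr; exact: bm_Re_cexp.
apply: eq_intT => y; rewrite hergt_cexp !mulr_sumr Re_sum mulr_sumr.
by apply: eq_bigr => k _; rewrite !mulrA.
Qed.

(** Only the constant term has a nonzero mean. For u = 1 the truncated Poisson kernel thus has
    integral exactly 1, without truncation error. *)
Lemma intT_hergt u D c :
  intT (fun y => complex.Re (u * hergt D (c * cexp (- y)))) = complex.Re u.
Proof.
transitivity (\sum_(k < D.+1) intT (fun y => complex.Re
   (u * herg_coef R k * c ^+ k * cexp (- k%:R * y)))).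
  rewrite -intT_sum => [|k]; last exact: bm_Re_cexp.
  apply: eq_intT => y; rewrite hergt_cexp !mulr_sumr Re_sum.
  by apply: eq_bigr => k _; rewrite !mulrA mulNr.
rewrite big_ord_recl big1 ?addr0 => [|i _].
  rewrite -[RHS]intT_cst; apply: eq_intT => y.
  by rewrite /= oppr0 mul0r cexp0 /herg_coef /= expr0 !mulr1.
by apply: (@intT_cexp _ _ i.+1) => //; right.
Qed.

(** By orthogonality the coefficient, times rho^m, is the mean of [p] on the circle of radius [rho]
    against the character of frequency - m. *)
Lemma cauchy_coef (p : {poly R[i]}) (rho B : R) m : 0 <= rho ->
  (forall z, normc z = rho -> normc p.[z] <= B) -> normc p`_m * rho ^+ m <= B.
Proof.
move=> rho0 pB.
have B0 : 0 <= B.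
  by apply: le_trans (pB rho%:C _); rewrite ?normc_ge0// normc_realE ger0_norm.
have [mp|mp] := leqP (size p) m; first by rewrite nth_default// normc0 mul0r.
have -> : normc p`_m * rho ^+ m = normc (p`_m * rho%:C ^+ m).
  by rewrite normcM normcX normc_realE (ger0_norm rho0).
apply: normc_le_Re => u u1.
have -> : complex.Re (u * (p`_m * rho%:C ^+ m)) =
    intT (fun y => complex.Re (u * (p.[rho%:C * cexp y] * cexp (- (m%:R * y))))).
  transitivity (\sum_(k < size p) intT (fun y => complex.Re
     (u * p`_k * rho%:C ^+ k * cexp ((k%:R - m%:R) * y)))); last first.
    rewrite -intT_sum => [|k]; last exact: bm_Re_cexp.
    apply: eq_intT => y; rewrite horner_coef mulr_suml !mulr_sumr Re_sum.
    apply: eq_bigr => k _; rewrite exprMn cexpX mulrBl cexpD; congr complex.Re.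
    by ring.
  rewrite (bigD1 (Ordinal mp))//= big1 ?addr0 => [|i im].
    rewrite -[LHS]intT_cst; apply: eq_intT => y.
    by rewrite subrr mul0r cexp0 mulr1 mulrA.
  have : (i != m :> nat) by apply: contra im => /eqP im; apply/eqP/val_inj.
  rewrite neq_ltn => /orP[im'|im'].
    apply: (@intT_cexp _ _ (m - i)); first by rewrite subn_gt0.
    by right; rewrite natrB ?opprB// ltnW.
  apply: (@intT_cexp _ _ (i - m)); first by rewrite subn_gt0.
  by left; rewrite natrB// ltnW.
have bmp : bm (fun y => complex.Re (u * (p.[rho%:C * cexp y] * cexp (- (m%:R * y))))).
  under eq_fun do rewrite horner_coef mulr_suml !mulr_sumr Re_sum.
  apply: bm_sum => k.
  under eq_fun => y do rewrite exprMn cexpX -2!mulrA -cexpD !mulrA -mulrBl.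
  exact: bm_Re_cexp.
rewrite -[leRHS]intT_cst; apply: le_intT => //; first exact: bm_cst.
move=> y _; apply: le_trans (Re_le_normc _) _.
rewrite !normcM u1 normc_cexp mul1r mulr1; apply: pB.
by rewrite normcM normc_cexp mulr1 normc_realE ger0_norm.
Qed.

End fourier.

(** * Oscillation of the Herglotz kernel and balanced weights *)

Section kernel_estimates.
Variable R : realType.
Implicit Types (w : R -> R) (u z : R[i]) (s y : R).
Local Notation leb := (@lebesgue_measure R).
Local Open Scope complex_scope.

(** Put d = 1 - |z| and B = |1 - (1 - s) z cexp (- y0)|. If B >= 4 s, both denominators in [hergB]
    are at least B / 2 and the difference is at most 8 s / B^2. Otherwise the trivial bound 4 / d
    suffices, since B^2 < 16 s^2. Shrinking z by 1 - s makes the Poisson numerator at least s and at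
    least d; this absorbs the terms 8 s and 64 s^2 / d, whence 72 = 8 + 64. *)
Lemma herg_osc z s y y' y0 : normc z < 1 -> 0 < s <= 1 ->
  normc (cexp (- y) - cexp (- y')) <= s ->
  normc (cexp (- y) - cexp (- y0)) <= s ->
  normc (cexp (- y') - cexp (- y0)) <= s ->
  normc (herg (z * cexp (- y)) - herg (z * cexp (- y'))) <=
  72 * (s / (1 - normc z)) * complex.Re (herg ((1 - s)%:C * z * cexp (- y0))).
Proof.
move=> z1 /andP[s0 s1] yy' yy0 y'y0.
have nze v : normc (z * cexp (- v)) = normc z by rewrite normcM normc_cexp mulr1.
set z' := (1 - s)%:C * z.
have nz' : normc z' = (1 - s) * normc z by rewrite normcM normc_realE ger0_norm ?subr_ge0.
have nz'e : normc (z' * cexp (- y0)) = (1 - s) * normc z by rewrite normcM normc_cexp mulr1.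
pose d : R := 1 - normc z; rewrite -/d; have d0 : 0 < d by rewrite subr_gt0.
have z0 := normc_ge0 z.
pose B : R := normc (1 - z' * cexp (- y0)).
have B0 : s <= B.
  apply: le_trans (normc_1B _); rewrite nz'e.
  by rewrite -[leLHS](_ : 1 - (1 - s) * 1 = s) ?lerD2l ?lerN2; [rewrite ler_wpM2l//; lra|ring].
have BA v : normc (cexp (- v) - cexp (- y0)) <= s ->
    B - 2 * s <= normc (1 - z * cexp (- v)).
  move=> vy0; have : B <= normc (1 - z * cexp (- v)) + normc (z * cexp (- v) - z' * cexp (- y0)).
    apply: le_trans (ler_normcD _ _); rewrite /B le_eqVlt; apply/orP; left.
    by apply/eqP; congr normc; ring.
  suff : normc (z * cexp (- v) - z' * cexp (- y0)) <= 2 * s by lra.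
  have -> : z * cexp (- v) - z' * cexp (- y0) =
     z * (cexp (- v) - cexp (- y0)) + s%:C * z * cexp (- y0).
    by rewrite /z' rmorphB rmorph1; ring.
  apply: le_trans (ler_normcD _ _) _.
  rewrite !normcM normc_cexp normc_realE (ger0_norm (ltW s0)) mulr1.
  have : normc z * normc (cexp (- v) - cexp (- y0)) <= 1 * s.
    by apply: ler_pM; rewrite ?normc_ge0// ltW.
  have : s * normc z <= s * 1 by rewrite ler_wpM2l// ltW.
  lra.
have dA v : d <= normc (1 - z * cexp (- v)).
  by apply: le_trans (normc_1B _); rewrite nze.
rewrite Re_herg -/B nz'e.
have Bgt0 : 0 < B by apply: lt_le_trans B0.
have B2 : 0 < B ^+ 2 by rewrite exprn_gt0.
have iB : 0 <= (B ^+ 2)^-1 by rewrite invr_ge0 ltW.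
have num : s <= 1 - ((1 - s) * normc z) ^+ 2 /\ d <= 1 - ((1 - s) * normc z) ^+ 2.
  have h1 : (1 - s) * normc z <= 1 - s by rewrite ler_piMr ?subr_ge0// ltW.
  have h2 : (1 - s) * normc z <= normc z by rewrite ler_piMl// lerBlDr lerDl ltW.
  have h0 : 0 <= (1 - s) * normc z by rewrite mulr_ge0 ?subr_ge0.
  have : ((1 - s) * normc z) ^+ 2 <= (1 - s) * normc z.
    by rewrite expr2 ler_piMr//; lra.
  by rewrite /d; split; lra.
suff osc : normc (herg (z * cexp (- y)) - herg (z * cexp (- y'))) <=
    (8 * s + 64 * s ^+ 2 / d) / B ^+ 2.
  apply: le_trans osc _; rewrite [leRHS]mulrA ler_wpM2r//.
  move: num; set q := 1 - _ => -[n1 n2].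
  have sd : 0 <= s / d by rewrite divr_ge0// ltW.
  have h1 : s <= s / d * q by have := ler_wpM2l sd n2; rewrite divfK ?gt_eqF.
  have h2 : 64 * s ^+ 2 / d <= 64 * (s / d * q).
    rewrite -mulrA ler_pM2l// expr2 mulrAC ler_wpM2l//.
  by rewrite -[leRHS]mulrA; lra.
have e0 : 0 <= 8 * s by rewrite mulr_ge0// ltW.
have e1 : 0 <= 64 * s ^+ 2 / d by rewrite !mulr_ge0 ?invr_ge0 ?ltW// exprn_ge0// ltW.
have [Bs|Bs] := leP (4 * s) B.
  rewrite hergB ?nze// -mulrBr normcM.
  apply: le_trans (_ : 8 * s / B ^+ 2 <= _); last first.
    by rewrite ler_wpM2r// lerDl.
  have a1 := BA _ yy0; have a2 := BA _ y'y0.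
  have -> : 8 * s / B ^+ 2 = (2 * s) / ((B / 2) * (B / 2)).
    by field; rewrite gt_eqF.
  apply: ler_pM.
  - by rewrite !mulr_ge0 ?normc_ge0.
  - by rewrite invr_ge0 mulr_ge0 ?normc_ge0.
  - rewrite ler_pM2l//; apply: le_trans yy'.
    by rewrite ler_piMl ?normc_ge0// ltW.
  - have h3 : B / 2 <= normc (1 - z * cexp (- y)) by lra.
    have h4 : B / 2 <= normc (1 - z * cexp (- y')) by lra.
    have h5 : 0 < B / 2 by lra.
    rewrite lef_pV2 ?posrE; first by apply: ler_pM => //; exact: ltW.
      by rewrite mulr_gt0//; lra.
    by rewrite mulr_gt0.
apply: le_trans (_ : 64 * s ^+ 2 / d / B ^+ 2 <= _); last first.
  by rewrite ler_wpM2r// lerDr.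
apply: le_trans (_ : 4 / d <= _).
  have hh v : normc (herg (z * cexp (- v))) <= 2 / d.
    apply: le_trans (herg_le _) _; first by rewrite nze.
    by rewrite ler_pM2l// lef_pV2 ?posrE// (lt_le_trans d0).
  by apply: le_trans (ler_normcB _ _) _; have := hh y; have := hh y'; lra.
rewrite -mulrA [d^-1 / _]mulrC mulrA ler_wpM2r ?invr_ge0 ?(ltW d0)//.
rewrite ler_pdivlMr// -(_ : 4 * (4 * s) ^+ 2 = 64 * s ^+ 2); last by ring.
by rewrite ler_pM2l// lerXn2r ?nnegrE ?mulr_ge0// ltW.
Qed.

Definition cell (n j : nat) : set R := `[j%:R / n%:R, j.+1%:R / n%:R[.

Lemma measurable_cell n j : measurable (cell n j).
Proof. exact: measurable_itv. Qed.

Lemma leb_cell n j : (0 < n)%N -> leb (cell n j) = (n%:R^-1)%:E.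
Proof.
move=> n0; rewrite /cell lebesgue_measure_itv/= lte_fin ltr_pM2r ?invr_gt0 ?ltr0n//.
rewrite ltr_nat ltnSn -EFinB -mulrBl -natrB ?leqnSn// subSnn.
by rewrite mul1r.
Qed.

Lemma leb_cell_lty n j : (0 < n)%N -> (leb (cell n j) < +oo)%E.
Proof. by move=> n0; rewrite leb_cell// ltry. Qed.

Lemma leb_itvco_lty (a b : R) : (leb `[a, b[ < +oo)%E.
Proof.
by rewrite lebesgue_measure_itv/= lte_fin; case: ifP => _; rewrite ?ltry// -EFinB ltry.
Qed.

Lemma cell_dist n j y y' : (0 < n)%N -> cell n j y -> cell n j y' ->
  `|y - y'| <= n%:R^-1.
Proof.
move=> n0; rewrite /cell /= !in_itv /= => /andP[h1 h2] /andP[h3 h4].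
have : (j.+1%:R / n%:R : R) = j%:R / n%:R + n%:R^-1 by rewrite -natr1 mulrDl mul1r.
by move=> e; rewrite e in h2 h4; rewrite ler_norml; lra.
Qed.

Lemma cell_left n j : (0 < n)%N -> cell n j (j%:R / n%:R).
Proof.
move=> n0; rewrite /cell /= in_itv /= lexx /= ltr_pM2r ?invr_gt0 ?ltr0n//.
by rewrite ltr_nat ltnSn.
Qed.

Lemma intT_cell n (f : R -> R) : (0 < n)%N -> bm f ->
  intT f = \sum_(j < n) \int[leb]_(y in cell n j) f y.
Proof.
move=> n0 bf.
have n0' : (0 : R) < n%:R by rewrite ltr0n.
suff H m : (m <= n)%N -> \int[leb]_(y in `[0, m%:R / n%:R[) f y =
    \sum_(j < m) \int[leb]_(y in cell n j) f y.
  by rewrite -H// divff ?gt_eqF.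
elim: m => [_|m IH mn].
  by rewrite big_ord0 mul0r set_itvco0 Rintegral_set0.
rewrite big_ord_recr /= -IH ?(ltnW mn)// -bm_RintU//.
- congr Rintegral; rewrite /cell; apply/seteqP; split => y /=; rewrite !in_itv /=.
    by case: (ltP y (m%:R / n%:R)) => h /andP[h1 h2]; [left|right]; apply/andP.
  have mn' : m%:R / n%:R <= m.+1%:R / n%:R :> R.
    by rewrite ler_pM2r ?invr_gt0// ler_nat.
  have m0 : 0 <= m%:R / n%:R :> R by rewrite divr_ge0.
  by case=> /andP[h1 h2]; apply/andP; split => //; lra.
- exact: measurable_cell.
- exact: leb_itvco_lty.
- exact: leb_cell_lty.
- apply/seteqP; split => // y [] /=; rewrite /cell /= !in_itv /=.
  by move=> /andP[_ h1] /andP[h2 _]; move: (le_lt_trans h2 h1); rewrite ltxx.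
Qed.

Section balanced.
Variables (n : nat) (N : R) (w : R -> R).
Hypotheses (n0 : (0 < n)%N) (bw : bm w).
Hypothesis wbal : forall j, (j < n)%N -> \int[leb]_(y in cell n j) w y = 0.
Hypothesis wmass : forall j, (j < n)%N ->
  \int[leb]_(y in cell n j) `|w y| <= 2 * N / n%:R.

(** Since [w] has mean zero on the cell, [F] may be replaced by its difference with its value at the
    left end. *)
Lemma cell_balanced_le j (F : R -> R) (q : R) : (j < n)%N -> bm F -> 0 <= q ->
  (forall y, cell n j y -> w y = 0) \/
  (forall y, cell n j y -> `|F y - F (j%:R / n%:R)| <= q) ->
  `|\int[leb]_(y in cell n j) (w y * F y)| <= q * (2 * N / n%:R).
Proof.
move=> jn bF q0 hF; pose y0 : R := j%:R / n%:R.
have fc := leb_cell_lty j n0; have mc := @measurable_cell n j.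
have -> : \int[leb]_(y in cell n j) (w y * F y) =
   \int[leb]_(y in cell n j) (w y * (F y - F y0)).
  have -> : \int[leb]_(y in cell n j) (w y * (F y - F y0)) =
     \int[leb]_(y in cell n j) (w y * F y - F y0 * w y).
    by apply: eq_Rintegral => y _; ring.
  rewrite bm_RintB//; [|exact: bmM|by apply: bmM => //; exact: bm_cst].
  by rewrite bm_RintZl// wbal// mulr0 subr0.
apply: le_trans (_ : \int[leb]_(y in cell n j) (q * `|w y|) <= _).
  apply: bm_Rint_norm_le => //.
  - by apply: bmM => //; apply: bmB => //; exact: bm_cst.
  - by apply: bmM; [exact: bm_cst|exact: bm_norm].
  - move=> y cy; case: hF => [/(_ _ cy) ->|/(_ _ cy) h].
      by rewrite mul0r !normr0 mulr0.
    by rewrite normrM mulrC ler_wpM2r.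
by rewrite bm_RintZl//; [rewrite ler_wpM2l//; exact: wmass|exact: bm_norm].
Qed.

Variables (D : nat) (r kappa : R).
Hypotheses (r1 : r < 1) (kappa0 : 0 <= kappa).
Hypothesis rk : 2 * r ^+ D.+1 / (1 - r) <= kappa.

Lemma hergt_osc u z y y' : normc u = 1 -> normc z <= r ->
  `|complex.Re (u * hergt D (z * cexp (- y))) - complex.Re (u * hergt D (z * cexp (- y')))|
  <= normc (herg (z * cexp (- y)) - herg (z * cexp (- y'))) + 2 * kappa.
Proof.
move=> u1 zr; rewrite -ReB -mulrBr; apply: le_trans (normr_Re_le _) _.
rewrite normcM u1 mul1r.
have t v : normc (hergt D (z * cexp (- v)) - herg (z * cexp (- v))) <= kappa.
  by apply: le_trans rk; apply: herg_trunc => //; rewrite normcM normc_cexp mulr1.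
rewrite (_ : _ - _ = (hergt D (z * cexp (- y)) - herg (z * cexp (- y)))
   - (hergt D (z * cexp (- y')) - herg (z * cexp (- y')))
   + (herg (z * cexp (- y)) - herg (z * cexp (- y')))); last by ring.
apply: le_trans (ler_normcD _ _) _; rewrite addrC lerD2l.
by apply: le_trans (ler_normcB _ _) _; have := t y; have := t y'; lra.
Qed.

Lemma cell_cexp j y y' : cell n j y -> cell n j y' ->
  normc (cexp (- y) - cexp (- y')) <= 16 / n%:R.
Proof.
move=> cy cy'; apply: le_trans (cexp_lip _ _) _.
by rewrite ler_pM2l// opprK addrC distrC; have := cell_dist n0 cy cy'; rewrite distrC.
Qed.

(** On each cell the oscillation of the kernel is at most [G y0] for every [y0] of that cell, so
    this bound may be averaged over [y0]. Summed over the cells, the averages give the integral of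
    [G], which [intT_hergt] computes and which does not grow with the number of cells. *)
Lemma intT_balanced_le u z : normc u = 1 -> normc z <= r -> 16 / n%:R <= 1 :> R ->
  `|intT (fun y => w y * complex.Re (u * hergt D (z * cexp (- y))))| <=
  2 * N * (72 * (16 / n%:R / (1 - normc z)) * (1 + kappa) + 2 * kappa).
Proof.
move=> u1 zr s1; set s : R := 16 / n%:R; pose F y := complex.Re (u * hergt D (z * cexp (- y))).
rewrite -[X in `|X|]/(intT (fun y => w y * F y)).
have n0' : (0 : R) < n%:R by rewrite ltr0n.
have s0 : 0 < s by rewrite divr_gt0.
have bF : bm F by exact: bm_hergt.
have z1 : normc z < 1 by exact: le_lt_trans zr r1.
have d0 : 0 < 1 - normc z by rewrite subr_gt0.
(* The real part of [hergt] stands for the Poisson kernel of [herg_osc], because its integral is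
   known exactly; the terms in [kappa] pay for exchanging [hergt] and [herg]. *)
pose G y0 := 72 * (s / (1 - normc z)) *
   (complex.Re (1 * hergt D ((1 - s)%:C * z * cexp (- y0))) + kappa) + 2 * kappa.
have bG : bm G.
  apply: bmD; last exact: bm_cst.
  apply: bmM; first exact: bm_cst.
  by apply: bmD; [exact: bm_hergt|exact: bm_cst].
have -> : 2 * N * (72 * (s / (1 - normc z)) * (1 + kappa) + 2 * kappa) = 2 * N * intT G.
  congr (_ * _); rewrite /G intTD//; [|apply: bmM|exact: bm_cst].
  - rewrite intTZl; last by apply: bmD; [exact: bm_hergt|exact: bm_cst].
    by rewrite intTD ?intT_cst ?intT_hergt//; [exact: bm_hergt|exact: bm_cst].
  - exact: bm_cst.
  - by apply: bmD; [exact: bm_hergt|exact: bm_cst].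
rewrite (intT_cell n0) ?(intT_cell n0 bG); last exact: bmM.
rewrite mulr_sumr; apply: le_trans (ler_norm_sum _ _ _) _; apply: ler_sum => j _.
have fc := leb_cell_lty j n0; have mc := @measurable_cell n j.
have key y0 : cell n j y0 ->
   `|\int[leb]_(y in cell n j) (w y * F y)| <= G y0 * (2 * N / n%:R).
  move=> cy0; have h y : cell n j y -> `|F y - F (j%:R / n%:R)| <= G y0.
    move=> cy; have cl := cell_left j n0.
    apply: le_trans (hergt_osc _ _ u1 zr) _; rewrite lerD2r.
    have := @herg_osc z s y (j%:R / n%:R) y0 z1.
    rewrite s0 s1 => /(_ isT (cell_cexp cy cl) (cell_cexp cy cy0) (cell_cexp cl cy0)).
    move=> /le_trans; apply.
    rewrite ler_pM2l; last by rewrite mulr_gt0// divr_gt0.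
    rewrite mul1r -lerBlDl -ReB; apply: le_trans (Re_le_normc _) _.
    rewrite normcBC; apply: le_trans rk; apply: herg_trunc => //.
    rewrite !normcM normc_cexp mulr1 normc_realE ger0_norm ?subr_ge0//.
    by apply: le_trans zr; rewrite ler_piMl ?normc_ge0// lerBlDr lerDl ltW.
  apply: cell_balanced_le => //; last by right.
  exact: le_trans (normr_ge0 _) (h _ cy0).
set q := `|_| in key *.
suff : q * fine (leb (cell n j)) <= (2 * N / n%:R) * \int[leb]_(y in cell n j) G y.
  by rewrite leb_cell//= mulrAC ler_pM2r// invr_gt0.
rewrite -Rintegral_cst// -bm_RintZl//; apply: bm_le_Rint => //.
- exact: bm_cst.
- by apply: bmM => //; exact: bm_cst.
- by move=> y /key; rewrite mulrC.
Qed.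

(** On cells at distance c from the pole, the kernel oscillates by at most 2 (16 / n) / c^2; this
    bound does not degrade as |z| tends to 1. *)
Lemma intT_balanced_far_le u z (c : R) : normc u = 1 -> normc z <= r -> 0 < c ->
  (forall j, (j < n)%N -> (forall y, cell n j y -> w y = 0) \/
    (forall y, cell n j y -> c <= normc (1 - z * cexp (- y)))) ->
  `|intT (fun y => w y * complex.Re (u * hergt D (z * cexp (- y))))| <=
  2 * N * (2 * (16 / n%:R) / c ^+ 2 + 2 * kappa).
Proof.
move=> u1 zr c0 hw; have n0' : (0 : R) < n%:R by rewrite ltr0n.
pose F y := complex.Re (u * hergt D (z * cexp (- y))).
rewrite -[X in `|X|]/(intT (fun y => w y * F y)).
have bF : bm F by exact: bm_hergt.
rewrite (intT_cell n0); last exact: bmM.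
apply: le_trans (ler_norm_sum _ _ _) _.
set q := _ + 2 * kappa.
have q0 : 0 <= q by rewrite addr_ge0 ?mulr_ge0// ?invr_ge0 ?exprn_ge0 ?ltW.
apply: le_trans (_ : \sum_(j < n) q * (2 * N / n%:R) <= _); last first.
  rewrite sumr_const card_ord -mulr_natl le_eqVlt; apply/orP; left; apply/eqP.
  by field; rewrite gt_eqF.
apply: ler_sum => j _; apply: cell_balanced_le => //.
case: (hw j (ltn_ord j)) => [|hc]; [by left|right => y cy].
have cl := cell_left j n0.
apply: le_trans (hergt_osc _ _ u1 zr) _; rewrite lerD2r.
have nz v : normc (z * cexp (- v)) < 1 by rewrite normcM normc_cexp mulr1 (le_lt_trans zr).
rewrite hergB// -mulrBr normcM.
apply: ler_pM.
- by rewrite !mulr_ge0 ?normc_ge0.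
- by rewrite invr_ge0 mulr_ge0 ?normc_ge0.
- rewrite ler_pM2l//; apply: le_trans (cell_cexp cy cl).
  by rewrite ler_piMl ?normc_ge0// ltW// (le_lt_trans zr).
- rewrite lef_pV2 ?posrE ?exprn_gt0//; last by rewrite mulr_gt0// (lt_le_trans c0)// hc.
  by rewrite expr2; apply: ler_pM; rewrite ?hc// ltW.
Qed.

End balanced.
End kernel_estimates.

(** * Herglotz polynomials of approximately balanced weights *)

Section herglotz_polynomials.
Variable R : realType.
Implicit Types (w : R -> R) (u z : R[i]) (x y : R).
Local Open Scope complex_scope.

(** The triangle inequality, combined with 1 - r <= |1 - r z|. *)
Lemma normc_1B_scale (r : R) z : 0 <= r <= 1 -> normc z = 1 ->
  normc (1 - z) <= 2 * normc (1 - r%:C * z).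
Proof.
move=> /andP[r0 r1] z1.
have nr : normc (r%:C * z) = r by rewrite normcM normc_realE z1 mulr1 ger0_norm.
have := normc_1B (r%:C * z); rewrite nr.
have : normc (1 - z) <= normc (1 - r%:C * z) + normc ((1 - r)%:C * z).
  apply: le_trans (ler_normcB _ _); rewrite le_eqVlt; apply/orP; left; apply/eqP.
  have -> : (1 - r)%:C = 1 - r%:C :> R[i] by rewrite rmorphB.
  by congr normc; ring.
by rewrite [normc (_%:C * z)]normcM normc_realE z1 mulr1 ger0_norm ?subr_ge0//; lra.
Qed.

Lemma exists_expr_small (r e : R) : 0 <= r < 1 -> 0 < e -> exists n, r ^+ n <= e.
Proof.
move=> /andP[r0 r1] e0.
have r1' : `|r| < 1 by rewrite ger0_norm.
have /cvgrPdist_le /(_ _ e0) [n _ /(_ n (leqnn n))] := cvg_expr r1'.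
by rewrite /= sub0r normrN ger0_norm ?exprn_ge0//; exists n.
Qed.

Lemma intT_kernel_le (f : R -> R) u z (D : nat) (B : R) : bm f -> normc u = 1 ->
  (forall y, Tpar y -> f y = 0 \/ normc (hergt D (z * cexp (- y))) <= B) ->
  `|intT (fun y => f y * complex.Re (u * hergt D (z * cexp (- y))))| <=
  B * intT (fun y => `|f y|).
Proof.
move=> bf u1 fB; rewrite -intTZl; last exact: bm_norm.
apply: intT_norm_le.
- by apply: bmM => //; exact: bm_hergt.
- by apply: bmM; [exact: bm_cst|exact: bm_norm].
- move=> y /fB[->|h]; first by rewrite mul0r normr0 mulr0.
  rewrite normrM mulrC ler_wpM2r//; apply: le_trans (normr_Re_le _) _.
  by rewrite normcM u1 mul1r.
Qed.

Section approx.
Variables (D : nat) (r kappa : R).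
Hypotheses (r01 : 0 <= r < 1) (kappa0 : 0 <= kappa).
Hypothesis rk : 2 * r ^+ D.+1 / (1 - r) <= kappa.

Lemma normc_rM z : normc (r%:C * z) = r * normc z.
Proof. by rewrite normcM normc_realE ger0_norm//; case/andP: r01. Qed.

Lemma hergt_near z : normc z <= r -> normc (hergt D z - herg z) <= kappa.
Proof.
by case/andP: r01 => _ r1 zr; apply: le_trans rk; exact: herg_trunc.
Qed.

Lemma Re_hergt_near z : normc z <= r ->
  `|complex.Re (hergt D z) - complex.Re (herg z)| <= kappa.
Proof. by move=> /hergt_near; apply: le_trans; rewrite -ReB normr_Re_le. Qed.

Lemma hergt_le z : normc z <= r ->
  normc (hergt D z) <= 2 / normc (1 - z) + kappa.
Proof.
move=> zr; rewrite -(subrK (herg z) (hergt D z)) addrC.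
apply: le_trans (ler_normcD _ _) _; apply: lerD; last exact: hergt_near.
by apply: herg_le; apply: le_lt_trans zr _; case/andP: r01.
Qed.

(** One half of the Poisson approximation of a continuous function. Where [cexp y] is close to
    [cexp x], [w y] is within [tau] of [w x]; elsewhere the Poisson kernel is at most 8 (1 - r) /
    c^2. The terms in [kappa] account for the truncated kernel, which may dip below 0. *)
Lemma Re_Hpoly_le w (M tau c : R) x : bm w -> Tpar x -> 0 < M ->
  (forall y, `|w y| <= M) -> 0 < tau -> 0 < c ->
  (forall y, Tpar y -> normc (1 - cexp (x - y)) < c -> `|w y - w x| <= tau) ->
  complex.Re (herg_poly w r D).[cexp x] <=
  w x + (tau * (1 + kappa) + 16 * M * (1 - r) / c ^+ 2 + 2 * M * kappa).
Proof.
move=> bw Tx M0 wM tau0 c0 wuc; case/andP: (r01) => r0 r1.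
pose h y := complex.Re (1 * hergt D (r%:C * cexp x * cexp (- y))).
have bh : bm h by exact: bm_hergt.
have hb v : bm (fun y => v * h y) by apply: bmM => //; exact: bm_cst.
have := Re_herg_poly r D 1 (cexp x) bw; rewrite mul1r => ->.
rewrite -[X in X <= _]/(intT (fun y => w y * h y)) -lerBlDl.
have -> : w x = intT (fun y => w x * h y) by rewrite intTZl// intT_hergt/= mulr1.
rewrite -intTB//; last exact: bmM.
set q := 16 * M * (1 - r) / c ^+ 2.
have -> : tau * (1 + kappa) + q + 2 * M * kappa =
   intT (fun y => tau * h y + (tau * kappa + q + 2 * M * kappa)).
  by rewrite intTD ?intT_cst ?intTZl ?intT_hergt//=; [ring|exact: bm_cst].
apply: le_intT.
- by apply: bmB => //; exact: bmM.
- by apply: bmD => //; exact: bm_cst.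
move=> y Ty; rewrite -mulrBl.
pose e := cexp (x - y).
have ne : normc e = 1 by rewrite normc_cexp.
have ze : r%:C * cexp x * cexp (- y) = r%:C * e by rewrite -mulrA -cexpD.
pose P := complex.Re (herg (r%:C * e)).
have hP : `|h y - P| <= kappa.
  by rewrite /h mul1r ze; apply: Re_hergt_near; rewrite normc_rM ne mulr1.
have nre : normc (r%:C * e) = r by rewrite normc_rM ne mulr1.
have PE : P = (1 - r ^+ 2) / normc (1 - r%:C * e) ^+ 2 by rewrite /P Re_herg nre.
have r2 : r ^+ 2 <= 1 by rewrite exprn_ile1// ltW.
have P0 : 0 <= P by rewrite PE divr_ge0 ?sqr_ge0// subr_ge0.
have a2 : `|w y - w x| <= 2 * M.
  by apply: le_trans (ler_normB _ _) _; have := wM y; have := wM x; lra.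
have s1 : (w y - w x) * h y <= `|w y - w x| * P + 2 * M * kappa.
  have -> : (w y - w x) * h y = (w y - w x) * P + (w y - w x) * (h y - P) by ring.
  apply: lerD; first by rewrite ler_wpM2r// ler_norm.
  by apply: le_trans (ler_norm _) _; rewrite normrM ler_pM.
have hP' : P <= h y + kappa by move: hP; rewrite ler_norml; lra.
have q0 : 0 <= q by rewrite /q divr_ge0 ?sqr_ge0// !mulr_ge0 ?subr_ge0// ltW.
suff : `|w y - w x| * P <= tau * (h y + kappa) + q by lra.
have [/(wuc _ Ty) near|far] := ltP (normc (1 - e)) c.
  apply: le_trans (_ : tau * P <= _); first by rewrite ler_wpM2r.
  by rewrite -[leLHS]addr0; apply: lerD => //; rewrite ler_pM2l.
rewrite -[leLHS]add0r; apply: lerD.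
  by rewrite mulr_ge0 ?(ltW tau0)//; lra.
apply: le_trans (_ : 2 * M * P <= _); first by rewrite ler_wpM2r.
have far2 : c / 2 <= normc (1 - r%:C * e).
  have := normc_1B_scale (r := r) _ ne; rewrite r0 (ltW r1) => /(_ isT).
  by move: far; lra.
have c2 : 0 < c ^+ 2 by rewrite exprn_gt0.
have -> : q = 2 * M * (8 * (1 - r) / c ^+ 2) by rewrite /q; ring.
rewrite ler_wpM2l ?mulr_ge0 ?(ltW M0)// PE.
have -> : 8 * (1 - r) / c ^+ 2 = (2 * (1 - r)) / (c / 2) ^+ 2.
  by field; rewrite gt_eqF.
have c20 : 0 < c / 2 by rewrite divr_gt0.
apply: ler_pM.
- by rewrite subr_ge0.
- by rewrite invr_ge0 sqr_ge0.
- have : 0 <= (1 - r) ^+ 2 by rewrite sqr_ge0.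
  by rewrite sqrrB; lra.
- rewrite lef_pV2 ?posrE ?exprn_gt0//; last exact: lt_le_trans far2.
  by rewrite lerXn2r// nnegrE ltW// (lt_le_trans c20).
Qed.

End approx.

(** [S] is [herg_poly w r D] with r near 1 and D large. The part [w - w0], small in L^1, is
    estimated by the supremum of the kernel, and [w0] by cancellation on cells. Points of [X] are
    far from both, so there the kernel stays bounded up to the circle. *)
Lemma exists_herglotz_poly w w0 (n : nat) (N M eta c0 e : R) (X : set R) :
  (16 <= n)%N -> 0 <= N -> bm w -> bm w0 ->
  (forall j, (j < n)%N -> \int[@lebesgue_measure R]_(y in cell n j) w0 y = 0) ->
  (forall j, (j < n)%N ->
     \int[@lebesgue_measure R]_(y in cell n j) `|w0 y| <= 2 * N / n%:R) ->
  0 < M -> (forall y, `|w y| <= M) ->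
  (forall tau : R, 0 < tau -> exists2 c : R, 0 < c & forall x y, Tpar x -> Tpar y ->
     normc (1 - cexp (x - y)) < c -> `|w y - w x| <= tau) ->
  intT (fun y => `|w y - w0 y|) <= eta ->
  X `<=` Tpar -> 0 < c0 <= 1 ->
  (forall x, X x -> forall j, (j < n)%N -> (forall y, cell n j y -> w0 y = 0) \/
    (forall y, cell n j y -> c0 <= normc (1 - cexp (x - y)))) ->
  (forall x, X x -> forall y, Tpar y -> w y - w0 y = 0 \/
    c0 <= normc (1 - cexp (x - y))) ->
  0 < e ->
  exists S : {poly R[i]}, [/\
    forall z, normc z < 1 -> normc S.[z] <= (3 * eta + 5000 * N / n%:R) / (1 - normc z),
    forall x, Tpar x -> complex.Re S.[cexp x] <= w x + e &
    forall x, X x -> normc S.[cexp x] <= 5 * eta / c0 + 260 * N / n%:R / c0 ^+ 2].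
Proof.
move=> n16 N0 bw bw0 wbal wmass M0 wM wuc weta XT /andP[c00 c01] Xw0 Xw e0.
have n0 : (0 < n)%N by apply: leq_trans n16.
have n0' : (0 : R) < n%:R by rewrite ltr0n.
have s1 : 16 / n%:R <= 1 :> R by rewrite ler_pdivrMr// mul1r ler_nat.
have e4 : 0 < e / 4 by rewrite divr_gt0.
have [c cgt0 cuc] := wuc _ e4.
have eta0 : 0 <= eta by apply: le_trans weta; apply: intT_ge0.
(* This makes the far part 16 M (1 - r) / c^2 of [Re_Hpoly_le] at most e / 4. *)
pose rho : R := Num.min (1 / 2) (c ^+ 2 * e / (64 * M)).
have rho0 : 0 < rho.
  by rewrite lt_min; apply/andP; split; rewrite ?divr_gt0 ?mulr_gt0 ?exprn_gt0.
have rho1 : rho <= 1 / 2 by rewrite ge_min lexx.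
have rho2 : rho <= c ^+ 2 * e / (64 * M) by rewrite ge_min lexx orbT.
pose r : R := 1 - rho.
have r01 : 0 <= r < 1 by rewrite /r; apply/andP; split; lra.
have r12 : r < 1 by case/andP: r01.
(* The bound 1 / n hides the truncation errors in the terms N / n; the bound e / (8 M) makes 2 M
   kappa at most e / 4. *)
pose kappa : R := Num.min (1 / n%:R) (e / (8 * M)).
have k0 : 0 < kappa by rewrite lt_min; apply/andP; split; rewrite divr_gt0 ?mulr_gt0.
have k1 : kappa <= 1 / n%:R by rewrite ge_min lexx.
have k2 : kappa <= e / (8 * M) by rewrite ge_min lexx orbT.
have k3 : kappa <= 1.
  by apply: le_trans k1 _; rewrite ler_pdivrMr// mul1r ler1n.
have [D rD] : exists D, 2 * r ^+ D.+1 / (1 - r) <= kappa.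
  have [D hD] := exists_expr_small r01 (mulr_gt0 k0 (divr_gt0 rho0 (ltr0Sn R 1))).
  exists D; rewrite /r subKr ler_pdivrMr// exprS mulrCA.
  have : r * r ^+ D <= 1 * r ^+ D by rewrite ler_wpM2r ?exprn_ge0//; lra.
  by rewrite /r in hD *; lra.
have k0' := ltW k0.
exists (herg_poly w r D); split.
- move=> z z1; apply: normc_le_Re => u u1; rewrite Re_herg_poly//.
  have d0 : 0 < 1 - normc z by rewrite subr_gt0.
  have rz : normc (r%:C * z) <= normc z.
    by rewrite (normc_rM r01) ler_piMl ?normc_ge0//; lra.
  have rzr : normc (r%:C * z) <= r.
    by rewrite (normc_rM r01) ler_piMr// ?(ltW z1)//; case/andP: r01.
  pose h y := complex.Re (u * hergt D (r%:C * z * cexp (- y))).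
  have bh : bm h by exact: bm_hergt.
  have bd : bm (fun y => w y - w0 y) by exact: bmB.
  have -> : intT (fun y => w y * h y) = intT (fun y => (w y - w0 y) * h y) + intT (fun y => w0 y * h y).
    by rewrite -intTD; [apply: eq_intT => y; ring|exact: bmM|exact: bmM].
  have i0 : 0 < (1 - normc z)^-1 by rewrite invr_gt0.
  have i1 : 1 <= (1 - normc z)^-1 by rewrite invf_ge1// gerBl normc_ge0.
  have A1 : intT (fun y => (w y - w0 y) * h y) <= 3 * (1 - normc z)^-1 * eta.
    apply: le_trans (ler_norm _) _.
    apply: le_trans (intT_kernel_le (B := 3 * (1 - normc z)^-1) bd u1 _) _.
      move=> y _; right; apply: le_trans (hergt_le r01 rD _) _.
        by rewrite normcM normc_cexp mulr1.
      have : 2 / normc (1 - r%:C * z * cexp (- y)) <= 2 / (1 - normc z).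
        rewrite ler_pM2l// lef_pV2 ?posrE//.
          apply: le_trans (normc_1B _); rewrite normcM normc_cexp mulr1.
          by rewrite lerD2l lerN2.
        apply: lt_le_trans (normc_1B _); rewrite normcM normc_cexp mulr1.
        by apply: lt_le_trans d0 _; rewrite lerD2l lerN2.
      lra.
    by rewrite ler_wpM2l// mulr_ge0// ltW.
  (* The constant obtained is 2 (72 * 16 * 2 + 2) = 4612, the inner factor 2 being a bound for 1 +
     kappa. *)
  have A2 : intT (fun y => w0 y * h y) <= 5000 * N / n%:R * (1 - normc z)^-1.
    apply: le_trans (ler_norm _) _.
    apply: le_trans (intT_balanced_le n0 bw0 wbal wmass r12 rD u1 rzr s1) _.
    have i2 : (1 - normc (r%:C * z))^-1 <= (1 - normc z)^-1.
      rewrite lef_pV2 ?posrE ?lerD2l ?lerN2//.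
      by apply: lt_le_trans d0 _; rewrite lerD2l lerN2.
    have -> : 5000 * N / n%:R * (1 - normc z)^-1 =
       2 * N * (2500 * n%:R^-1 * (1 - normc z)^-1) by ring.
    rewrite ler_wpM2l ?mulr_ge0//.
    have in0 : 0 < (n%:R : R)^-1 by rewrite invr_gt0.
    have h1 : n%:R^-1 * (1 - normc (r%:C * z))^-1 <= n%:R^-1 * (1 - normc z)^-1.
      by rewrite ler_pM2l.
    have h2 : n%:R^-1 * 1 <= n%:R^-1 * (1 - normc z)^-1 by rewrite ler_pM2l.
    have h3 : 72 * (16 / n%:R / (1 - normc (r%:C * z))) * (1 + kappa) <=
        (72 * 16) * (n%:R^-1 * (1 - normc z)^-1) * 2.
      have -> : 72 * (16 / n%:R / (1 - normc (r%:C * z))) =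
          72 * 16 * (n%:R^-1 / (1 - normc (r%:C * z))) by ring.
      have a0 : 0 <= (1 - normc (r%:C * z))^-1.
        by rewrite invr_ge0 (le_trans (ltW d0))// lerD2l lerN2.
      apply: ler_pM.
      - by rewrite mulr_ge0 ?mulr_ge0// ltW.
      - by rewrite addr_ge0.
      - by rewrite ler_pM2l.
      - by rewrite -[leRHS](_ : 1 + 1 = 2)// lerD2l.
    rewrite div1r in k1; apply: le_trans (lerD h3 (_ : 2 * kappa <= 2 * (n%:R^-1 / (1 - normc z)))) _.
      by rewrite ler_pM2l// (le_trans k1)// -[leLHS]mulr1.
    have : 0 <= n%:R^-1 / (1 - normc z) by rewrite mulr_ge0// ltW.
    by rewrite -[2500 * _ / _]mulrA; clear; lra.
  apply: le_trans (lerD A1 A2) _.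
  by rewrite le_eqVlt; apply/orP; left; apply/eqP; ring.
- move=> x Tx; have := @Re_Hpoly_le D r kappa r01 rD w M (e / 4) c x.
  move=> /(_ bw Tx M0 wM e4 cgt0 (fun y Ty h => cuc x y Tx Ty h)) /le_trans; apply.
  rewrite lerD2l.
  have h1 : 16 * M * (1 - r) / c ^+ 2 <= e / 4.
    rewrite /r subKr ler_pdivrMr ?exprn_gt0// mulrC -ler_pdivlMr ?mulr_gt0//.
    by apply: le_trans rho2 _; rewrite le_eqVlt; apply/orP; left; apply/eqP; field; rewrite gt_eqF.
  have h2 : 2 * M * kappa <= e / 4.
    rewrite mulrC -ler_pdivlMr ?mulr_gt0//.
    by apply: le_trans k2 _; rewrite le_eqVlt; apply/orP; left; apply/eqP; field; rewrite gt_eqF.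
  have h3 : e / 4 * kappa <= e / 4 * 1 by rewrite ler_pM2l.
  lra.
- move=> x Xx; apply: normc_le_Re => u u1; rewrite Re_herg_poly//.
  have rzr : normc (r%:C * cexp x) <= r by rewrite (normc_rM r01) normc_cexp mulr1.
  pose h y := complex.Re (u * hergt D (r%:C * cexp x * cexp (- y))).
  have bh : bm h by exact: bm_hergt.
  have bd : bm (fun y => w y - w0 y) by exact: bmB.
  have -> : intT (fun y => w y * h y) = intT (fun y => (w y - w0 y) * h y) + intT (fun y => w0 y * h y).
    by rewrite -intTD; [apply: eq_intT => y; ring|exact: bmM|exact: bmM].
  have far y : c0 <= normc (1 - cexp (x - y)) ->
      c0 / 2 <= normc (1 - r%:C * cexp x * cexp (- y)).
    move=> h1; rewrite -mulrA -cexpD.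
    have := normc_1B_scale (r := r) _ (normc_cexp (x - y)).
    by rewrite (ltW r12) andbT; case/andP: r01 => -> _ /(_ isT); lra.
  have c20 : 0 < c0 / 2 by rewrite divr_gt0.
  have ic0 : 1 <= c0^-1 by rewrite invf_ge1.
  have ic20 : 1 <= (c0 ^+ 2)^-1 by rewrite invf_ge1 ?exprn_gt0// exprn_ile1// ltW.
  have A1 : intT (fun y => (w y - w0 y) * h y) <= 5 / c0 * eta.
    apply: le_trans (ler_norm _) _.
    apply: le_trans (intT_kernel_le (B := 5 / c0) bd u1 _) _.
      move=> y Ty; case: (Xw x Xx y Ty) => [|/far h1]; [by left|right].
      apply: le_trans (hergt_le r01 rD _) _; first by rewrite normcM normc_cexp mulr1.
      have : 2 / normc (1 - r%:C * cexp x * cexp (- y)) <= 2 / (c0 / 2).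
        by rewrite ler_pM2l// lef_pV2 ?posrE// (lt_le_trans c20).
      by rewrite invf_div; lra.
    by rewrite ler_wpM2l// divr_ge0// ltW.
  (* 260 = 2 (128 + 2): the 128 is 2 * 16 * 4, with 4 from halving [c0], and the 2 comes from 2
     kappa. *)
  have A2 : intT (fun y => w0 y * h y) <= 260 * N / n%:R / c0 ^+ 2.
    apply: le_trans (ler_norm _) _.
    have Xw0' j : (j < n)%N -> (forall y, cell n j y -> w0 y = 0) \/
       (forall y, cell n j y -> c0 / 2 <= normc (1 - r%:C * cexp x * cexp (- y))).
      by move=> /(Xw0 x Xx)[h1|h1]; [left|right => y /h1/far].
    apply: le_trans (intT_balanced_far_le n0 bw0 wbal wmass r12 k0' rD u1 rzr c20 Xw0') _.
    have -> : 2 * (16 / n%:R) / (c0 / 2) ^+ 2 = 128 * (n%:R^-1 * (c0 ^+ 2)^-1) :> R.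
      by field; rewrite !gt_eqF.
    have -> : 260 * N / n%:R / c0 ^+ 2 = 2 * N * (130 * (n%:R^-1 * (c0 ^+ 2)^-1)) by ring.
    rewrite ler_wpM2l ?mulr_ge0//.
    have : n%:R^-1 * 1 <= n%:R^-1 * (c0 ^+ 2)^-1 by rewrite ler_pM2l// invr_gt0.
    by rewrite div1r in k1; lra.
  apply: le_trans (lerD A1 A2) _.
  by rewrite le_eqVlt; apply/orP; left; apply/eqP; ring.
Qed.

End herglotz_polynomials.

(** * Polynomials imitating the exponential *)

Section power_polynomials.
Variable R : realType.
Implicit Types (x z : R[i]) (S p : {poly R[i]}).
Local Open Scope complex_scope.

Lemma normc_1DXB1 x m : normc ((1 + x) ^+ m - 1) <= (1 + normc x) ^+ m - 1.
Proof.
elim: m => [|m IH]; first by rewrite !expr0 !subrr normc0.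
have -> : (1 + x) ^+ m.+1 - 1 = ((1 + x) ^+ m - 1) * (1 + x) + x by rewrite exprSr; ring.
have -> : (1 + normc x) ^+ m.+1 - 1 =
    ((1 + normc x) ^+ m - 1) * (1 + normc x) + normc x by rewrite exprSr; ring.
apply: le_trans (ler_normcD _ _) _; rewrite lerD2r normcM.
apply: ler_pM; rewrite ?normc_ge0//.
by apply: le_trans (ler_normcD _ _) _; rewrite normc1.
Qed.

Lemma ler_1DX_expR (t : R) m : 0 <= t -> (1 + t / m.+1%:R) ^+ m.+1 <= expR t.
Proof.
move=> t0; have -> : expR t = expR (t / m.+1%:R) ^+ m.+1.
  by rewrite -expRM_natl mulrC divfK.
by rewrite lerXn2r ?nnegrE ?expR_ge0 ?expR_ge1Dx// addr_ge0// divr_ge0.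
Qed.

Lemma poly_disc_bound S : exists2 B : R, 0 <= B & forall z, normc z <= 1 -> normc S.[z] <= B.
Proof.
exists (\sum_(i < size S) normc S`_i); first by apply: sumr_ge0 => i _; exact: normc_ge0.
move=> z z1; rewrite horner_coef; apply: le_trans (ler_normc_sum _ _ _) _.
apply: ler_sum => i _; rewrite normcM normcX ler_piMr ?normc_ge0//.
by rewrite exprn_ile1 ?normc_ge0.
Qed.

(** Take c = 1 / (m + 1) with c |S|^2 <= 1 on the closed disc. Then |1 + c S|^2 = 1 + 2 c Re S + c^2
    |S|^2 <= exp (2 c Re S + c), and the power m + 1 followed by a square root gives the loss 1 / 2.
    The first bound holds for every m. *)
Lemma exists_exp_poly S : exists p,
  (forall z, normc (p.[z] - 1) <= expR (normc S.[z]) - 1) /\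
  (forall z, normc z = 1 -> normc p.[z] <= expR (complex.Re S.[z] + 1 / 2)).
Proof.
have [B B0 SB] := poly_disc_bound S.
have [m mB] : exists m : nat, B ^+ 2 <= m.+1%:R.
  exists (Num.bound (B ^+ 2)); apply: le_trans (ltW (archi_boundP (sqr_ge0 B))) _.
  by rewrite ler_nat.
pose c : R := m.+1%:R^-1; have c0 : 0 < c by rewrite invr_gt0.
exists ((1 + c%:C *: S) ^+ m.+1); split => z.
  rewrite horner_exp hornerD hornerZ hornerC.
  apply: le_trans (normc_1DXB1 _ _) _; rewrite lerD2r.
  rewrite normcM normc_realE (ger0_norm (ltW c0)) mulrC.
  exact: ler_1DX_expR (normc_ge0 _).
move=> z1; rewrite horner_exp hornerD hornerZ hornerC normcX.
set s := S.[z]; have sB : normc s <= B by apply: SB; rewrite z1.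
rewrite -(ler_pXn2r (n := 2))// ?nnegrE ?exprn_ge0 ?normc_ge0 ?expR_ge0//.
rewrite -exprM mulnC exprM -expRM_natl.
have -> : 2 * (complex.Re s + 1 / 2) = m.+1%:R * (2 * c * complex.Re s + c).
  by rewrite /c; field.
rewrite [in leRHS]expRM_natl lerXn2r ?nnegrE ?sqr_ge0 ?expR_ge0//.
apply: le_trans (expR_ge1Dx _); rewrite normc_sqr.
have h : c ^+ 2 * normc s ^+ 2 <= c.
  rewrite expr2 -mulrA ler_piMr ?(ltW c0)// /c mulrC ler_pdivrMr// mul1r.
  by apply: le_trans mB; rewrite lerXn2r ?nnegrE ?normc_ge0.
by move: h; rewrite normc_sqr; case: s {sB} => a b /=; rewrite !mul0r subr0 addr0 add0r; lra.
Qed.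

End power_polynomials.

(** * Pairing polynomials with the measure *)

Section pairing.
Variables (R : realType) (nu : cmeasure R).
Implicit Types (p : {poly R[i]}).
Local Open Scope complex_scope.

(* [Re \int conj(p) dnu]: with the conjugate, only the [nu_n] with [n >= 0] enter. *)
Definition pairing p : R :=
  rint (cm1 nu) (fun t => complex.Re p.[cexp t]) -
  rint (cm2 nu) (fun t => complex.Re p.[cexp t]) +
  (rint (cm3 nu) (fun t => complex.Im p.[cexp t]) -
   rint (cm4 nu) (fun t => complex.Im p.[cexp t])).

Lemma bm_ccos n : bm (@ccos R n). Proof. exact: bm_cos. Qed.
Lemma bm_csin n : bm (@csin R n). Proof. exact: bm_sin. Qed.

Lemma rint_trig (tau : {finite_measure set (measurableTypeR R) -> \bar R})
  (m : nat) (a b : nat -> R) :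
  rint tau (fun t => \sum_(k < m) (a k * ccos k t + b k * csin k t)) =
  \sum_(k < m) (a k * rint tau (ccos k) + b k * rint tau (csin k)).
Proof.
have mT := @measurable_Tpar R; have fT := finite_measure_lty tau mT.
have bmc (c : R) f : bm f -> bm (fun t => c * f t) by move=> ?; apply: bmM => //; exact: bm_cst.
have bc k := bmc (a k) _ (bm_ccos k); have bs k := bmc (b k) _ (bm_csin k).
rewrite /rint -[LHS]/(\int[tau]_(t in Tpar) (\sum_(k < m) (a k * ccos k t + b k * csin k t))).
rewrite bm_Rint_sum//; last by move=> k; exact: bmD.
apply: eq_bigr => k _; rewrite bm_RintD// !bm_RintZl//; [exact: bm_csin|exact: bm_ccos].
Qed.

Lemma pairingE p : pairing p = \sum_(k < size p)
  (complex.Re p`_k * fcoef_re nu k + complex.Im p`_k * fcoef_im nu k).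
Proof.
have ReE : (fun t => complex.Re p.[cexp t]) = (fun t => \sum_(k < size p)
    (complex.Re p`_k * ccos k t + - complex.Im p`_k * csin k t)).
  apply/funext => t; rewrite horner_coef Re_sum; apply: eq_bigr => k _.
  by rewrite cexpX ReM /= /ccos /csin mulNr !mulrA.
have ImE : (fun t => complex.Im p.[cexp t]) = (fun t => \sum_(k < size p)
    (complex.Im p`_k * ccos k t + complex.Re p`_k * csin k t)).
  apply/funext => t; rewrite horner_coef.
  have -> (s : R[i]) : complex.Im s = complex.Re (- 'i * s).
    by case: s => x y; rewrite mulNr ReN mulrC ReiNIm opprK.
  rewrite mulr_sumr Re_sum; apply: eq_bigr => k _.
  rewrite cexpX; case: (p`_k) => x y; rewrite /cexp /ccos /csin /= !mulrA; ring.
rewrite /pairing ReE ImE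
  (rint_trig _ _ (fun k => complex.Re p`_k) (fun k => - complex.Im p`_k))
  (rint_trig _ _ (fun k => complex.Re p`_k) (fun k => - complex.Im p`_k))
  (rint_trig _ _ (fun k => complex.Im p`_k) (fun k => complex.Re p`_k))
  (rint_trig _ _ (fun k => complex.Im p`_k) (fun k => complex.Re p`_k)).
rewrite -!sumrB -big_split /=; apply: eq_bigr => k _.
by rewrite /fcoef_re /fcoef_im; ring.
Qed.

Lemma fcoef_absE k : fcoef_abs nu k = normc (fcoef_re nu k +i* fcoef_im nu k).
Proof. by []. Qed.

Lemma pairing_term_le (a : R[i]) k :
  `|complex.Re a * fcoef_re nu k + complex.Im a * fcoef_im nu k| <=
  normc a * fcoef_abs nu k.
Proof.
rewrite fcoef_absE; set v := _ +i* _.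
have -> : complex.Re a * fcoef_re nu k + complex.Im a * fcoef_im nu k =
  complex.Re (a^* * v) by case: a => x y /=; rewrite mulNr opprK.
apply: le_trans (normr_Re_le _) _; rewrite normcM ler_wpM2r ?normc_ge0//.
by case: a => x y /=; rewrite sqrrN.
Qed.

(* Choosing [d = a / sqrt (k+1)] balances [A / d] against [k d]; this is where
   the decay rate [exp (- c sqrt n)] is matched with growth [exp (A / (1 - |z|))]. *)
Lemma pairing_near1 (c C : R) : 0 < c ->
  (forall n, fcoef_abs nu n * expR (c * Num.sqrt n%:R) <= C) ->
  exists A0 K : R, [/\ 0 < A0, 0 <= K & forall (A : R) p, 0 <= A <= A0 ->
    (forall z, normc z < 1 -> normc (p.[z] - 1) <= expR (A / (1 - normc z)) - 1) ->
    `|pairing p - fcoef_re nu 0| <= K * A].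
Proof.
move=> c0 hC.
(* With s = sqrt (k+1) and d = a / s, the bound a <= c / 8 limits (1 - d)^(-k) to exp (c s / 4), and
   A <= a c / 4 limits exp (A / d) to exp (c s / 4). Half of the decay exp (- c s) remains. The
   bound a <= 1 / 2 keeps the radius 1 - d at least 1 / 2. *)
pose a : R := Num.min (1 / 2) (c / 8).
have a0 : 0 < a by rewrite lt_min; apply/andP; split; rewrite divr_gt0.
have a1 : a <= 1 / 2 by rewrite ge_min lexx.
have a2 : a <= c / 8 by rewrite ge_min lexx orbT.
have C0 : 0 <= C.
  by apply: le_trans (hC 0%N); rewrite mulr_ge0 ?expR_ge0// fcoef_absE normc_ge0.
pose L : R := 2 * expR c * (10 / c) ^+ 5.
have L0 : 0 <= L.
  apply: mulr_ge0; first by rewrite mulr_ge0// expR_ge0.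
  by apply/exprn_ge0/divr_ge0 => //; exact: ltW.
exists (a * c / 4), (C / a * L); split.
- by rewrite divr_gt0// mulr_gt0.
- by rewrite mulr_ge0// divr_ge0// ltW.
move=> A p /andP[A0 A1] hp.
pose q := p - 1.
(* Subtracting 1 changes only the coefficient of degree 0; both sums are padded to a common length
   because [p] and [q] may differ in size. *)
have -> : pairing p - fcoef_re nu 0 = pairing q.
  have [n [np nq]] : exists n, (size p <= n.+1)%N /\ (size q <= n.+1)%N.
    exists (maxn (size p) (size q)); split; rewrite ltnW// ltnS ?leq_maxl ?leq_maxr//.
  have ext (s : {poly R[i]}) : (size s <= n.+1)%N -> pairing s = \sum_(k < n.+1)
      (complex.Re s`_k * fcoef_re nu k + complex.Im s`_k * fcoef_im nu k).
    move=> sn; rewrite pairingE.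
    rewrite (big_ord_widen _
      (fun k => complex.Re s`_k * fcoef_re nu k + complex.Im s`_k * fcoef_im nu k) sn).
    rewrite big_mkcond /=; apply: eq_bigr => k _; case: ifP => // /negbT.
    by rewrite -leqNgt => ks; rewrite nth_default//= !mul0r addr0.
  rewrite !ext//= !big_ord_recl /= /q coefB coef1 /=.
  have -> : \sum_(i < n) (complex.Re (p - 1)`_(bump 0 i) * fcoef_re nu (bump 0 i) +
      complex.Im (p - 1)`_(bump 0 i) * fcoef_im nu (bump 0 i)) =
      \sum_(i < n) (complex.Re p`_(bump 0 i) * fcoef_re nu (bump 0 i) +
      complex.Im p`_(bump 0 i) * fcoef_im nu (bump 0 i)).
    by apply: eq_bigr => i _; rewrite coefB coef1 /= subr0.
  by case: (p`_0) => x y /=; ring.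
rewrite pairingE; apply: le_trans (ler_norm_sum _ _ _) _.
(* The right-hand side telescopes, so any number of terms adds up to at most [C / a * L * A]. *)
have term k : normc q`_k * fcoef_abs nu k <=
    C / a * L * A * (k.+1%:R^-1 - k.+2%:R^-1).
  pose s : R := Num.sqrt k.+1%:R.
  have s1 : 1 <= s by rewrite -(sqrtr1 R) ler_wsqrtr// ler1n.
  have s0 : 0 < s by apply: lt_le_trans s1.
  have s2 : s ^+ 2 = k.+1%:R by rewrite sqr_sqrtr.
  pose t : R := Num.sqrt k%:R.
  have st : s <= t + 1.
    rewrite -(ler_pXn2r (n := 2))// ?nnegrE ?addr_ge0 ?sqrtr_ge0 ?(ltW s0)//.
    by rewrite s2 sqrrD sqr_sqrtr// mulr1 expr1n -natr1 lerD2r lerDl mulrn_wge0// sqrtr_ge0.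
  pose d : R := a / s.
  have d0 : 0 < d by rewrite divr_gt0.
  have da : d <= a by rewrite ler_pdivrMr// ler_peMr// ltW.
  have d12 : d <= 1 / 2 by apply: le_trans a1.
  have rho0 : 0 < 1 - d by move: d12; clear; lra.
  have nz (z : R[i]) : normc z = 1 - d -> normc q.[z] <= expR (A / d) - 1.
    move=> zd; rewrite /q hornerD hornerN hornerC.
    by apply: le_trans (hp z _) _; rewrite zd ?subKr// gtrBl.
  have := cauchy_coef k (ltW rho0) nz.
  have dinv : (1 - d)^-1 <= expR (2 * d).
    apply: le_trans (_ : 1 + 2 * d <= _); last exact: expR_ge1Dx.
    rewrite -[leLHS]mul1r ler_pdivrMr//.
    have : 0 <= d * (1 - 2 * d) by rewrite mulr_ge0 ?(ltW d0)//; move: d12; clear; lra.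
    by clear; lra.
  rewrite -ler_pdivlMr ?exprn_gt0// => qk.
  have Ad : A / d = A / a * s by rewrite /d invf_div mulrA mulrAC.
  have {}qk : normc q`_k <= A / a * s * expR (c / 2 * s).
    apply: le_trans qk _.
    have e1 : expR (A / d) - 1 <= A / d * expR (A / d).
      have := expR_ge1Dx (- (A / d)); rewrite expRN.
      have E0 := expR_gt0 (A / d).
      move=> h; have : (1 - A / d) * expR (A / d) <= 1.
        by rewrite -ler_pdivlMr// mul1r.
      by rewrite mulrBl mul1r; clear; lra.
    have e2 : ((1 - d) ^+ k)^-1 <= expR (2 * a * s).
      rewrite -exprVn; apply: le_trans (_ : expR (2 * d) ^+ k <= _).
        by rewrite lerXn2r ?nnegrE ?expR_ge0// invr_ge0 ltW.
      rewrite -expRM_natl ler_expR.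
      have -> : 2 * a * s = k.+1%:R * (2 * d).
        by rewrite -s2 /d; field; rewrite gt_eqF.
      by rewrite ler_wpM2r ?ler_nat// mulr_ge0// ltW.
    apply: le_trans (_ : A / d * expR (A / d) * expR (2 * a * s) <= _).
      apply: ler_pM => //.
        by rewrite subr_ge0 -expR0 ler_expR divr_ge0// ltW.
      by rewrite invr_ge0 exprn_ge0// ltW.
    rewrite -mulrA -expRD Ad ler_wpM2l ?mulr_ge0 ?invr_ge0 ?(ltW a0) ?(ltW s0)//.
    rewrite ler_expR -mulrDl ler_pM2r//.
    have : A / a <= c / 4 by rewrite ler_pdivrMr//; move: A1; clear; lra.
    by move: a2; clear; lra.
  have fk : fcoef_abs nu k <= C * expR (- (c * t)).
    by have := hC k; rewrite expRN ler_pdivlMr ?expR_gt0.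
  have := ler_pM (normc_ge0 _) (sqrtr_ge0 _) qk fk; move=> /le_trans; apply.
  have E1 : expR (- (c * t)) <= expR c * expR (- (c * s)).
    rewrite -expRD ler_expR; have := ler_wpM2l (ltW c0) st; clear; lra.
  (* The inequality x <= exp x at x = c s / 10, raised to the fifth power. One factor s comes from
     the bound on the coefficient, s^4 from the telescoping denominator. *)
  have E2 : s ^+ 5 * expR (- (c / 2 * s)) <= (10 / c) ^+ 5.
    rewrite expRN ler_pdivrMr ?expR_gt0//.
    have -> : c / 2 * s = 5%:R * (c / 10 * s) by field.
    rewrite expRM_natl -exprMn lerXn2r ?nnegrE ?(ltW s0)//.
      by rewrite mulr_ge0 ?expR_ge0// divr_ge0// ltW.
    rewrite mulrC -ler_pdivrMr ?divr_gt0// invf_div.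
    apply: le_trans (expR_ge1Dx _).
    have -> : s * (c / 10) = c / 10 * s by ring.
    by rewrite lerDr.
  have dif : k.+1%:R^-1 - k.+2%:R^-1 = (s ^+ 2 * (s ^+ 2 + 1))^-1 :> R.
    have -> : k.+2%:R = s ^+ 2 + 1 :> R by rewrite s2 natr1.
    rewrite -s2; field; rewrite !gt_eqF ?exprn_gt0//.
    by rewrite addr_gt0// exprn_gt0.
  have P0 : 0 < s ^+ 2 * (s ^+ 2 + 1) by rewrite mulr_gt0 ?addr_gt0 ?exprn_gt0.
  rewrite dif ler_pdivlMr//.
  have E3 : s ^+ 2 * (s ^+ 2 + 1) <= 2 * s ^+ 4.
    have : s ^+ 2 * 1 <= s ^+ 2 * s ^+ 2.
      by rewrite ler_pM2l ?exprn_gt0// exprn_ege1.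
    by rewrite -[s ^+ 4](_ : s ^+ 2 * s ^+ 2 = _) ?[leLHS]mulrDr; [clear; lra|ring].
  have CA : 0 <= C / a * A by rewrite mulr_ge0// divr_ge0// ltW.
  have -> : C / a * L * A = C / a * A * L by ring.
  have -> : A / a * s * expR (c / 2 * s) * (C * expR (- (c * t))) * (s ^+ 2 * (s ^+ 2 + 1))
     = C / a * A * (s * expR (c / 2 * s) * expR (- (c * t)) * (s ^+ 2 * (s ^+ 2 + 1))) by ring.
  rewrite ler_wpM2l//.
  apply: le_trans (_ : s * expR (c / 2 * s) * (expR c * expR (- (c * s))) * (2 * s ^+ 4) <= _).
    apply: ler_pM => //.
    - by rewrite !mulr_ge0 ?expR_ge0// ltW.
    - exact: ltW.
    - by rewrite ler_wpM2l// mulr_ge0 ?expR_ge0// ltW.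
  have -> : s * expR (c / 2 * s) * (expR c * expR (- (c * s))) * (2 * s ^+ 4) =
     2 * expR c * (s ^+ 5 * (expR (c / 2 * s) * expR (- (c * s)))) by ring.
  rewrite -expRD (_ : c / 2 * s + - (c * s) = - (c / 2 * s)); last by field.
  by rewrite /L ler_wpM2l// mulr_ge0 ?expR_ge0.
apply: le_trans (_ : \sum_(k < size q) C / a * L * A * (k.+1%:R^-1 - k.+2%:R^-1) <= _).
  by apply: ler_sum => k _; apply: le_trans (pairing_term_le _ _) (term k).
have KA : 0 <= C / a * L * A by rewrite 2?mulr_ge0// divr_ge0// ltW.
rewrite -mulr_sumr ler_piMr//.
elim: (size q) => [|m IH]; first by rewrite big_ord0.
suff -> : \sum_(k < m.+1) (k.+1%:R^-1 - k.+2%:R^-1) = 1 - m.+2%:R^-1 :> R.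
  by rewrite gerBl.
elim: m {IH} => [|m IH]; first by rewrite big_ord_recl big_ord0 addr0 /= invr1.
by rewrite big_ord_recr /= IH; ring.
Qed.

End pairing.

(** * Finite measures tested by polynomials *)

Section finite_measures.
Variable R : realType.
Local Notation fmeas := {finite_measure set (measurableTypeR R) -> \bar R}.
Implicit Types (tau : fmeas) (A B K V : set R).

Lemma fm_ge0 tau A : 0 <= fine (tau A).
Proof. by rewrite fine_ge0. Qed.

Lemma fmDI tau A B : measurable A -> measurable B ->
  fine (tau A) = fine (tau (A `\` B)) + fine (tau (A `&` B)).
Proof.
move=> mA mB; rewrite (measureDI tau mA mB) fineD//; apply: fin_num_measure.
  exact: measurableD.
exact: measurableI.
Qed.

Lemma fm_sub tau A B : measurable A -> measurable B -> B `<=` A ->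
  fine (tau A) = fine (tau (A `\` B)) + fine (tau B).
Proof. by move=> mA mB BA; rewrite (fmDI tau mA mB) (setIidr BA). Qed.

Lemma le_fm tau A B : measurable A -> measurable B -> A `<=` B ->
  fine (tau A) <= fine (tau B).
Proof. by move=> mA mB AB; rewrite (fm_sub tau mB mA AB) lerDr fm_ge0. Qed.

Lemma fm_cvg0 (mu : {measure set (measurableTypeR R) -> \bar R}) (D : nat -> set R) :
  (mu (D 0%N) < +oo)%E -> (forall n, measurable (D n)) ->
  (forall n m, (n <= m)%N -> D m `<=` D n) -> \bigcap_n D n = set0 ->
  forall e : R, 0 < e -> exists n0, forall n, (n0 <= n)%N -> fine (mu (D n)) <= e.
Proof.
move=> fD mD dD D0 e e0.
have h : (mu \o D) x @[x --> \oo] --> mu (\bigcap_n D n).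
  apply: nonincreasing_cvg_mu => //.
  - by rewrite D0.
  - by move=> n m nm; apply/subsetPset; exact: dD.
rewrite D0 measure0 in h.
have {}h : (fine \o (mu \o D)) x @[x --> \oo] --> (0 : R) by exact: fine_cvg h.
have /cvgrPdist_le/(_ _ e0) [n0 _ hn] := h.
exists n0 => n /hn; by rewrite /= sub0r normrN ger0_norm// fine_ge0.
Qed.

Lemma bm_Re_poly (p : {poly R[i]}) : bm (fun t => complex.Re p.[cexp t]).
Proof.
under eq_fun do rewrite horner_coef Re_sum; apply: bm_sum => k.
by under eq_fun do rewrite cexpX; exact: bm_Re_cexp.
Qed.

Lemma bm_Im_poly (p : {poly R[i]}) : bm (fun t => complex.Im p.[cexp t]).
Proof.
have -> : (fun t => complex.Im p.[cexp t]) =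
    (fun t => complex.Re (((- 'i)%C%:P * p).[cexp t])).
  apply/funext => t; rewrite hornerM hornerC.
  by case: (p.[_]) => x y; rewrite mulNr ReN mulrC ReiNIm opprK.
exact: bm_Re_poly.
Qed.

(* [V] surrounds a set [K] on which [p] is small, while [p] is close to 1 away from [V]. *)
Lemma rint_poly_test tau (p : {poly R[i]}) (K V : set R) (B : R -> R) (e : R) :
  measurable K -> measurable V -> K `<=` V -> V `<=` Tpar -> 0 <= e -> bm B ->
  (forall x, V x -> normc p.[cexp x] <= B x) ->
  fine (tau (V `\` K)) <= e -> \int[tau]_(x in V) B x <= e ->
  (forall x, (Tpar `\` V) x -> normc (p.[cexp x] - 1) <= e) ->
  `|rint tau (fun t => complex.Re p.[cexp t]) - fine (tau (Tpar `\` K))| <=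
    (2 + fine (tau Tpar)) * e /\
  `|rint tau (fun t => complex.Im p.[cexp t])| <= (2 + fine (tau Tpar)) * e.
Proof.
move=> mK mV KV VT e0 bB pB VK BV pV.
have mT := @measurable_Tpar R.
have mTV : measurable (Tpar `\` V) by exact: measurableD.
have bR := bm_Re_poly p; have bI := bm_Im_poly p.
have fT A : measurable A -> (tau A < +oo)%E by exact: finite_measure_lty.
have split f : bm f -> rint tau f = \int[tau]_(x in V) f x + \int[tau]_(x in Tpar `\` V) f x.
  move=> bf; rewrite -bm_RintU//; [by rewrite /rint setDUK|exact: fT|exact: fT|].
  by rewrite setDIK.
have le1 f : bm f -> (forall x, `|f x| <= normc p.[cexp x]) ->
    `|\int[tau]_(x in V) f x| <= e.
  move=> bf fp; apply: le_trans BV; apply: bm_Rint_norm_le => //; first exact: fT.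
  by move=> x /pB; exact: le_trans.
have le2 f : bm f -> (forall x, `|f x| <= normc (p.[cexp x] - 1)) ->
    `|\int[tau]_(x in Tpar `\` V) f x| <= fine (tau Tpar) * e.
  move=> bf fp; apply: le_trans (_ : e * fine (tau (Tpar `\` V)) <= _).
    rewrite -Rintegral_cst//; apply: bm_Rint_norm_le => //; first exact: fT.
      exact: bm_cst.
    by move=> x /pV; exact: le_trans.
  by rewrite mulrC ler_wpM2r// le_fm.
have iT := fm_ge0 tau Tpar.
split; rewrite split//.
  have -> : fine (tau (Tpar `\` K)) = fine (tau (V `\` K)) + fine (tau (Tpar `\` V)).
    rewrite (fmDI tau (measurableD mT mK) mV) addrC.
    have -> : (Tpar `\` K) `&` V = V `\` K.
      by apply/seteqP; split=> x [] => [[? ?] ?|/[dup] /VT ? ? ?]; do ?split.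
    suff -> : (Tpar `\` K) `\` V = Tpar `\` V by [].
    by apply/seteqP; split=> x [] => [[? ?] ?|? nV]; do ?split => //; move=> /KV.
  have -> : \int[tau]_(x in Tpar `\` V) complex.Re p.[cexp x] =
      \int[tau]_(x in Tpar `\` V) (complex.Re p.[cexp x] - 1) + fine (tau (Tpar `\` V)).
    rewrite bm_RintB//; [|exact: fT|exact: bm_cst].
    by rewrite Rintegral_cst// mul1r subrK.
  have h1 := le1 _ bR (fun x => normr_Re_le _).
  have h2 : `|\int[tau]_(x in Tpar `\` V) (complex.Re p.[cexp x] - 1)| <= fine (tau Tpar) * e.
    apply: le2; first by apply: bmB => //; exact: bm_cst.
    by move=> x; apply: le_trans (normr_Re_le _); rewrite ReB.
  have h3 := fm_ge0 tau (V `\` K).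
  by move: h1 h2; rewrite !ler_norml; move: VK h3; clear; lra.
have h1 := le1 _ bI (fun x => normr_Im_le _).
have h2 : `|\int[tau]_(x in Tpar `\` V) complex.Im p.[cexp x]| <= fine (tau Tpar) * e.
  apply: le2 => // x; apply: le_trans (normr_Im_le _).
  by case: (p.[_]) => a b /=; rewrite subr0.
by apply: le_trans (ler_normD _ _) _; move: h1 h2; move: e0; clear; lra.
Qed.

Lemma ler0_eps (x C : R) : (forall e : R, 0 < e <= 1 -> `|x| <= C * e) -> x = 0.
Proof.
move=> h; apply/eqP; rewrite -normr_le0; apply/ler_addgt0Pl => e e0.
have C0 : 0 <= C by have := h 1; rewrite ltr01 lexx mulr1 => /(_ isT); exact: le_trans.
pose d := Num.min 1 (e / (C + 1)).
have C1 : 0 < C + 1 by rewrite ltr_wpDl.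
have d01 : 0 < d <= 1 by rewrite lt_min ltr01 divr_gt0// ge_min lexx.
apply: le_trans (h _ d01) _; rewrite addr0.
apply: le_trans (_ : C * (e / (C + 1)) <= _).
  by rewrite ler_wpM2l// ge_min lexx orbT.
by rewrite mulrCA ler_piMr ?(ltW e0)// ler_pdivrMr// mul1r lerDl.
Qed.

(** Smallness is asked of each of the four positive measures, not merely of the combination [nu];
    [B] majorizes |p| on [V]. *)
Definition is_test (nu : cmeasure R) K (e : R) (p : {poly R[i]}) V (B : R -> R) :=
  [/\ measurable V, K `<=` V, V `<=` Tpar, bm B &
   [/\ (forall x, V x -> normc p.[cexp x] <= B x),
       `|pairing nu p - fcoef_re nu 0| <= e,
       (forall x, (Tpar `\` V) x -> normc (p.[cexp x] - 1) <= e),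
       [/\ fine (cm1 nu (V `\` K)) <= e, fine (cm2 nu (V `\` K)) <= e,
           fine (cm3 nu (V `\` K)) <= e & fine (cm4 nu (V `\` K)) <= e] &
       [/\ \int[cm1 nu]_(x in V) B x <= e, \int[cm2 nu]_(x in V) B x <= e,
           \int[cm3 nu]_(x in V) B x <= e & \int[cm4 nu]_(x in V) B x <= e]]].

Lemma fcoef_re0 (nu : cmeasure R) :
  fcoef_re nu 0 = fine (cm1 nu Tpar) - fine (cm2 nu Tpar).
Proof.
have mT := @measurable_Tpar R.
have c0 : @ccos R 0 = fun=> 1 by apply/funext => t; rewrite /ccos mulr0 mul0r cos0.
have s0 : @csin R 0 = fun=> 0 by apply/funext => t; rewrite /csin mulr0 mul0r sin0.
have h tau (r : R) : rint tau (fun=> r) = r * fine (tau Tpar) by exact: Rintegral_cst.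
by rewrite /fcoef_re c0 s0 !h !mul1r !mul0r subrr addr0.
Qed.

(** By [rint_poly_test] the pairing is within a multiple of e of Re nu(T \ K); by assumption it is
    within e of [fcoef_re nu 0], which is Re nu(T). The difference of the two is Re nu(K). *)
Lemma cm_re_test (nu : cmeasure R) K : measurable K -> K `<=` Tpar ->
  (forall e : R, 0 < e <= 1 -> exists p V (B : R -> R), is_test nu K e p V B) ->
  cm_re nu K = 0.
Proof.
move=> mK KT H.
have mT := @measurable_Tpar R.
pose T := (2 + fine (cm1 nu Tpar)) + (2 + fine (cm2 nu Tpar)) +
  (2 + fine (cm3 nu Tpar)) + (2 + fine (cm4 nu Tpar)).
apply: (@ler0_eps _ (1 + T)) => e /[dup] e01 /andP[/ltW e0 _].
have [p [V [B [mV KV VT bB [pB Hp pV [t1 t2 t3 t4] [i1 i2 i3 i4]]]]]] := H e e01.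
have [a1 _] := rint_poly_test mK mV KV VT e0 bB pB t1 i1 pV.
have [a2 _] := rint_poly_test mK mV KV VT e0 bB pB t2 i2 pV.
have [_ a3] := rint_poly_test mK mV KV VT e0 bB pB t3 i3 pV.
have [_ a4] := rint_poly_test mK mV KV VT e0 bB pB t4 i4 pV.
move: Hp; rewrite fcoef_re0 /pairing.
rewrite (@fm_sub (cm1 nu) Tpar K)// (@fm_sub (cm2 nu) Tpar K)// /cm_re.
rewrite mulrDl mul1r /T !(mulrDl _ _ e).
move: a1 a2 a3 a4; rewrite !(mulrDl _ _ e) !ler_norml; clear; lra.
Qed.

End finite_measures.

(** * The mass at the cut point, distance functions and uniform continuity *)

Section point_mass_and_topology.
Variable R : realType.
Local Notation fmeas := {finite_measure set (measurableTypeR R) -> \bar R}.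

Definition fast_decay (nu : cmeasure R) := exists c : R, 0 < c /\ exists C : R,
  forall n : nat, fcoef_abs nu n * expR (c * Num.sqrt n%:R) <= C.

Lemma fm_cvg0_4 (nu : cmeasure R) (D : nat -> set R) : (forall n, measurable (D n)) ->
  (forall n m, (n <= m)%N -> D m `<=` D n) -> \bigcap_n D n = set0 ->
  forall e : R, 0 < e -> exists n0, forall n, (n0 <= n)%N ->
  [/\ fine (cm1 nu (D n)) <= e, fine (cm2 nu (D n)) <= e,
      fine (cm3 nu (D n)) <= e & fine (cm4 nu (D n)) <= e].
Proof.
move=> mD dD D0 e e0.
have [n1 h1] := fm_cvg0 (finite_measure_lty (cm1 nu) (mD 0%N)) mD dD D0 e0.
have [n2 h2] := fm_cvg0 (finite_measure_lty (cm2 nu) (mD 0%N)) mD dD D0 e0.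
have [n3 h3] := fm_cvg0 (finite_measure_lty (cm3 nu) (mD 0%N)) mD dD D0 e0.
have [n4 h4] := fm_cvg0 (finite_measure_lty (cm4 nu) (mD 0%N)) mD dD D0 e0.
exists (maxn (maxn n1 n2) (maxn n3 n4)) => n.
rewrite !geq_max => /andP[/andP[g1 g2] /andP[g3 g4]].
by split; [exact: h1|exact: h2|exact: h3|exact: h4].
Qed.

Lemma exists_invn_le (e : R) : 0 < e -> exists n : nat, n.+1%:R^-1 <= e.
Proof.
move=> e0; exists (Num.bound e^-1).
rewrite -[leRHS]invrK lef_pV2 ?posrE ?invr_gt0//.
apply: le_trans (ltW (archi_boundP _)) _; first by rewrite invr_ge0 ltW.
by rewrite ler_nat.
Qed.

(** A punctured neighbourhood, on the circle, of the cut point 0; [n.+2] keeps its radius at most 1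
    / 2. *)
Definition endpoint_nbhd (n : nat) : set R := `]0, n.+2%:R^-1[ `|` `]1 - n.+2%:R^-1, 1[.

Lemma measurable_endpoint_nbhd n : measurable (endpoint_nbhd n).
Proof. by apply: measurableU; exact: measurable_itv. Qed.

Lemma invn2_le n : (n.+2%:R^-1 : R) <= 1 / 2.
Proof. by rewrite div1r lef_pV2 ?posrE// ler_nat. Qed.

Lemma endpoint_nbhd_tail (nu : cmeasure R) (e : R) : 0 < e -> exists n0, forall n, (n0 <= n)%N ->
  [/\ fine (cm1 nu (endpoint_nbhd n)) <= e, fine (cm2 nu (endpoint_nbhd n)) <= e,
      fine (cm3 nu (endpoint_nbhd n)) <= e & fine (cm4 nu (endpoint_nbhd n)) <= e].
Proof.
move=> e0; apply: fm_cvg0_4 => // [n|n m nm x|]; first exact: measurable_endpoint_nbhd.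
  rewrite /endpoint_nbhd /= !in_itv /=; have : m.+2%:R^-1 <= n.+2%:R^-1 :> R.
    by rewrite lef_pV2 ?posrE// ler_nat.
  move: (_^-1) (_^-1) => u v h [/andP[x0 xd]|/andP[x0 xd]]; [left|right].
    by rewrite x0 (lt_le_trans xd).
  by rewrite xd andbT (le_lt_trans _ x0)// lerD2l lerN2.
apply/seteqP; split => // x hx.
have d0 n : 0 < (n.+2%:R^-1 : R) by rewrite invr_gt0.
have [x0 x1] : 0 < x /\ x < 1.
  pose t : R := 0.+2%:R^-1; have t1 : t <= 1 / 2 by exact: invn2_le.
  have t0 : 0 < t by exact: d0.
  have : endpoint_nbhd 0 x by exact: hx.
  rewrite /endpoint_nbhd -/t /= !in_itv /= => -[/andP[g1 g2]|/andP[g1 g2]];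
  by move: t1 t0 g1 g2; move: t; clear => t *; split; lra.
pose y := Num.min x (1 - x).
have y0 : 0 < y by rewrite lt_min x0 subr_gt0.
have [n hn] := exists_invn_le y0.
have yd : n.+2%:R^-1 <= y by apply: le_trans hn; rewrite lef_pV2 ?posrE// ler_nat.
have yx : y <= x by rewrite ge_min lexx.
have yx1 : y <= 1 - x by rewrite ge_min lexx orbT.
have := hx n I; rewrite /endpoint_nbhd /= !in_itv /= => -[/andP[g1 g2]|/andP[g1 g2]];
  by move: yd yx yx1 g1 g2; move: (_^-1) => v; clear; lra.
Qed.

(** The polynomial 1 - (1 + z + ... + z^m) / (m + 1) vanishes at z = 1, is close to 1 away from that
    point when m is large, and differs from 1 by at most 1 / ((m + 1) (1 - |z|)) in the disc. It
    tests the point 0, which weights living inside (0, 1) do not reach. *)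
Lemma cm_re_at0 (nu : cmeasure R) : fast_decay nu -> cm_re nu [set 0] = 0.
Proof.
move=> [c [c0 [C hC]]]; have [A0 [K [A00 K0 near1]]] := pairing_near1 c0 hC.
apply: cm_re_test; [exact: measurable_set1| |].
  by move=> _ ->; rewrite /Tpar /= in_itv /= lexx ltr01.
move=> e /andP[e0 e1].
pose d (n : nat) : R := n.+2%:R^-1.
have d0 n : 0 < d n by rewrite invr_gt0.
have d12 n : d n <= 1 / 2 by exact: invn2_le.
pose D := endpoint_nbhd; have mD n : measurable (D n) by exact: measurable_endpoint_nbhd.
have e2 : 0 < e / 2 by rewrite divr_gt0.
have [n0 tail] := endpoint_nbhd_tail nu e2.
have {tail} tail := tail n0 (leqnn _).
have [b b0 far] : exists2 b : R, 0 < b &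
   forall s, d n0 <= `|s| <= 1 - d n0 -> b <= normc (1 - cexp s).
  by apply: cexp_far; rewrite d0 d12.
have KK : 0 < K + 1 by rewrite ltr_wpDl.
(* The three bounds make [near1] applicable, make its error [K * a] at most e, and give |p - 1| <= 2
   a / b <= e away from the cut. *)
pose t : R := Num.min A0 (Num.min (e / (K + 1)) (b * e / 2)).
have t0 : 0 < t by rewrite !lt_min A00 divr_gt0//= divr_gt0// mulr_gt0.
have [m ht] := exists_invn_le t0.
have [hA [hK hb]] : [/\ m.+1%:R^-1 <= A0, m.+1%:R^-1 <= e / (K + 1) & m.+1%:R^-1 <= b * e / 2].
  by split; apply: le_trans ht _; rewrite /t !ge_min lexx ?orbT.
pose a : R := m.+1%:R^-1; have a0 : 0 < a by rewrite invr_gt0.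
pose q : {poly R[i]} := \sum_(k < m.+1) 'X^k.
pose p := 1 - (a%:C)%C *: q.
have qE z : q.[z] = \sum_(k < m.+1) z ^+ k.
  by rewrite /q horner_sum; apply: eq_bigr => k _; rewrite hornerXn.
have pE z : p.[z] - 1 = - ((a%:C)%C * q.[z]).
  by rewrite /p hornerD hornerN hornerZ hornerC; ring.
have pn z : normc (p.[z] - 1) = a * normc q.[z].
  by rewrite pE normcN normcM normc_realE ger0_norm// ltW.
have qle z : normc q.[z] <= \sum_(k < m.+1) normc z ^+ k.
  rewrite qE; apply: le_trans (ler_normc_sum _ _ _) _.
  by apply: ler_sum => k _; rewrite normcX.
exists p, ([set 0] `|` D n0), (fun x => 2 * \1_(D n0) x).
have m0 : measurable [set (0 : R)] by exact: measurable_set1.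
have mV : measurable ([set 0] `|` D n0) by exact: measurableU.
have D0 : ~ D n0 0.
  rewrite /D /endpoint_nbhd /= -/(d n0) !in_itv /= ltxx /=; case=> // /andP[+ _].
  by have := d12 n0; lra.
have VD : ([set 0] `|` D n0) `\` [set 0] = D n0.
  apply/seteqP; split => x; first by move=> [[]].
  by move=> Dx; split; [right|move=> x0; apply: D0; rewrite -x0].
have int (tau : fmeas) : fine (tau (D n0)) <= e / 2 ->
    \int[tau]_(x in [set 0] `|` D n0) (2 * \1_(D n0) x) <= e.
  move=> h; have fV := finite_measure_lty tau mV.
  rewrite bm_RintZl//; last exact: bm_indic.
  have mDn := mD n0; rewrite /Rintegral integral_indic// setIUr.
  rewrite (_ : D n0 `&` [set 0] = set0) ?set0U ?setIid.
    by move: h; clear; lra.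
  by apply/seteqP; split => // x [/[swap] -> /D0].
split => //.
- move=> x [->|]; first by rewrite /Tpar /= in_itv /= lexx ltr01.
  rewrite /D /endpoint_nbhd /Tpar /= -/(d n0) !in_itv /=; have := d12 n0; have := d0 n0.
  by move=> h h' [/andP[g1 g2]|/andP[g1 g2]]; apply/andP; move: h h' g1 g2; clear; split; lra.
- by apply: bmM; [exact: bm_cst|exact: bm_indic].
split.
- move=> x Vx; case: Vx => [->|Dx].
    have -> : p.[cexp 0] = 0.
      rewrite /p hornerD hornerN hornerZ hornerC qE cexp0.
      under eq_bigr do rewrite expr1n.
      rewrite sumr_const card_ord -[1 *+ _](rmorph_nat (real_complex R)) -rmorphM.
      by rewrite /a mulVf ?pnatr_eq0// subrr.
    by rewrite normc0 mulr_ge0.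
  rewrite indicE mem_set// mulr1.
  have -> : p.[cexp x] = 1 + (p.[cexp x] - 1) by ring.
  apply: le_trans (ler_normcD _ _) _; rewrite normc1 pn.
  have : a * normc q.[cexp x] <= 1.
    rewrite /a mulrC ler_pdivrMr// mul1r; apply: le_trans (qle _) _.
    by under eq_bigr do rewrite normc_cexp expr1n; rewrite sumr_const card_ord.
  lra.
- apply: le_trans (near1 a p _ _) _; first by rewrite (ltW a0).
    move=> z z1; rewrite pn.
    have d1 : 0 < 1 - normc z by rewrite subr_gt0.
    have h := expR_ge1Dx (a / (1 - normc z)).
    suff : a * normc q.[z] <= a / (1 - normc z) by move: h; clear; lra.
    rewrite ler_pM2l// -[leRHS]mul1r ler_pdivlMr//.
    apply: le_trans (_ : (\sum_(k < m.+1) normc z ^+ k) * (1 - normc z) <= _).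
      by rewrite ler_pM2r.
    have := subrX1 (normc z) m.+1; have := exprn_ge0 m.+1 (normc_ge0 z).
    by set S := \sum_(i < _) _; clear; lra.
  apply: le_trans (_ : K * (e / (K + 1)) <= _); first by rewrite ler_wpM2l.
  by rewrite mulrCA ler_piMr ?(ltW e0)// ler_pdivrMr// mul1r lerDl.
- move=> x [Tx nV]; rewrite pn.
  have xf : d n0 <= `|x| <= 1 - d n0.
    move: Tx; rewrite /Tpar /= in_itv /= => /andP[x0 x1].
    rewrite ger0_norm//.
    have nx0 : x != 0 by apply/eqP => x0'; apply: nV; left.
    have x0' : 0 < x by rewrite lt_neqAle eq_sym nx0.
    apply/andP; split; rewrite leNgt; apply/negP => h; apply: nV; right.
      by left; rewrite /= in_itv /= x0'.
    by right; rewrite /= in_itv /= h.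
  have bx := far _ xf.
  have : normc q.[cexp x] * normc (1 - cexp x) <= 2.
    rewrite -normcM qE mulrC -normcN -mulNr opprB -subrX1.
    apply: le_trans (ler_normcB _ _) _.
    by rewrite normcX normc_cexp normc1 expr1n.
  have : normc q.[cexp x] * b <= normc q.[cexp x] * normc (1 - cexp x).
    by rewrite ler_wpM2l ?normc_ge0.
  move=> h1 h2; have h3 : normc q.[cexp x] * b <= 2 by apply: le_trans h1 h2.
  apply: le_trans (_ : b * e / 2 * normc q.[cexp x] <= _).
    by rewrite ler_wpM2r ?normc_ge0.
  have := ler_wpM2l (ltW e0) h3; clear; lra.
- by rewrite VD; move: tail e0; clear => -[? ? ? ?] ?; split; lra.
- by move: tail => [? ? ? ?]; split; exact: int.
Qed.

(** Distance on the line rather than on the circle; the sets [K] of the nullity criterion stay away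
    from the cut. *)
Definition distK (K : set R) (x : R) : R := inf [set `|x - k| | k in K].

Section dist.
Variable K : set R.
Hypothesis K0 : K !=set0.

Lemma has_inf_dist x : has_inf [set `|x - k| | k in K].
Proof.
case: K0 => k Kk; split; first by exists `|x - k|; exists k.
by exists 0 => _ [k' _ <-].
Qed.

Lemma distK_ge0 x : 0 <= distK K x.
Proof.
by apply: lb_le_inf => [|_ [k _ <-]//]; have [] := has_inf_dist x.
Qed.

Lemma distK_le x k : K k -> distK K x <= `|x - k|.
Proof. by move=> Kk; apply: ge_inf; [have [] := has_inf_dist x|exists k]. Qed.

Lemma distK_lt x e : distK K x < e -> exists2 k, K k & `|x - k| < e.
Proof. by have [S0 _] := has_inf_dist x; move=> /(inf_lt S0)[_ [k Kk <-] ke]; exists k. Qed.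

Lemma distK_lip x y : `|distK K x - distK K y| <= `|x - y|.
Proof.
suff H u v : distK K u <= distK K v + `|u - v|.
  by rewrite ler_norml; have := H x y; have := H y x; rewrite (distrC y); lra.
rewrite -lerBlDr; apply: lb_le_inf => [|_ [k Kk <-]]; first by have [] := has_inf_dist v.
rewrite lerBlDr addrC; apply: le_trans (distK_le u Kk) _.
by apply: le_trans (ler_distD v _ _) _.
Qed.

Lemma distK_mem x : K x -> distK K x = 0.
Proof.
move=> Kx; apply/eqP; rewrite eq_le distK_ge0 andbT.
by apply: le_trans (distK_le x Kx) _; rewrite subrr normr0.
Qed.

Lemma lip_continuous (f : R -> R) (L : R) :
  (forall x y, `|f x - f y| <= L * `|x - y|) -> continuous f.
Proof.
move=> fL x; apply/cvgrPdist_le => e e0.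
have L0 : 0 < `|L| + 1 by rewrite ltr_wpDl.
have d0 : 0 < e / (`|L| + 1) by rewrite divr_gt0.
apply/nbhs_ballP; exists (e / (`|L| + 1)) => //= y; rewrite /ball /= => xy.
apply: le_trans (fL _ _) _.
apply: le_trans (_ : (`|L| + 1) * `|x - y| <= _).
  by rewrite ler_wpM2r// (le_trans (ler_norm L))// lerDl.
by rewrite mulrC -ler_pdivlMr// ltW.
Qed.

Lemma continuous_distK : continuous (distK K).
Proof. by apply: (@lip_continuous _ 1) => x y; rewrite mul1r distK_lip. Qed.

Lemma closed_distK0 x : closed K -> distK K x = 0 -> K x.
Proof.
move=> cK dx; rewrite ((closure_id K).1 cK) => B /nbhs_ballP[e e0 he].
have [k Kk ke] : exists2 k, K k & `|x - k| < e by apply: distK_lt; rewrite dx.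
by exists k; split => //; exact: he.
Qed.

End dist.

Lemma unif_continuous_segment (w : R -> R) (a b t : R) : continuous w -> 0 < t ->
  exists2 d : R, 0 < d & forall x y, a <= x <= b -> `|x - y| < d -> `|w y - w x| <= t.
Proof.
move=> cw t0; have cpt := @segment_compact R a b.
pose P (d x : R) := forall y, `|x - y| < d -> `|w y - w x| <= t.
have := (compact_near_coveringP _).1 cpt R (0^'+) P _.
have t2 : 0 < t / 2 by rewrite divr_gt0.
case=> [x _|d /= d0 hd].
  have /cvgrPdist_le/(_ _ t2)/nbhs_ballP[e /= e0 he] := cw x.
  have e2 : 0 < e / 2 by rewrite divr_gt0.
  exists (ball x (e / 2), [set d | d < e / 2]) => /=.
    split; first exact: nbhsx_ballx.
    exact: nbhs_right_lt.
  move=> [x' d] /= [xx' de] y x'y.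
  have h1 := he x'; have h2 := he y; rewrite /ball /= in h1 h2 xx'.
  have {}h1 : `|w x - w x'| <= t / 2 by apply: h1; apply: lt_trans xx' _; lra.
  have {}h2 : `|w x - w y| <= t / 2.
    by apply: h2; apply: le_lt_trans (ler_distD x' _ _) _; lra.
  by apply: le_trans (ler_distD (w x) _ _) _; rewrite (distrC (w y)); lra.
exists (d / 2); first by rewrite divr_gt0.
move=> x y xab; apply: (hd (d / 2)) => //=.
- by rewrite sub0r normrN gtr0_norm ?divr_gt0// ltr_pdivrMr// mulr2n mulrDr mulr1 ltrDl.
- by rewrite divr_gt0.
Qed.

(** A short chord means that |x - y| is either near 0, where uniform continuity on [0, 1] applies,
    or near 1, where both points lie within [b] of the cut and [w] vanishes at both. *)
Lemma circle_unif_continuous (w : R -> R) (b : R) : continuous w -> 0 < b <= 1 / 2 ->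
  (forall x, w x != 0 -> b <= x <= 1 - b) ->
  forall t : R, 0 < t -> exists2 c : R, 0 < c & forall x y, Tpar x -> Tpar y ->
    normc (1 - cexp (x - y)) < c -> `|w y - w x| <= t.
Proof.
move=> cw /andP[b0 b12] wb t t0.
have [d d0 hd] := unif_continuous_segment 0 1 cw t0.
pose d' := Num.min b d.
have d'0 : 0 < d' by rewrite lt_min b0.
have d'b : d' <= b by rewrite ge_min lexx.
have d'd : d' <= d by rewrite ge_min lexx orbT.
have [c c0 far] : exists2 c : R, 0 < c &
   forall s, d' <= `|s| <= 1 - d' -> c <= normc (1 - cexp s).
  by apply: cexp_far; rewrite d'0; lra.
exists c => // x y Tx Ty xyc.
have [x0 x1] : 0 <= x /\ x < 1 by move: Tx; rewrite /Tpar /= in_itv /= => /andP[].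
have [y0 y1] : 0 <= y /\ y < 1 by move: Ty; rewrite /Tpar /= in_itv /= => /andP[].
have [xyd|xyd] := ltP `|x - y| d'.
  by apply: hd; rewrite ?x0 ?ltW// (lt_le_trans xyd).
have w0 v : 0 <= v -> v < 1 -> v < b \/ 1 - b < v -> w v = 0.
  by move=> v0 v1 hv; apply/eqP/negPn/negP => /wb /andP[]; lra.
have [far'|near] := leP `|x - y| (1 - d').
  by move: (far (x - y)); rewrite xyd far' => /(_ isT); lra.
suff [-> ->] : w x = 0 /\ w y = 0 by rewrite subrr normr0 ltW.
have [xy|xy] := leP x y.
  rewrite distrC ger0_norm ?subr_ge0// in near.
  by split; apply: w0 => //; [left|right]; lra.
rewrite gtr0_norm ?subr_gt0// in near.
by split; apply: w0 => //; [right|left]; lra.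
Qed.

End point_mass_and_topology.

(** * Regularity of finite Borel measures on the line *)

Section regularity.
Variable R : realType.
Variable tau : {finite_measure set (measurableTypeR R) -> \bar R}.
Implicit Types (A B F U : set R) (e : R).

(** Squeezing between a closed and an open set is symmetric under complement, which helps these sets
    to form a sigma-algebra. *)
Definition regular_set A := forall e : R, 0 < e -> exists F U,
  [/\ closed F, open U, F `<=` A, A `<=` U & fine (tau (U `\` F)) <= e].

Lemma le_fmU A B : measurable A -> measurable B ->
  fine (tau (A `|` B)) <= fine (tau A) + fine (tau B).
Proof.
move=> mA mB; have mU : measurable (A `|` B) by exact: measurableU.
rewrite (fm_sub tau mU mA (@subsetUl _ A B)) addrC lerD2l.
by apply: le_fm => //; [exact: measurableD|move=> x [[]]].
Qed.

Lemma regular_setC A : regular_set A -> regular_set (~` A).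
Proof.
move=> rA e /rA[F [U [cF oO FA AO h]]]; exists (~` U), (~` F); split.
- exact: open_closedC.
- exact: closed_openC.
- exact: subsetC.
- exact: subsetC.
- by rewrite setDE setCK setIC -setDE.
Qed.

Lemma regular_ocitv (a b : R) : regular_set `]a, b].
Proof.
move=> e e0; pose d n : R := n.+1%:R^-1.
have d0 n : 0 < d n by rewrite invr_gt0.
have dd n m : (n <= m)%N -> d m <= d n.
  by move=> nm; rewrite lef_pV2 ?posrE// ler_nat.
pose D n : set R := `]a, a + d n[ `|` `]b, b + d n[.
have mD n : measurable (D n) by apply: measurableU; exact: measurable_itv.
have [] := fm_cvg0 (finite_measure_lty tau (mD 0%N)) mD _ _ e0.
- move=> n m nm x; rewrite /D /= !in_itv /=; have := dd _ _ nm.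
  by move=> h [/andP[g1 g2]|/andP[g1 g2]]; [left|right]; rewrite g1 /=; lra.
- apply/seteqP; split => // x hx.
  have [n [hn1 hn2]] : exists n, (a < x -> d n <= x - a) /\ (b < x -> d n <= x - b).
    have [n1 h1] : exists n, a < x -> d n <= x - a.
      have [ax|] := ltP a x; last by exists 0%N.
      by move: ax; rewrite -subr_gt0 => /exists_invn_le[n hn]; exists n.
    have [n2 h2] : exists n, b < x -> d n <= x - b.
      have [bx|] := ltP b x; last by exists 0%N.
      by move: bx; rewrite -subr_gt0 => /exists_invn_le[n hn]; exists n.
    exists (maxn n1 n2); split => [/h1|/h2]; apply: le_trans; apply: dd.
      exact: leq_maxl.
    exact: leq_maxr.
  have := hx n I; rewrite /D /= !in_itv /= => -[/andP[g1 g2]|/andP[g1 g2]].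
    by have := hn1 g1; lra.
  by have := hn2 g1; lra.
move=> n /(_ n (leqnn n)) hn.
exists `[a + d n, b]%classic, `]a, b + d n[%classic; split.
- exact: interval_closed.
- exact: interval_open.
- by move=> x /=; rewrite !in_itv /= => /andP[h1 h2]; have := d0 n; lra.
- by move=> x /=; rewrite !in_itv /= => /andP[h1 h2]; have := d0 n; lra.
- apply: le_trans hn; apply: le_fm => //.
    by apply: measurableD; exact: measurable_itv.
  move=> x [] /=; rewrite /D /= !in_itv /= => /andP[h1 h2] /negP.
  by rewrite negb_and -!ltNge => /orP[h|h]; [left|right]; apply/andP.
Qed.

Lemma regular_bigcup (A : (set R)^nat) : (forall n, measurable (A n)) ->
  (forall n, regular_set (A n)) -> regular_set (\bigcup_k A k).
Proof.
move=> mA rA e e0.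
have e2 : 0 < e / 2 by rewrite divr_gt0.
have eps n : 0 < e / 2 / (2 ^ n.+1)%:R by rewrite divr_gt0// ltr0n expn_gt0.
pose f n := cid (rA n _ (eps n)).
pose F n := sval (f n); pose g n := cid (svalP (f n)); pose U n := sval (g n).
have h n : [/\ closed (F n), open (U n), F n `<=` A n, A n `<=` U n &
   fine (tau (U n `\` F n)) <= e / 2 / (2 ^ n.+1)%:R] by exact: svalP (g n).
have mO n : measurable (U n) by apply: open_measurable; case: (h n).
have mF n : measurable (F n) by apply: closed_measurable; case: (h n).
pose D m := \bigcup_k A k `\` \bigcup_(k < m) A k.
have mUA m : measurable (\bigcup_(k < m) A k) by exact: bigcup_measurable.
have mUA' : measurable (\bigcup_k A k) by exact: bigcupT_measurable.
have mD m : measurable (D m) by apply: measurableD.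
(* A countable union of closed sets need not be closed: only the first [m] are kept, with [m] such
   that the part of the union missed by the first [m] sets has mass at most e / 2. *)
have [] := fm_cvg0 (finite_measure_lty tau (mD 0%N)) mD _ _ e2.
- move=> n m nm x [[k _ Akx] hx]; split; first by exists k.
  by move=> [j /= jn Ajx]; apply: hx; exists j => //=; exact: leq_trans nm.
- apply/seteqP; split => // x hx; have [[k _ Akx] _] := hx 0%N I.
  by have [_] := hx k.+1 I; apply; exists k => /=.
move=> m /(_ m (leqnn m)) Dm.
exists (\bigcup_(k < m) F k), (\bigcup_k U k); split.
- by apply: closed_bigcup => [|i _]; [exact: finite_II|case: (h i)].
- by apply: bigcup_open => i _; case: (h i).
- by move=> x [k _ Fx]; exists k => //; case: (h k) => _ _ + _ _; exact.
- by move=> x [k _ Ax]; exists k => //; case: (h k) => _ _ _ + _; exact.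
have mOF n : measurable (U n `\` F n) by exact: measurableD.
have mUF : measurable (\bigcup_(k < m) F k) by exact: bigcup_measurable.
have mUO : measurable (\bigcup_k U k) by exact: bigcupT_measurable.
have mB : measurable (\bigcup_n (U n `\` F n)) by exact: bigcupT_measurable.
have sub : \bigcup_k U k `\` \bigcup_(k < m) F k `<=` \bigcup_n (U n `\` F n) `|` D m.
  move=> x [[k _ Ox] nF]; have [Ax|nA] := pselect ((\bigcup_k A k) x).
    have [[j jm Ajx]|nAm] := pselect ((\bigcup_(k < m) A k) x); last by right.
    left; exists j => //; split; first by case: (h j) => _ _ _ + _; exact.
    by move=> Fj; apply: nF; exists j.
  left; exists k => //; split => // Fk; apply: nA; exists k => //.
  by case: (h k) => _ _ + _ _; exact.
have le1 : fine (tau (\bigcup_n (U n `\` F n))) <= e / 2.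
  rewrite -lee_fin fineK ?fin_num_measure//.
  apply: le_trans (measure_sigma_subadditive tau mOF mB (@subset_refl _ _)) _.
  have := @epsilon_trick R (fun=> 0%E) (e / 2) xpredT (fun=> lexx _) (ltW e2).
  rewrite (_ : (\sum_(0 <= i <oo) 0)%E = 0%E :> \bar R) ?add0e; last by rewrite eseries0.
  move=> h0; apply: le_trans h0.
  apply: lee_nneseries => [n _ _|n _]; first exact: measure_ge0.
  rewrite add0e; case: (h n) => _ _ _ _; rewrite -lee_fin fineK ?fin_num_measure//.
  exact: mOF.
have mU : measurable (\bigcup_n (U n `\` F n) `|` D m) by exact: measurableU.
apply: le_trans (le_fm tau (measurableD mUO mUF) mU sub) _.
have : fine (tau (\bigcup_n (U n `\` F n) `|` D m)) <=
    fine (tau (\bigcup_n (U n `\` F n))) + fine (tau (D m)).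
  exact: le_fmU.
by move: le1 Dm; clear; lra.
Qed.

Lemma measurable_regular A : measurable A -> regular_set A.
Proof.
pose M := [set B : set R | measurable B /\ regular_set B].
suff : (@measurable _ (measurableTypeR R)) `<=` M by move=> h /h[].
apply: smallest_sub.
- split.
  + split; first exact: measurable0.
    move=> e e0; exists set0, set0; rewrite set0D measure0.
    by split; [exact: closed0|exact: open0|by []|by []|exact: ltW].
  + move=> B [mB rB]; rewrite setTD; split; first exact: measurableC.
    exact: regular_setC.
  + move=> B hB; split; first by apply: bigcupT_measurable => n; case: (hB n).
    by apply: regular_bigcup => n; case: (hB n).
- move=> _ [[a b] _ <-] /=; split; [exact: measurable_itv|exact: regular_ocitv].
Qed.

Lemma closed_approx A e : measurable A -> 0 < e ->
  exists F, [/\ closed F, F `<=` A & fine (tau (A `\` F)) <= e].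
Proof.
move=> mA e0; have [F [U [cF oO FA AO h]]] := measurable_regular mA e0.
exists F; split => //; apply: le_trans h.
have mF := closed_measurable cF; have mO := open_measurable oO.
by apply: le_fm; [exact: measurableD|exact: measurableD|move=> x [/AO]].
Qed.

End regularity.

(** * A criterion for a closed set to have no real mass *)

Section nullity_criterion.
Variable R : realType.
Local Notation leb := (@lebesgue_measure R).
Implicit Types (K : set R) (nu : cmeasure R).

Definition nbK K (d : R) : set R := [set x | Tpar x /\ distK K x < d].

Lemma nbK_sub K d : nbK K d `<=` Tpar. Proof. by move=> x []. Qed.

Lemma measurable_nbK K d : K !=set0 -> measurable (nbK K d).
Proof.
move=> K0; rewrite (_ : nbK K d = Tpar `&` distK K @^-1` [set` `]-oo, d[]); last first.
  by apply/seteqP; split => x /=; rewrite in_itv.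
apply: measurableI; first exact: measurable_Tpar.
rewrite -[X in measurable X]setTI; apply: (continuous_measurable_fun (continuous_distK K0)) => //.
Qed.

Lemma sub_nbK K d : K `<=` Tpar -> 0 < d -> K `<=` nbK K d.
Proof. by move=> KT d0 x Kx; split; [exact: KT|rewrite distK_mem//; exists x]. Qed.

(** Since [K] is closed the neighbourhoods shrink to [K], and continuity from above applies. *)
Lemma nbK_tail (mu : {measure set (measurableTypeR R) -> \bar R}) K (e : R) :
  closed K -> K !=set0 -> K `<=` Tpar -> (mu Tpar < +oo)%E -> 0 < e ->
  exists2 d0 : R, 0 < d0 & forall d, 0 < d <= d0 -> fine (mu (nbK K d `\` K)) <= e.
Proof.
move=> cK K0 KT fT e0.
have mK := closed_measurable cK; have mT := @measurable_Tpar R.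
pose D n := nbK K n.+1%:R^-1 `\` K.
have mD' d : measurable (nbK K d `\` K) by apply: measurableD => //; exact: measurable_nbK.
have mD n : measurable (D n) by exact: mD'.
have fD A : measurable A -> A `<=` Tpar -> (mu A < +oo)%E.
  by move=> mA AT; apply: le_lt_trans fT; apply: le_measure; rewrite ?inE.
have subT d : nbK K d `\` K `<=` Tpar by move=> x [[]].
have [] := fm_cvg0 (fD _ (mD 0%N) (@subT _)) mD _ _ e0.
- move=> n m nm x [[Tx xd] nK]; split => //; split => //; apply: lt_le_trans xd _.
  by rewrite lef_pV2 ?posrE// ler_nat.
- apply/seteqP; split => // x hx; have [[Tx _] nK] := hx 0%N I; apply: nK.
  apply: (closed_distK0 K0 cK); apply/eqP; rewrite eq_le distK_ge0// andbT leNgt.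
  apply/negP => /exists_invn_le[n hn].
  by have [[_ h] _] := hx n I; move: (lt_le_trans h hn); rewrite ltxx.
move=> n /(_ n (leqnn n)) hn; exists n.+1%:R^-1; first by rewrite invr_gt0.
move=> d /andP[d0 dn]; apply: le_trans hn.
rewrite fine_le ?ge0_fin_numE ?fD//; last 1 first.
  apply: le_measure; [by rewrite inE; exact: mD'|by rewrite inE; exact: mD|].
  by move=> x [[Tx xd] nK]; split => //; split => //; exact: lt_le_trans dn.
exact: subT.
Qed.

(* [w] is a continuous approximation of [w0], whose integral over each cell of
   length [1/n] vanishes.  The cancellation keeps the Herglotz transform of [w]
   below [e / (1 - |z|)] although [w] is very negative on [K]. *)
Definition balanced_weight nu K (d : R) (n : nat) (N eta e : R) :=
  exists (w w0 : R -> R) (M : R), [/\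
    [/\ continuous w, bm w0, 0 < M & forall y, `|w y| <= M],
    forall y, d / 2 <= distK K y -> w y = 0 /\ w0 y = 0,
    intT (fun y => `|w y - w0 y|) <= eta,
    forall j, (j < n)%N -> [/\ \int[leb]_(y in cell n j) w0 y = 0,
      \int[leb]_(y in cell n j) `|w0 y| <= 2 * N / n%:R &
      (forall y, cell n j y -> w0 y = 0) \/ (exists2 k, K k & cell n j k)] &
    [/\ \int[cm1 nu]_(y in nbK K d) expR (w y + 1) <= e,
        \int[cm2 nu]_(y in nbK K d) expR (w y + 1) <= e,
        \int[cm3 nu]_(y in nbK K d) expR (w y + 1) <= e &
        \int[cm4 nu]_(y in nbK K d) expR (w y + 1) <= e]].

Lemma expRB1_le (t : R) : 0 <= t <= 1 / 2 -> expR t - 1 <= 2 * t.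
Proof.
move=> /andP[t0 t1]; have h := expR_ge1Dx (- t).
have E0 := expR_gt0 t.
have : (1 - t) * expR t <= 1 by rewrite -ler_pdivlMr// mul1r -expRN.
have : expR t * (t * (1 - 2 * t)) >= 0.
  by rewrite mulr_ge0 ?(ltW E0)// mulr_ge0// subr_ge0; lra.
move=> h1 h2; rewrite lerBlDr.
have : expR t * (1 - t) * (1 + 2 * t) <= 1 * (1 + 2 * t).
  by apply: ler_wpM2r; [lra|rewrite mulrC].
by move: h1; clear; lra.
Qed.

(** The hypothesis yields [N] and [d0] from [e]; [d] then fixes the separation [c2] between far
    points and the weights; [n] and [eta] come last, fine enough for the Herglotz polynomial to be
    small. Near [K] the majorant of |p| is exp (w + 1): one half of this 1 is the error allowed in
    [exists_herglotz_poly], the other half the loss in [exists_exp_poly]. *)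
Lemma cm_re_closed nu K (b : R) : fast_decay nu -> closed K -> 0 < b <= 1 / 2 ->
  (forall k, K k -> b <= k <= 1 - b) ->
  (forall e : R, 0 < e <= 1 -> exists (N d0 : R), [/\ 0 <= N, 0 < d0 & forall d, 0 < d <= d0 ->
     exists n0, forall n, (n0 <= n)%N -> forall eta, 0 < eta ->
     balanced_weight nu K d n N eta e]) ->
  cm_re nu K = 0.
Proof.
move=> [c [c0 [C hC]]] cK /andP[b0 b12] Kb H.
have [->|/set0P K0] := eqVneq K set0; first by rewrite /cm_re !measure0 subrr.
have [A0 [K1 [A00 K10 near1]]] := pairing_near1 c0 hC.
have mK : measurable K by exact: closed_measurable.
have KT : K `<=` Tpar.
  by move=> x /Kb /andP[x0 x1]; rewrite /Tpar /= in_itv /=; apply/andP; split; lra.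
have mT := @measurable_Tpar R.
apply: cm_re_test => // e /andP[e0 e1].
have [N [d0 [N0 d00 Hd]]] := H e (introT andP (conj e0 e1)).
have tail (tau : {finite_measure set (measurableTypeR R) -> \bar R}) :
    exists2 d1 : R, 0 < d1 & forall d, 0 < d <= d1 -> fine (tau (nbK K d `\` K)) <= e.
  by apply: nbK_tail => //; exact: finite_measure_lty.
have [d1 d10 t1] := tail (cm1 nu); have [d2 d20 t2] := tail (cm2 nu).
have [d3 d30 t3] := tail (cm3 nu); have [d4 d40 t4] := tail (cm4 nu).
pose d := Num.min b (Num.min d0 (Num.min (Num.min d1 d2) (Num.min d3 d4))).
have dgt0 : 0 < d by rewrite !lt_min b0 d00 d10 d20 d30 d40.
have [db dd0] : d <= b /\ d <= d0 by rewrite /d !ge_min !lexx ?orbT.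
have [dd1 dd2] : d <= d1 /\ d <= d2 by rewrite /d !ge_min !lexx ?orbT.
have [dd3 dd4] : d <= d3 /\ d <= d4 by rewrite /d !ge_min !lexx ?orbT.
have d2' : 0 < d / 2 by rewrite divr_gt0.
have [c1 c10 far] : exists2 c1 : R, 0 < c1 &
   forall s, d / 2 <= `|s| <= 1 - d / 2 -> c1 <= normc (1 - cexp s).
  by apply: cexp_far; rewrite d2' /=; move: db b12 dgt0; clear; lra.
pose c2 := Num.min 1 c1.
have c20 : 0 < c2 by rewrite lt_min ltr01.
have c21 : 0 < c2 <= 1 by rewrite c20 ge_min lexx.
have c2c1 : c2 <= c1 by rewrite ge_min lexx orbT.
(* The first two bounds serve [near1] and its error [K1 * t]; t <= e / 2 gives exp t - 1 <= e on the
   far set. *)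
pose t := Num.min A0 (Num.min (e / (K1 + 1)) (e / 2)).
have t0 : 0 < t.
  by rewrite !lt_min A00 !divr_gt0// ltr_wpDl.
have [n0 Hn] := Hd d (introT andP (conj dgt0 dd0)).
have N1 : 0 < N + 1 by rewrite ltr_wpDl.
have [a [a0 aE]] : exists a : R, 0 < a /\ a = 10000 by exists 10000; rewrite ltr0n.
have aN : 0 < a * (N + 1) by rewrite mulr_gt0.
(* The bound d / 2 keeps every cell that meets [K] within d / 2 of it. The factor 10000 = 2 * 5000
   leaves at most t / 2 to each term in N / n, the other half of [t] going to [eta]. *)
pose s := Num.min (d / 2) (Num.min (t / (a * (N + 1))) (t * c2 ^+ 2 / (a * (N + 1)))).
have tc2 : 0 < t * c2 ^+ 2 by rewrite mulr_gt0// exprn_gt0.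
have s0 : 0 < s by rewrite !lt_min d2' (divr_gt0 t0 aN) (divr_gt0 tc2 aN).
have [m hm] := exists_invn_le s0.
pose n := maxn 16 (maxn n0 m.+1).
have n16 : (16 <= n)%N by rewrite leq_maxl.
have nn0 : (n0 <= n)%N by rewrite !leq_max leqnn orbT.
have ngt0 : (0 < n)%N by apply: leq_trans n16.
have ns : n%:R^-1 <= s.
  apply: le_trans hm; rewrite lef_pV2 ?posrE ?ltr0n// ler_nat.
  by rewrite !leq_max leqnn !orbT.
have sd : s <= d / 2 by rewrite ge_min lexx.
have st1 : s <= t / (a * (N + 1)) by rewrite /s !ge_min lexx ?orbT.
have st2 : s <= t * c2 ^+ 2 / (a * (N + 1)) by rewrite /s !ge_min lexx ?orbT.
pose eta := t * c2 / 10.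
have eta0 : 0 < eta by rewrite divr_gt0// mulr_gt0.
have [w [w0 [M [[cw bw0 M0 wM] wsupp weta wcell [i1 i2 i3 i4]]]]] := Hn n nn0 eta eta0.
have bw : bm w by apply: bm_continuous => //; exists M.
pose X := Tpar `\` nbK K d.
have XT : X `<=` Tpar by move=> x [].
(* A point x off [nbK K d] is at least d away from k, and k lies in [b, 1 - b] with d <= b, so |x -
   y| keeps a distance d / 2 from both 0 and 1. *)
have nearK y k : K k -> `|y - k| <= d / 2 -> forall x, X x -> c2 <= normc (1 - cexp (x - y)).
  move=> Kk yk x [Tx nx]; apply: le_trans c2c1 _; apply: far.
  have xk : d <= `|x - k|.
    apply: le_trans (distK_le K0 x Kk); rewrite leNgt; apply/negP => h; exact: nx.
  have := Kb k Kk; move: Tx; rewrite /Tpar /= in_itv /= => /andP[x0 x1] /andP[k0 k1].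
  apply/andP; split.
    by have := ler_distD y x k; move: xk yk; clear; lra.
  move: yk; rewrite !ler_norml; move: x0 x1 k0 k1 db; clear.
  by move=> x0 x1 k0 k1 db /andP[h1 h2]; apply/andP; split; lra.
have Xw0 x : X x -> forall j, (j < n)%N -> (forall y, cell n j y -> w0 y = 0) \/
    (forall y, cell n j y -> c2 <= normc (1 - cexp (x - y))).
  move=> Xx j jn; have [_ _ [|[k Kk ck]]] := wcell j jn; [by left|right => y cy].
  apply: (nearK y k) => //; apply: le_trans (cell_dist ngt0 cy ck) _.
  exact: le_trans ns sd.
have Xw x : X x -> forall y, Tpar y -> w y - w0 y = 0 \/ c2 <= normc (1 - cexp (x - y)).
  move=> Xx y Ty; have [yd|yd] := leP (d / 2) (distK K y).
    by left; have [-> ->] := wsupp _ yd; rewrite subrr.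
  by right; have [k Kk kd] := distK_lt K0 yd; apply: (nearK y k) => //; exact: ltW.
have wb y : w y != 0 -> b / 2 <= y <= 1 - b / 2.
  move=> wy; have yd : distK K y < d / 2.
    by rewrite ltNge; apply/negP => /wsupp[/eqP]; rewrite (negPf wy).
  have [k /Kb /andP[k0 k1]] := distK_lt K0 yd.
  rewrite ltr_norml; move: k0 k1 db; clear => k0 k1 db /andP[h1 h2].
  by apply/andP; split; lra.
have b2 : 0 < b / 2 <= 1 / 2 by rewrite divr_gt0//=; move: b12 b0; clear; lra.
have half : 0 < 1 / 2 :> R by [].
have [S [S1 S2 S3]] := exists_herglotz_poly n16 N0 bw bw0
  (fun j jn => let: And3 h _ _ := wcell j jn in h)
  (fun j jn => let: And3 _ h _ := wcell j jn in h)
  M0 wM (circle_unif_continuous cw b2 wb) weta XT c21 Xw0 Xw half.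
have [p [p1 p2]] := exists_exp_poly S.
have N10000 : 5000 * N / n%:R <= t / 2.
  have : N / n%:R <= (N + 1) * s by rewrite ler_pM ?invr_ge0 ?ler0n ?lerDl.
  by move: st1; rewrite ler_pdivlMr// aE -mulrA; clear; lra.
have A1 : 3 * eta + 5000 * N / n%:R <= t.
  have : t * c2 <= t * 1 by rewrite ler_pM2l//; case/andP: c21.
  by rewrite /eta; move: N10000 t0; clear; lra.
have A2 : 5 * eta / c2 + 260 * N / n%:R / c2 ^+ 2 <= t.
  have -> : 5 * eta / c2 = t / 2 by rewrite /eta; field; rewrite gt_eqF.
  rewrite -lerBrDl ler_pdivrMr ?exprn_gt0//.
  have : N / n%:R <= (N + 1) * s by rewrite ler_pM ?invr_ge0 ?ler0n ?lerDl.
  have : 0 <= (N + 1) * s by rewrite mulr_ge0// ltW.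
  by move: st2; rewrite ler_pdivlMr// aE -mulrA; clear; lra.
have tA0 : t <= A0 by rewrite ge_min lexx.
have te1 : t <= e / (K1 + 1) by rewrite /t !ge_min lexx ?orbT.
have te2 : t <= e / 2 by rewrite /t !ge_min lexx ?orbT.
exists p, (nbK K d), (fun y => expR (w y + 1)); split.
- exact: measurable_nbK.
- exact: sub_nbK.
- exact: nbK_sub.
- by apply: bm_expR; apply: bmD => //; exact: bm_cst.
split.
- move=> x [Tx _]; apply: le_trans (p2 _ (normc_cexp x)) _; rewrite ler_expR.
  by have := S2 x Tx; clear; lra.
- apply: le_trans (near1 t p _ _) _; first by rewrite (ltW t0).
    move=> z z1; apply: le_trans (p1 z) _; rewrite lerD2r ler_expR.
    apply: le_trans (S1 z z1) _; rewrite ler_wpM2r// invr_ge0 subr_ge0.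
    exact: ltW.
  apply: le_trans (_ : K1 * (e / (K1 + 1)) <= _); first by rewrite ler_wpM2l.
  by rewrite mulrCA ler_piMr ?(ltW e0)// ler_pdivrMr ?mul1r ?lerDl// ltr_wpDl.
- move=> x Xx; apply: le_trans (p1 _) _.
  have h := le_trans (S3 x Xx) A2.
  apply: le_trans (_ : expR (e / 2) - 1 <= _).
    by rewrite lerD2r ler_expR (le_trans h).
  apply: le_trans (expRB1_le _) _; last by rewrite mulrC divfK.
  by rewrite divr_ge0 ?(ltW e0)//= ler_pM2r.
- split; [apply: t1|apply: t2|apply: t3|apply: t4]; by rewrite dgt0.
- by [].
Qed.

End nullity_criterion.

(** * Absolute continuity *)

Section riesz.
Variable R : realType.
Local Notation leb := (@lebesgue_measure R).
Implicit Types (A K : set R) (nu : cmeasure R).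

(** Inner regularity for [cm1] and for [cm2] gives two closed sets, whose union serves both
    measures. Near the cut the mass is small once the point 0 is removed, and that point is covered
    by hypothesis. *)
Lemma cm_re_inner nu A : measurable A -> A `<=` Tpar -> cm_re nu [set 0] = 0 ->
  (forall K (b : R), closed K -> K `<=` A -> 0 < b <= 1 / 2 ->
     (forall k, K k -> b <= k <= 1 - b) -> cm_re nu K = 0) ->
  cm_re nu A = 0.
Proof.
move=> mA AT at0 HK; apply: (@ler0_eps _ _ 4) => e /andP[e0 _].
have [n /(_ n (leqnn n)) [t1 t2 _ _]] := endpoint_nbhd_tail nu e0.
pose b : R := n.+2%:R^-1.
have b0 : 0 < b by rewrite invr_gt0.
pose A' := A `&` `[b, 1 - b].
have mA' : measurable A' by apply: measurableI => //; exact: measurable_itv.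
have [F1 [cF1 F1A h1]] := closed_approx (cm1 nu) mA' e0.
have [F2 [cF2 F2A h2]] := closed_approx (cm2 nu) mA' e0.
pose K := F1 `|` F2.
have KA' : K `<=` A' by move=> x [/F1A|/F2A].
have cK : closed K by exact: closedU.
have mK : measurable K by exact: closed_measurable.
have Kz : cm_re nu K = 0.
  apply: (HK K b) => //; first by move=> x /KA'[].
    by rewrite b0; exact: invn2_le.
  by move=> k /KA'[_]; rewrite /= in_itv.
have mz : measurable [set (0 : R)] by exact: measurable_set1.
pose rest := (A `\` [set 0]) `\` K.
have mAz : measurable (A `\` [set 0]) by exact: measurableD.
have mrest : measurable rest by exact: measurableD.
have K0 : K `<=` A `\` [set 0].
  move=> x /KA'[Ax]; rewrite /= in_itv /= => /andP[bx _]; split => // x0.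
  by move: (lt_le_trans b0 bx); rewrite x0 ltxx.
have sub : rest `<=` endpoint_nbhd n `|` (A' `\` K).
  move=> x [[Ax x0] nK]; have := AT x Ax; rewrite /Tpar /= in_itv /= => /andP[x0' x1].
  have xgt0 : 0 < x by rewrite lt_neqAle x0' andbT eq_sym; apply/eqP.
  have [xb|bx] := ltP x b; first by left; left; rewrite /= in_itv /= xgt0.
  have [xb|xb] := ltP (1 - b) x; first by left; right; rewrite /= in_itv /= xb.
  by right; split => //; split => //; rewrite /= in_itv /= bx.
have mE := @measurable_endpoint_nbhd R n.
have mAK : measurable (A' `\` K) by exact: measurableD.
have bound (tau : {finite_measure set (measurableTypeR R) -> \bar R}) F :
    measurable F -> F `<=` K -> fine (tau (endpoint_nbhd n)) <= e ->
    fine (tau (A' `\` F)) <= e -> fine (tau rest) <= 2 * e.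
  move=> mF FK g1 g2; apply: le_trans (le_fm tau mrest (measurableU _ _ mE mAK) sub) _.
  apply: le_trans (le_fmU tau mE mAK) _.
  have : fine (tau (A' `\` K)) <= fine (tau (A' `\` F)).
    apply: le_fm => //; first exact: measurableD.
    by move=> x [Ax nK]; split => // /FK.
  by move: g1 g2; clear; lra.
have r1 := bound (cm1 nu) F1 (closed_measurable cF1) (@subsetUl _ _ _) t1 h1.
have r2 := bound (cm2 nu) F2 (closed_measurable cF2) (@subsetUr _ _ _) t2 h2.
have atA : cm_re nu (A `&` [set 0]) = 0.
  have [A0|nA0] := pselect (A 0).
    by rewrite (_ : A `&` [set 0] = [set 0])//; apply/seteqP; split => x [] // ->.
  rewrite (_ : A `&` [set 0] = set0) ?/cm_re ?measure0 ?subrr//.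
  by apply/seteqP; split => // x [/[swap] ->].
have dec (tau : {finite_measure set (measurableTypeR R) -> \bar R}) :
    fine (tau A) = fine (tau rest) + fine (tau K) + fine (tau (A `&` [set 0])).
  by rewrite (fmDI tau mA mz) (fm_sub tau mAz mK K0).
have f1 := fm_ge0 (cm1 nu) rest; have f2 := fm_ge0 (cm2 nu) rest.
move: Kz atA; rewrite /cm_re !dec ler_norml; move: r1 r2 f1 f2 e0; clear.
by move=> *; apply/andP; split; lra.
Qed.

Lemma Rint_indic (mu : {measure set (measurableTypeR R) -> \bar R}) (A B : set R) :
  measurable A -> measurable B -> \int[mu]_(x in A) \1_B x = fine (mu (B `&` A)).
Proof. by move=> mA mB; rewrite /Rintegral integral_indic. Qed.

Lemma Rint_indic_fm (tau : {finite_measure set (measurableTypeR R) -> \bar R})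
  (A B : set R) : measurable A -> measurable B -> B `<=` A ->
  \int[tau]_(x in A) \1_B x = fine (tau B).
Proof. by move=> mA mB BA; rewrite Rint_indic// (setIidl BA). Qed.

Lemma intT_indic (B : set R) : measurable B -> B `<=` Tpar -> intT \1_B = fine (leb B).
Proof.
move=> mB BT; rewrite /intT Rint_indic//; last exact: measurable_Tpar.
by rewrite (setIidl BT).
Qed.

Section bump.
Variables (K : set R) (rho : R).
Hypotheses (K0 : K !=set0) (rho0 : 0 < rho).

Definition bump (y : R) : R := Num.max 0 (1 - distK K y / rho).

Lemma continuous_bump : continuous bump.
Proof.
move=> y; apply: (@continuous_max R R (fun=> 0) (fun y => 1 - distK K y / rho)); first exact: cvg_cst.
apply: cvgB; first exact: cvg_cst.
by apply: cvgM; [exact: continuous_distK|exact: cvg_cst].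
Qed.

Lemma bump_ge0 y : 0 <= bump y. Proof. by rewrite le_max lexx. Qed.

Lemma bump_le1 y : bump y <= 1.
Proof. by rewrite ge_max ler01 gerBl divr_ge0 ?distK_ge0// ltW. Qed.

Lemma bump_mem y : K y -> bump y = 1.
Proof. by move=> Ky; rewrite /bump distK_mem// mul0r subr0 max_r. Qed.

Lemma bump_far y : rho <= distK K y -> bump y = 0.
Proof. by move=> h; rewrite /bump max_l// subr_le0 ler_pdivlMr// mul1r. Qed.

Lemma bm_bump : bm bump.
Proof.
apply: bm_continuous; first exact: continuous_bump.
by exists 1 => y; rewrite ger0_norm ?bump_ge0// bump_le1.
Qed.

Lemma bump_le_indic y : Tpar y -> bump y <= \1_(nbK K rho `\` K) y + \1_K y.
Proof.
move=> Ty; rewrite !indicE; have [Ky|nKy] := pselect (K y).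
  by rewrite (mem_set Ky) (le_trans (bump_le1 y))// lerDr.
have [h|h] := leP rho (distK K y); first by rewrite bump_far// addr_ge0.
have -> : y \in nbK K rho `\` K by apply/mem_set.
by rewrite (le_trans (bump_le1 y))// lerDl.
Qed.

End bump.

(** Here [w0] is 0, so the mass parameter of [balanced_weight] is 0. The local [N] is the depth of
    the bump [w], fixed by [e]; since [K] is null, the bump can then be made so thin that its L^1
    norm is at most [eta]. *)
Lemma cm_re_null_closed nu K (b : R) : fast_decay nu -> closed K -> leb K = 0%E ->
  0 < b <= 1 / 2 -> (forall k, K k -> b <= k <= 1 - b) -> cm_re nu K = 0.
Proof.
move=> hnu cK K0 b12 Kb.
have [->|/set0P Kn0] := eqVneq K set0; first by rewrite /cm_re !measure0 subrr.
have mK : measurable K by exact: closed_measurable.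
have KT : K `<=` Tpar.
  move=> x /Kb /andP[x0 x1]; rewrite /Tpar /= in_itv /=.
  by case/andP: b12 => b0 _; apply/andP; split; lra.
apply: (cm_re_closed hnu cK b12 Kb) => e /andP[e0 e1].
have E1 := expR_gt0 (1 : R).
(* Off [K] the integrand exp (w + 1) is only bounded by exp 1, so the mass there must be at most e /
   (2 exp 1); on [K] the depth [N] provides the other half of e. *)
have eE : 0 < e / (2 * expR 1) by rewrite divr_gt0// mulr_gt0.
pose T := fine (cm1 nu Tpar) + fine (cm2 nu Tpar) + fine (cm3 nu Tpar) + fine (cm4 nu Tpar).
have T1 := fm_ge0 (cm1 nu) Tpar; have T2 := fm_ge0 (cm2 nu) Tpar.
have T3 := fm_ge0 (cm3 nu) Tpar; have T4 := fm_ge0 (cm4 nu) Tpar.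
have T0 : 0 <= T by rewrite /T !addr_ge0.
pose N := 2 * expR 1 * T / e.
have N0 : 0 <= N by rewrite divr_ge0 ?(ltW e0)// mulr_ge0// mulr_ge0// ltW.
have NE : expR (1 - N) * T <= e / 2.
  rewrite expRD expRN mulrAC ler_pdivrMr ?expR_gt0//.
  have := expR_ge1Dx N; have -> : expR 1 * T = e / 2 * N by rewrite /N; field; rewrite gt_eqF.
  by move=> h; rewrite ler_pM2l ?divr_gt0//; move: h; clear; lra.
have tail (tau : {finite_measure set (measurableTypeR R) -> \bar R}) :
    exists2 d1 : R, 0 < d1 & forall d, 0 < d <= d1 ->
    fine (tau (nbK K d `\` K)) <= e / (2 * expR 1).
  by apply: nbK_tail => //; apply: finite_measure_lty; exact: measurable_Tpar.
have [d1 d10 t1] := tail (cm1 nu); have [d2 d20 t2] := tail (cm2 nu).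
have [d3 d30 t3] := tail (cm3 nu); have [d4 d40 t4] := tail (cm4 nu).
exists 0, (Num.min (Num.min d1 d2) (Num.min d3 d4)); split => //.
  by rewrite !lt_min d10 d20 d30 d40.
move=> d /andP[d0]; rewrite !le_min => /andP[/andP[dd1 dd2] /andP[dd3 dd4]].
exists 1%N => n n1 eta eta0.
have N1 : 0 < N + 1 by rewrite ltr_wpDl.
have [r r0 hr] := nbK_tail cK Kn0 KT (@leb_Tpar_lty R) (divr_gt0 eta0 N1).
pose rho := Num.min r (d / 2).
have rho0 : 0 < rho by rewrite lt_min r0 divr_gt0.
have rhor : rho <= r by rewrite ge_min lexx.
have rhod : rho <= d / 2 by rewrite ge_min lexx orbT.
pose w y := - (N * bump K rho y).
have bN (c : R) : bm (fun y => c * bump K rho y).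
  by apply: bmM; [exact: bm_cst|exact: bm_bump].
have mnb v := measurable_nbK v Kn0.
have mnbK v : measurable (nbK K v `\` K) by exact: measurableD.
have w0 y : w y <= 0 by rewrite oppr_le0 mulr_ge0// bump_ge0.
exists w, (fun=> 0), (N + 1); split.
- split => // [y||y].
  + by apply: cvgN; apply: cvgM; [exact: cvg_cst|exact: continuous_bump].
  + exact: bm_cst.
  + rewrite normrN normrM !ger0_norm ?bump_ge0//.
    by apply: le_trans (ler_wpM2l N0 (bump_le1 Kn0 rho0 y)) _; rewrite mulr1 lerDl.
- by move=> y yd; rewrite /w bump_far ?mulr0 ?oppr0// (le_trans rhod).
- have -> : intT (fun y => `|w y - 0|) = intT (fun y => N * bump K rho y).
    apply: eq_intT => y; rewrite subr0 normrN ger0_norm// mulr_ge0// bump_ge0//.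
  apply: le_trans (_ : intT (fun y => N * (\1_(nbK K rho `\` K) y + \1_K y)) <= _).
    apply: le_intT => //.
      by apply: bmM; [exact: bm_cst|apply: bmD; exact: bm_indic].
    by move=> y Ty; rewrite ler_wpM2l// bump_le_indic.
  rewrite intTZl; last by apply: bmD; exact: bm_indic.
  rewrite intTD; [|exact: bm_indic|exact: bm_indic].
  rewrite !intT_indic//; last by move=> x [[]].
  rewrite K0 /= addr0.
  have /hr h : 0 < rho <= r by rewrite rho0.
  apply: le_trans (ler_wpM2l N0 h) _.
  by rewrite mulrCA ler_piMr ?(ltW eta0)// ler_pdivrMr// mul1r lerDl.
- move=> j jn; split; last by left.
    by rewrite Rintegral_cst ?mul0r//; exact: measurable_cell.
  rewrite normr0 Rintegral_cst ?mul0r ?mulr0 ?mul0r//; exact: measurable_cell.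
have bound (tau : {finite_measure set (measurableTypeR R) -> \bar R}) :
    fine (tau Tpar) <= T -> fine (tau (nbK K d `\` K)) <= e / (2 * expR 1) ->
    \int[tau]_(y in nbK K d) expR (w y + 1) <= e.
  move=> h1 h2; have fV := finite_measure_lty tau (mnb d).
  apply: le_trans (_ : \int[tau]_(y in nbK K d)
      (expR (1 - N) + expR 1 * \1_(nbK K d `\` K) y) <= _).
    apply: bm_le_Rint => //.
    - apply/bm_expR/bmD; [exact/bmN/bN|exact: bm_cst].
    - apply: bmD; [exact: bm_cst|apply: bmM; [exact: bm_cst|exact: bm_indic]].
    - move=> y nby; have [Ky|nKy] := pselect (K y).
        by rewrite /w bump_mem// mulr1 addrC lerDl mulr_ge0 ?expR_ge0.
      have -> : \1_(nbK K d `\` K) y = 1 :> R by rewrite indicE mem_set.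
      by rewrite mulr1 -[leLHS]add0r lerD ?expR_ge0// ler_expR gerDr.
  rewrite bm_RintD//; [|exact: bm_cst|apply: bmM; [exact: bm_cst|exact: bm_indic]].
  rewrite bm_RintZl//; last exact: bm_indic.
  have -> : \int[tau]_(x in nbK K d) \1_(nbK K d `\` K) x = fine (tau (nbK K d `\` K)).
    by apply: Rint_indic_fm => //; move=> x [].
  rewrite Rintegral_cst; last exact: mnb.
  have g1 : expR (1 - N) * fine (tau (nbK K d)) <= e / 2.
    apply: le_trans NE; rewrite ler_wpM2l ?expR_ge0//; apply: le_trans h1.
    by apply: le_fm => //; [exact: measurable_Tpar|exact: nbK_sub].
  have g2 : expR 1 * fine (tau (nbK K d `\` K)) <= e / 2.
    apply: le_trans (ler_wpM2l (ltW E1) h2) _.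
    by rewrite le_eqVlt; apply/orP; left; apply/eqP; field; rewrite gt_eqF.
  by move: g1 g2; clear; lra.
split; apply: bound; rewrite /T;
  try (by [apply: t1; rewrite d0|apply: t2; rewrite d0|apply: t3; rewrite d0|apply: t4; rewrite d0]);
  by move: T1 T2 T3 T4; clear; lra.
Qed.

Lemma cm_re_null nu A : fast_decay nu -> measurable A -> A `<=` Tpar ->
  leb A = 0%E -> cm_re nu A = 0.
Proof.
move=> hnu mA AT A0; apply: cm_re_inner => //; first exact: cm_re_at0.
move=> K b cK KA b12 Kb; apply: (cm_re_null_closed hnu cK _ b12 Kb).
apply/eqP; rewrite -measure_le0 -A0; apply: le_measure; rewrite ?inE//.
exact: closed_measurable.
Qed.

End riesz.

(** * Exchanging real and imaginary parts *)

Section imaginary_rotation.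
Variable R : realType.
Implicit Types nu : cmeasure R.

(** This is i nu = (m4 - m3) + i (m1 - m2): up to sign, the imaginary part of [nu] becomes a real
    part, and the Fourier coefficients keep their moduli. *)
Definition cm_mulI nu : cmeasure R :=
  CMeasure (cm_supp4 nu) (cm_supp3 nu) (cm_supp1 nu) (cm_supp2 nu).

Lemma cm_re_mulI nu A : cm_re (cm_mulI nu) A = - cm_im nu A.
Proof. by rewrite /cm_re /cm_im /= opprB. Qed.

Lemma fast_decay_mulI nu : fast_decay nu -> fast_decay (cm_mulI nu).
Proof.
move=> [c [c0 [C hC]]]; exists c; split => //; exists C => n.
suff -> : fcoef_abs (cm_mulI nu) n = fcoef_abs nu n by [].
rewrite /fcoef_abs addrC; congr (Num.sqrt (_ + _)).
  by congr (_ ^+ 2); rewrite /fcoef_re /fcoef_im /=; ring.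
by rewrite -sqrrN; congr (_ ^+ 2); rewrite /fcoef_re /fcoef_im /=; ring.
Qed.

End imaginary_rotation.

(** * Measures with densities and the Radon-Nikodym theorem *)

Section densities.
Variable R : realType.
Local Notation leb := (@lebesgue_measure R).
Local Notation fmeas := {finite_measure set (measurableTypeR R) -> \bar R}.

Section density_measure.
Variable f : R -> R.
Hypothesis f0 : forall x, 0 <= f x.
Hypothesis fi : leb.-integrable [set: R] (EFin \o f).

(** The proofs are carried as arguments so that the finite measure structure can be attached to the
    term [dens f0 fi] itself. *)
Definition dens (f0' : forall x, 0 <= f x)
    (fi' : leb.-integrable [set: R] (EFin \o f)) (A : set (measurableTypeR R)) :=
  (\int[leb]_(x in A) (f x)%:E)%E.

Local Notation df := (dens f0 fi).

Let dens0 : df set0 = 0%E. Proof. by rewrite /dens integral_set0. Qed.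

Let dens_ge0 A : (0 <= df A)%E.
Proof. by rewrite /dens integral_ge0// => x _; rewrite lee_fin. Qed.

Let dens_sigma_additive : semi_sigma_additive df.
Proof.
move=> A mA tA mUA; rewrite /dens integral_bigcup//=; last first.
  exact: (integrableS _ _ (@subsetT _ _) fi).
apply: is_cvg_ereal_nneg_natsum_cond => n _ _.
by apply: integral_ge0 => x _; rewrite lee_fin.
Qed.

HB.instance Definition _ := isMeasure.Build _ _ _ df dens0 dens_ge0 dens_sigma_additive.

Let dens_fin : fin_num_fun df.
Proof.
move=> A mA; apply: (integrable_fin_num (mu := leb)) => //.
exact: (integrableS _ _ (@subsetT _ _) fi).
Qed.

HB.instance Definition _ := @Measure_isFinite.Build _ _ _ df dens_fin.

Lemma dens_dominates : df `<< leb.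
Proof.
apply/null_content_dominatesP => A mA A0; rewrite /dens.
apply: null_set_integral => //.
by apply/measurable_funTS; apply: (measurable_int leb).
Qed.

(** Change of variables is applied with the Radon-Nikodym derivative of [dens], which agrees with
    [f] almost everywhere because both have the same integrals over measurable sets. *)
Lemma integral_dens (D : set R) (h : R -> R) : measurable D -> bm h ->
  (forall x, 0 <= h x) ->
  (\int[df]_(x in D) (h x)%:E = \int[leb]_(x in D) (h x * f x)%:E)%E.
Proof.
move=> mD [mh _] h0.
have mf : measurable_fun [set: R] (EFin \o f) by exact: (measurable_int leb).
have meh : measurable_fun D (EFin \o h) by apply/measurable_EFinP; exact: measurable_funTS.
have := @Radon_Nikodym_SigmaFinite.change_of_variables _ _ R df leb dens_dominates
  (EFin \o h) D (fun x => h0 x) mD meh.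
move=> /= <-.
have mr : measurable_fun [set: R] (Radon_Nikodym_SigmaFinite.f df leb).
  exact: (measurable_int leb (Radon_Nikodym_SigmaFinite.f_integrable dens_dominates)).
apply: ae_eq_integral => //.
- by apply: emeasurable_funM => //; exact: measurable_funTS.
- apply/measurable_EFinP; apply: measurable_funM; first exact: measurable_funTS.
  by apply: measurable_funTS; apply/measurable_EFinP.
have : ae_eq leb D (Radon_Nikodym_SigmaFinite.f df leb) (EFin \o f).
  apply: integral_ae_eq => //.
  - apply: (integrableS measurableT) => //.
    exact: (Radon_Nikodym_SigmaFinite.f_integrable dens_dominates).
  - exact: measurable_funTS.
  - by move=> A AD mA; rewrite -Radon_Nikodym_SigmaFinite.f_integral//; exact: dens_dominates.
by apply: filterS => x /= hx Dx; rewrite hx// EFinM.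
Qed.

End density_measure.

(** Radon-Nikodym for the signed charge m1 - m2. Only the difference is dominated by Lebesgue
    measure: m1 and m2 may share a singular part. *)
Lemma exists_density (m1 m2 : fmeas) :
  m1 (~` Tpar) = 0%E -> m2 (~` Tpar) = 0%E ->
  (forall A : set R, measurable A -> A `<=` Tpar -> leb A = 0%E ->
     fine (m1 A) - fine (m2 A) = 0) ->
  exists g : R -> R, leb.-integrable [set: R] (EFin \o g) /\
    forall A : set R, measurable A ->
    (fine (m1 A) - fine (m2 A))%:E = (\int[leb]_(x in A) (g x)%:E)%E.
Proof.
move=> s1 s2 H.
pose c := cadd (charge_of_finite_measure m1) (cscale (-1) (charge_of_finite_measure m2)).
have cE (A : set R) : measurable A -> c A = (fine (m1 A) - fine (m2 A))%:E.
  move=> mA; rewrite EFinB !fineK ?fin_num_measure//.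
  by rewrite -[LHS]/(m1 A + (-1)%:E * m2 A)%E EFinN mulNe mul1e.
have mT := @measurable_Tpar R; have mTc := measurableC mT.
have sup (m : fmeas) (A : set R) : measurable A -> m (~` Tpar) = 0%E ->
    fine (m A) = fine (m (A `&` Tpar)).
  move=> mA s; rewrite (fmDI m mA mT) (_ : fine (m (A `\` Tpar)) = 0) ?add0r//.
  apply/eqP; rewrite eq_le fm_ge0 andbT.
  have : fine (m (A `\` Tpar)) <= fine (m (~` Tpar)).
    by apply: le_fm => //; exact: measurableD.
  by move/le_trans; apply; have -> : m (~` Tpar) = 0%E by exact: s.
have cdom : c `<< leb.
  apply/null_content_dominatesP => A mA A0; rewrite cE//.
  rewrite (sup m1)// (sup m2)// H//; first exact: measurableI.
  apply/eqP; rewrite -measure_le0 -A0; apply: le_measure; rewrite ?inE//.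
  exact: measurableI.
have rfin x : Radon_Nikodym c leb x \is a fin_num by exact: Radon_Nikodym_fin_num.
exists (fun x => fine (Radon_Nikodym c leb x)).
have gE : EFin \o (fun x => fine (Radon_Nikodym c leb x)) = Radon_Nikodym c leb.
  by apply/funext => x /=; rewrite fineK.
split; first by rewrite gE; exact: Radon_Nikodym_integrable.
move=> A mA; rewrite -cE//; apply: etrans (Radon_Nikodym_integral cdom mA) _.
by apply: eq_integral => x _; rewrite fineK.
Qed.

(** Written as m1 + p2 = p1 + m2, the hypothesis equates two positive measures on the circle, which
    then integrate [h] alike. *)
Lemma eq_rint_diff (m1 m2 p1 p2 : fmeas) (h : R -> R) : bm h ->
  (forall A : set R, measurable A -> A `<=` Tpar ->
     fine (m1 A) - fine (m2 A) = fine (p1 A) - fine (p2 A)) ->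
  rint m1 h - rint m2 h = rint p1 h - rint p2 h.
Proof.
move=> bh H; have mT := @measurable_Tpar R.
have fi (m : fmeas) : m.-integrable Tpar (EFin \o h).
  by apply: bm_integrable => //; exact: finite_measure_lty.
have mh : measurable_fun Tpar (EFin \o h) by exact: (measurable_int m1).
have E : (\int[measure_add m1 p2]_(x in Tpar) (h x)%:E =
          \int[measure_add p1 m2]_(x in Tpar) (h x)%:E)%E.
  apply: eq_measure_integral => A mA AT.
  apply: etrans (measure_addE m1 p2 A) _; apply/esym.
  apply: etrans (measure_addE p1 m2 A) _; apply/esym.
  have e := H A mA AT.
  have fk (m : fmeas) : m A = (fine (m A))%:E by rewrite fineK ?fin_num_measure.
  suff : ((fine (m1 A))%:E + (fine (p2 A))%:E = (fine (p1 A))%:E + (fine (m2 A))%:E)%E.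
    by rewrite -!fk.
  rewrite -!EFinD; congr EFin.
  by move: e; clear; lra.
rewrite !integral_measure_add// in E; try exact: fi.
have ff (m : fmeas) : (\int[m]_(x in Tpar) (h x)%:E)%E \is a fin_num.
  by apply: (integrable_fin_num (mu := m)) => //; exact: fi.
have : rint m1 h + rint p2 h = rint p1 h + rint m2 h.
  by rewrite /rint -(fineD (ff m1) (ff p2)) -(fineD (ff p1) (ff m2)); congr fine.
by clear; lra.
Qed.

End densities.

(** * Local integrability of the logarithm *)

Section local_log_integrability.
Variable R : realType.
Local Notation leb := (@lebesgue_measure R).
Variable f : R -> R.
Hypotheses (mf : measurable_fun [set: R] f) (f0 : forall x, 0 <= f x).
Implicit Type A : set R.

(** For L >= 0 this is min (L, log^- f) with log^- 0 = +oo: truncating inside the logarithm gives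
    the value [L] at the zeros of [f], where [- ln 0] would give 0. *)
Definition logtrunc (L x : R) : R := Num.max 0 (- ln (Num.max (f x) (expR (- L)))).

Lemma logtrunc_ge0 L x : 0 <= logtrunc L x.
Proof. by rewrite le_max lexx. Qed.

Lemma logtrunc_le L x : 0 <= L -> logtrunc L x <= L.
Proof.
move=> L0; rewrite ge_max L0 /= lerNl -[leLHS]expRK ler_ln ?posrE ?expR_gt0//.
  by rewrite le_max lexx orbT.
by rewrite lt_max expR_gt0 orbT.
Qed.

Lemma bm_logtrunc L : 0 <= L -> bm (logtrunc L).
Proof.
move=> L0; split.
  apply: measurable_maxr; first exact: measurable_cst.
  apply: measurableT_comp => //; apply: measurableT_comp; first exact: measurable_ln.
  by apply: measurable_maxr => //; exact: measurable_cst.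
by exists L => x; rewrite ger0_norm ?logtrunc_ge0// logtrunc_le.
Qed.

Lemma expR_logtrunc L x (a : R) : 0 <= a <= 1 -> expR (a * logtrunc L x) * f x <= 1 + f x.
Proof.
move=> /andP[a0 a1].
have E : expR (a * logtrunc L x) <= expR (logtrunc L x).
  by rewrite ler_expR ler_piMl ?logtrunc_ge0.
apply: le_trans (ler_wpM2r (f0 x) E) _.
pose m := Num.max (f x) (expR (- L)).
have m0 : 0 < m by rewrite lt_max expR_gt0 orbT.
have fm : f x <= m by rewrite le_max lexx.
rewrite /logtrunc -/m; have [h|h] := leP (- ln m) 0.
  by rewrite expR0 mul1r lerDr.
rewrite expRN lnK ?posrE//.
by rewrite mulrC (le_trans (_ : _ <= 1))// ?lerDl// ler_pdivrMr// mul1r.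
Qed.

Lemma logtrunc_zero L x : 0 <= L -> f x = 0 -> logtrunc L x = L.
Proof.
move=> L0 fx; rewrite /logtrunc fx (max_r (expR_ge0 _)) expRK opprK.
by rewrite max_r.
Qed.

Lemma logtrunc_ge L x : Num.min L (Num.max 0 (- ln (f x))) <= logtrunc L x.
Proof.
rewrite /logtrunc; have [h|h] := leP (expR (- L)) (f x); first by rewrite ge_min lexx orbT.
by rewrite expRK opprK ge_min le_max lexx orbT.
Qed.

Definition zeros : set R := [set x | f x = 0].

(* As [ln 0 = 0] in the library, the integral does not see the zeros of [f]. *)
Definition log_good A :=
  leb (A `&` zeros) = 0%E /\ (\int[leb]_(x in A) (ln (f x))%:E > -oo)%E.

Lemma measurable_zeros : measurable zeros.
Proof.
rewrite (_ : zeros = f @^-1` [set 0])//.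
by rewrite -[X in measurable X]setTI; apply: mf => //; exact: measurable_set1.
Qed.

(** The truncations equal [L] on the zeros of [f], so [L] times the measure of the zeros stays
    bounded. They also dominate min (L, max (0, - ln f)), so monotone convergence bounds the
    integral of the negative part of ln f. *)
Lemma logtrunc_bounded_good A (m : R) : measurable A -> (leb A < +oo)%E ->
  (forall L : nat, \int[leb]_(x in A) logtrunc L%:R x <= m) -> log_good A.
Proof.
move=> mA fA H.
have mZ := measurable_zeros.
have mAZ : measurable (A `&` zeros) by exact: measurableI.
have bL (L : nat) : bm (logtrunc L%:R) by exact: bm_logtrunc.
split.
  have fin : (leb (A `&` zeros) < +oo)%E.
    apply: le_lt_trans fA; apply: le_measure; rewrite ?inE//.
  pose l := fine (leb (A `&` zeros)).
  suff l0 : l = 0.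
    apply: etrans (esym (fineK _)) _; first by rewrite ge0_fin_numE.
    by rewrite -/l l0.
  have lge : 0 <= l by exact: fine_ge0.
  have Hl (L : nat) : L%:R * l <= m.
    apply: le_trans (H L).
    have -> : l = \int[leb]_(x in A) \1_(A `&` zeros) x.
      by rewrite Rint_indic// (setIidl (@subIsetl _ _ _)).
    rewrite -bm_RintZl//; last exact: bm_indic.
    apply: bm_le_Rint => //.
      by apply: bmM; [exact: bm_cst|exact: bm_indic].
    move=> x Ax; rewrite indicE; have [h|h] := pselect (f x = 0).
      by rewrite mem_set// mulr1 logtrunc_zero.
    by rewrite memNset ?mulr0 ?logtrunc_ge0// => -[].
  apply/eqP; rewrite eq_le lge andbT leNgt; apply/negP => lgt.
  have := Hl (Num.truncn (m / l)).+1; rewrite leNgt -ltr_pdivrMr// => /negP; apply.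
  exact: truncnS_gt.
pose h x := Num.max 0 (- ln (f x)).
have mln : measurable_fun [set: R] (fun x => ln (f x)).
  by apply: measurableT_comp => //; exact: measurable_ln.
have mh : measurable_fun [set: R] h.
  by apply: measurable_maxr; [exact: measurable_cst|exact: measurableT_comp].
have hge x : 0 <= h x by rewrite le_max lexx.
pose g (L : nat) (x : R) := (Num.min L%:R (h x))%:E.
have gh x : (g^~ x @ \oo --> (h x)%:E)%E.
  apply: cvg_near_cst; exists (Num.truncn (h x)).+1 => // n /= nh.
  by rewrite /g min_r// (le_trans (ltW (truncnS_gt (h x))))// ler_nat.
have mg n : measurable_fun A (g n).
  apply/measurable_EFinP; apply: measurable_funTS.
  by apply: measurable_minr => //; exact: measurable_cst.
have g0 n x : A x -> (0 <= g n x)%E by rewrite lee_fin le_min ler0n hge.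
have ng x : A x -> {homo g^~ x : a b / (a <= b)%N >-> (a <= b)%E}.
  move=> _ a b ab; rewrite lee_fin le_min ge_min ge_min lexx orbT andbT.
  by rewrite ler_nat ab.
have hm : (\int[leb]_(x in A) (h x)%:E <= m%:E)%E.
  have -> : (\int[leb]_(x in A) (h x)%:E = \int[leb]_(x in A) limn (g^~ x))%E.
    by apply: eq_integral => x _; apply/esym/cvg_lim => //; exact: gh.
  rewrite monotone_convergence//; apply: lime_le.
    apply: ereal_nondecreasing_is_cvgn => a b ab.
    apply: ge0_le_integral => //; try exact: g0; try exact: mg.
    by move=> x Ax; exact: (ng _ Ax _ _ ab).
  near=> n.
  apply: le_trans (_ : (\int[leb]_(x in A) (logtrunc n%:R x)%:E <= _)%E).
    apply: ge0_le_integral => //; first exact: g0.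
    - exact: mg.
    - by apply/measurable_EFinP; apply: measurable_funTS; case: (bL n).
    - by move=> x _; rewrite lee_fin; exact: logtrunc_ge.
  have := H n; rewrite -lee_fin /Rintegral fineK//.
  by apply: (integrable_fin_num (mu := leb)) => //; exact: bm_integrable.
rewrite integralE.
have neg : (\int[leb]_(x in A) (fun x => (ln (f x))%:E)^\- x <= m%:E)%E.
  apply: le_trans hm; rewrite le_eqVlt; apply/orP; left; apply/eqP.
  by apply: eq_integral => x _; rewrite funenegE -EFinN -EFin_max maxC.
apply: (@lt_le_trans _ _ (- m%:E)%E); first by rewrite ltNyr.
rewrite -[leLHS]add0e leeD//.
  by apply: integral_ge0 => x _; exact: funepos_ge0.
by rewrite leeN2.
Unshelve. all: by end_near. Qed.

(* Where [ln f] is not integrable, any amount of positive mass fits on the set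
   where [f] is small without spoiling the integrability of [exp W * f]. *)
Lemma bad_weight A (m : R) : measurable A -> (leb A < +oo)%E -> ~ log_good A -> 0 <= m ->
  exists W : R -> R, [/\ bm W, forall x, 0 <= W x, forall x, ~ A x -> W x = 0,
    \int[leb]_(x in A) W x = m & forall x, expR (W x) * f x <= 1 + f x].
Proof.
move=> mA fA ng m0.
(* The margin 1 keeps the total [I] positive even for m = 0; scaling the truncated logarithm by m /
   I <= 1 then gives mass exactly [m]. *)
have [L hL] : exists L : nat, m + 1 < \int[leb]_(x in A) logtrunc L%:R x.
  apply: contrapT => h; apply: ng; apply: (@logtrunc_bounded_good A (m + 1)) => // L.
  by rewrite leNgt; apply/negP => hL; apply: h; exists L.
pose I := \int[leb]_(x in A) logtrunc L%:R x.
have I0 : 0 < I by apply: le_lt_trans hL; rewrite addr_ge0.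
have bL : bm (logtrunc L%:R) by exact: bm_logtrunc.
have a01 : 0 <= m / I <= 1.
  rewrite divr_ge0 ?(ltW I0)//= ler_pdivrMr// mul1r (le_trans _ (ltW hL))// lerDl//.
exists (fun x => m / I * logtrunc L%:R x * \1_A x); split.
- by apply: bmM; [apply: bmM => //; exact: bm_cst|exact: bm_indic].
- move=> x; rewrite mulr_ge0//.
  by case/andP: a01 => a0 _; rewrite mulr_ge0// logtrunc_ge0.
- by move=> x nA; rewrite indicE memNset// mulr0.
- have -> : \int[leb]_(x in A) (m / I * logtrunc L%:R x * \1_A x) =
           \int[leb]_(x in A) (m / I * logtrunc L%:R x).
    by apply: eq_Rintegral => x xA; rewrite indicE xA mulr1.
  by rewrite bm_RintZl// -/I mulfVK// gt_eqF.
- move=> x; rewrite indicE; case: (x \in A); rewrite ?mulr0 ?mulr1.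
    exact: expR_logtrunc.
  by rewrite expR0 mul1r lerDr.
Qed.

End local_log_integrability.

(** * Construction and smoothing of weights *)

Section weights.
Variable R : realType.
Local Notation leb := (@lebesgue_measure R).
Implicit Types (A K : set R) (W : R -> R).

(** Continuous functions are dense in L^1, and clipping to [0, M] brings the approximation no
    farther from [W], whose values lie there. *)
Lemma continuous_L1_approx W (M eta : R) : bm W -> (forall y, 0 <= W y <= M) ->
  0 < eta -> exists psi : R -> R, [/\ continuous psi, forall y, 0 <= psi y <= M &
    intT (fun y => `|psi y - W y|) <= eta].
Proof.
move=> bW WM eta0; have mT := @measurable_Tpar R; have fT := @leb_Tpar_lty R.
have [g [cg _ cv]] := approximation_continuous_integrable mT fT (bm_integrable mT fT bW).
have : nbhs (0 : \bar R)%E [set x | (x < eta%:E)%E].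
  apply: open_nbhs_nbhs; split; last by rewrite /= lte_fin.
  exact: open_ereal_lt_ereal.
move=> /cv [n _ /(_ n (leqnn n)) /= hn].
have M0 : 0 <= M by have /andP[a b] := WM 0; exact: le_trans b.
pose psi y := Num.max 0 (Num.min M (g n y)).
have psiM y : 0 <= psi y <= M by rewrite /psi le_max lexx /= ge_max M0 ge_min lexx.
have cpsi : continuous psi.
  move=> y; apply: (@continuous_max R R (fun=> 0) (fun y => Num.min M (g n y))).
    exact: cvg_cst.
  apply: (@continuous_min R R (fun=> M) (g n)); first exact: cvg_cst.
  exact: cg.
exists psi; split => //.
have bpsi : bm psi.
  apply: bm_continuous => //; exists M => y; have /andP[a b] := psiM y.
  by rewrite ger0_norm.
have bd : bm (fun y => `|psi y - W y|) by apply/bm_norm/bmB.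
rewrite -lee_fin /intT /Rintegral fineK; last first.
  by apply: (integrable_fin_num (mu := leb)) => //; exact: bm_integrable.
apply: le_trans (ltW hn); apply: ge0_le_integral => //.
- by apply/measurable_EFinP; apply: measurable_funTS; case: bd.
- apply/measurable_EFinP; apply: measurable_funTS; apply: measurableT_comp => //.
  apply: measurable_funB; first by case: bW.
  exact: continuous_measurable_fun.
move=> y Ty; rewrite lee_fin; have /andP[w0 w1] := WM y.
rewrite /psi distrC; case: (leP M (g n y)) => h.
  by rewrite max_r// !ler0_norm ?subr_le0 ?(le_trans w1)//; lra.
case: (leP (g n y) 0) => h2; last by [].
by rewrite !ger0_norm ?subr_ge0 ?(le_trans h2)//; lra.
Qed.

Lemma abs_continuous_dens (h : R -> R) (h0 : forall x, 0 <= h x)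
    (hi : leb.-integrable [set: R] (EFin \o h)) (e : R) : 0 < e ->
  exists2 d : R, 0 < d & forall A, measurable A -> (leb A < d%:E)%E ->
    fine (dens h0 hi A) < e.
Proof.
move=> e0; have [d [d0 H]] := integral_normr_continuous hi e0.
exists d => // A mA Ad; apply: le_lt_trans (H A mA Ad); rewrite /dens /Rintegral.
rewrite le_eqVlt; apply/orP; left; apply/eqP.
by congr fine; apply: eq_integral => x _; rewrite ger0_norm.
Qed.

Lemma leb_markov A (h : R -> R) : measurable A -> A `<=` Tpar -> bm h ->
  (forall x, A x -> 1 <= `|h x|) -> fine (leb A) <= intT (fun x => `|h x|).
Proof.
move=> mA AT bh h1; rewrite -intT_indic//.
apply: le_intT; [exact: bm_indic|exact: bm_norm|move=> x Tx; rewrite indicE].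
have [Ax|nAx] := pselect (A x); first by rewrite mem_set ?h1.
by rewrite (memNset nAx) normr_ge0.
Qed.

(** [W] is replaced by a clipped continuous approximation with a cutoff near [K], the indicator of
    [K] by a thin bump. The bound [M + N] does not depend on [eta], so [eta] may be chosen in terms
    of it. *)
Lemma smooth_weight K W (M N d eta : R) : closed K -> K !=set0 -> K `<=` Tpar ->
  bm W -> (forall y, 0 <= W y <= M) -> 0 <= N -> 0 < d -> 0 < eta ->
  (forall y, d / 4 < distK K y -> W y = 0) ->
  exists w : R -> R, [/\ continuous w, forall y, `|w y| <= M + N,
    forall y, d / 2 <= distK K y -> w y = 0 &
    intT (fun y => `|w y - (W y - N * \1_K y)|) <= eta].
Proof.
move=> cK K0 KT bW WM N0 d0 eta0 Wd.
have mK : measurable K by exact: closed_measurable.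
have M0 : 0 <= M by have /andP[a b] := WM 0; exact: le_trans b.
have e2 : 0 < eta / 2 by rewrite divr_gt0.
have [psi [cpsi psiM hpsi]] := continuous_L1_approx bW WM e2.
have N1 : 0 < N + 1 by rewrite ltr_wpDl.
have [r r0 hr] := nbK_tail cK K0 KT (@leb_Tpar_lty R) (divr_gt0 e2 N1).
pose rho := Num.min r (d / 2).
have rho0 : 0 < rho by rewrite lt_min r0 divr_gt0.
have rhor : rho <= r by rewrite ge_min lexx.
have rhod : rho <= d / 2 by rewrite ge_min lexx orbT.
(* A cutoff equal to 1 up to distance d / 4, where [W] lives, and to 0 from distance d / 2 on. *)
pose chi y := Num.min 1 (Num.max 0 (2 - 4 / d * distK K y)).
have chi01 y : 0 <= chi y <= 1 by rewrite /chi ge_min lexx /= le_min ler01 le_max lexx.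
have chi0 y : d / 2 <= distK K y -> chi y = 0.
  move=> h; rewrite /chi max_l ?min_r// subr_le0.
  by rewrite -ler_pdivrMl ?divr_gt0// (le_trans _ h)// invf_div; lra.
have chi1 y : distK K y <= d / 4 -> chi y = 1.
  move=> h; have h' : 4 / d * distK K y <= 1.
    by rewrite -ler_pdivlMl ?divr_gt0// (le_trans h)// invf_div mulr1.
  by rewrite /chi max_r ?min_l// ?subr_ge0; move: h'; clear; lra.
have cchi : continuous chi.
  move=> y; apply: (@continuous_min R R (fun=> 1) (fun y => Num.max 0 (2 - 4 / d * distK K y))).
    exact: cvg_cst.
  apply: (@continuous_max R R (fun=> 0) (fun y => 2 - 4 / d * distK K y)); first exact: cvg_cst.
  apply: cvgB; first exact: cvg_cst.
  by apply: cvgM; [exact: cvg_cst|exact: continuous_distK].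
have bpsi : bm psi.
  by apply: bm_continuous => //; exists M => y; have /andP[a b] := psiM y; rewrite ger0_norm.
have bchi : bm chi.
  by apply: bm_continuous => //; exists 1 => y; have /andP[a b] := chi01 y; rewrite ger0_norm.
have bb : bm (fun y => N * bump K rho y) by apply: bmM; [exact: bm_cst|exact: bm_bump].
have b1 : bm (fun y => N * (\1_K y : R)) by apply: bmM; [exact: bm_cst|exact: bm_indic].
exists (fun y => psi y * chi y - N * bump K rho y); split.
- move=> y; apply: cvgB; first by apply: cvgM; [exact: cpsi|exact: cchi].
  by apply: cvgM; [exact: cvg_cst|exact: continuous_bump].
- move=> y; have /andP[a b] := psiM y; have /andP[c1 c2] := chi01 y.
  have h1 : 0 <= psi y * chi y <= M by rewrite mulr_ge0//= (le_trans _ b)// ler_piMr.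
  have h2 : 0 <= N * bump K rho y <= N.
    by rewrite mulr_ge0 ?bump_ge0//= ler_piMr// bump_le1.
  case/andP: h1 => p1 p2; case/andP: h2 => q1 q2; rewrite ler_norml.
  by move: p1 p2 q1 q2; clear => *; apply/andP; split; lra.
- by move=> y h; rewrite chi0// bump_far ?mulr0 ?subrr// (le_trans rhod).
have mnbK : measurable (nbK K rho `\` K) by apply: measurableD => //; exact: measurable_nbK.
apply: le_trans (_ : intT (fun y => `|psi y - W y| + N * \1_(nbK K rho `\` K) y) <= _).
  apply: le_intT.
  - by apply/bm_norm/bmB; apply: bmB => //; apply: bmM.
  - apply: bmD; first by apply/bm_norm/bmB.
    by apply: bmM; [exact: bm_cst|exact: bm_indic].
  move=> y Ty.
  have -> : psi y * chi y - N * bump K rho y - (W y - N * \1_K y) =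
    (psi y * chi y - W y) + N * (\1_K y - bump K rho y) by ring.
  apply: le_trans (ler_normD _ _) _; apply: lerD.
    have /andP[a b] := chi01 y.
    have -> : psi y * chi y - W y = (psi y - W y) * chi y.
      have [h|h] := leP (distK K y) (d / 4); first by rewrite chi1// !mulr1.
      by rewrite Wd// !subr0.
    by rewrite normrM (ger0_norm a) ler_piMr.
  rewrite normrM (ger0_norm N0) ler_wpM2l// distrC.
  have := bump_le_indic K0 rho0 Ty; have := bump_ge0 K rho y.
  rewrite !indicE; have [Ky|nKy] := pselect (K y).
    by rewrite (mem_set Ky) bump_mem// subrr normr0.
  by rewrite (memNset nKy) subr0 addr0 => /ger0_norm ->.
rewrite intTD; [|by apply/bm_norm/bmB|by apply: bmM; [exact: bm_cst|exact: bm_indic]].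
rewrite intTZl; last exact: bm_indic.
rewrite intT_indic//; last by move=> x [[]].
have /hr h : 0 < rho <= r by rewrite rho0.
have h2 := ler_wpM2l N0 h.
have h3 : N * (eta / 2 / (N + 1)) <= eta / 2.
  by rewrite mulrCA ler_piMr ?(ltW e2)// ler_pdivrMr// mul1r lerDl.
by move: hpsi (le_trans h2 h3); clear; lra.
Qed.

Lemma cell_inj n j k (x : R) : (0 < n)%N -> cell n j x -> cell n k x -> j = k.
Proof.
move=> n0; rewrite /cell /= !in_itv /=.
have n0' : (0 : R) < n%:R by rewrite ltr0n.
rewrite !ler_pdivrMr// !ltr_pdivlMr// => /andP[a b] /andP[c d].
apply/eqP; rewrite eqn_leq -ltnS -(ltnS k j) -!(ltr_nat R).
by rewrite (le_lt_trans a)// (le_lt_trans c).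
Qed.

(** Open cells, from which the open set of the theorem is built; the half-open cells partition the
    circle and differ from these by one point. *)
Definition icell n j : set R := `]j%:R / n%:R, j.+1%:R / n%:R[.

Lemma log_good_cell (f : R -> R) n j : measurable_fun [set: R] f ->
  log_good f (cell n j) -> log_good f (icell n j).
Proof.
move=> mf [h1 h2]; have sub : icell n j `<=` cell n j.
  by move=> x; rewrite /icell /cell /= !in_itv /= => /andP[/ltW -> ->].
have mi : measurable (icell n j) by exact: measurable_itv.
have mZ := measurable_zeros mf; split.
  apply/eqP; rewrite -measure_le0 -h1; apply: le_measure; rewrite ?inE.
  - exact: measurableI.
  - by apply: measurableI => //; exact: measurable_cell.
  - exact: setSI.
rewrite /icell integral_itv_obnd_cbnd//.
apply/measurable_EFinP; apply: measurable_funTS; exact: measurableT_comp.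
Qed.

(** A cell that [K] meets in positive measure is not [log_good], the left end being negligible, so
    [bad_weight] places on it the mass that compensates -N on [K]. The other cells carry weight 0,
    hence [W] lives on cells that meet [K]. *)
Lemma cell_weights (f : R -> R) K (n : nat) (N : R) :
  measurable_fun [set: R] f -> (forall x, 0 <= f x) -> (0 < n)%N -> measurable K ->
  0 <= N -> (forall j, (j < n)%N -> log_good f (icell n j) -> K `&` icell n j = set0) ->
  exists W : R -> R, [/\ bm W, forall x, 0 <= W x,
    forall j, (j < n)%N -> \int[leb]_(x in cell n j) W x = N * fine (leb (K `&` cell n j)),
    forall x, expR (W x) * f x <= 1 + f x &
    forall x, W x = 0 \/ exists j k, [/\ cell n j x, K k & cell n j k]].
Proof.
move=> mf f0 n0 mK N0 Kgood.
have cellW j : exists W : R -> R, (j < n)%N -> [/\ bm W, forall x, 0 <= W x,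
    forall x, ~ cell n j x -> W x = 0, \int[leb]_(x in cell n j) W x = N * fine (leb (K `&` cell n j)) &
    forall x, expR (W x) * f x <= 1 + f x /\ (W x = 0 \/ exists2 k, K k & cell n j k)].
  have [jn|jn] := boolP (j < n)%N; last by exists (fun=> 0).
  have mc := @measurable_cell R n j.
  have [z|nz] := eqVneq (leb (K `&` cell n j)) 0%E.
    exists (fun=> 0) => _; split => //; first exact: bm_cst.
    - by rewrite z mulr0 Rintegral_cst// mul0r.
    - by move=> x; rewrite expR0 mul1r lerDr; split => //; left.
  have bad : ~ log_good f (cell n j).
    move=> /(log_good_cell mf) /(Kgood _ jn) E; apply/negP: nz; rewrite negbK.
    have sub : K `&` cell n j `<=` [set j%:R / n%:R].
      move=> x [Kx cx]; apply: contrapT => ne.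
      suff : (K `&` icell n j) x by rewrite E.
      split => //; move: cx; rewrite /cell /icell /= !in_itv /= => /andP[h ->].
      by rewrite lt_neqAle h !andbT eq_sym; apply/eqP.
    rewrite -measure_le0 -(lebesgue_measure_set1 (j%:R / n%:R : R)).
    apply: le_measure; rewrite ?inE//; first exact: measurableI.
  have m0 : 0 <= N * fine (leb (K `&` cell n j)) by rewrite mulr_ge0// fine_ge0.
  have [W [bW W0 Wc WI We]] := bad_weight mf f0 mc (leb_cell_lty R j n0) bad m0.
  exists W => _; split => // x; split => //; right.
  have /set0P[k [Kk ck]] : K `&` cell n j != set0.
    by apply: contra_neq nz => ->; rewrite measure0.
  by exists k.
have [Wj hW] := choice cellW.
pose W x := \sum_(j < n) Wj j x.
have Wcell j x : (j < n)%N -> cell n j x -> W x = Wj j x.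
  move=> jn cx; rewrite /W (bigD1 (Ordinal jn)) //= big1 ?addr0// => i ij.
  have [_ _ h _ _] := hW i (ltn_ord i); apply: h => ci.
  by move/eqP: ij; apply; apply: val_inj; exact: (cell_inj n0 ci cx).
have Wout x : (forall j, (j < n)%N -> ~ cell n j x) -> W x = 0.
  move=> h; rewrite /W big1// => i _; have [_ _ h' _ _] := hW i (ltn_ord i).
  by apply: h'; exact: h.
have cases x : W x = 0 \/ exists j, [/\ (j < n)%N, cell n j x & W x = Wj j x].
  have [[j [jn cx]]|h] := pselect (exists j, (j < n)%N /\ cell n j x).
    by right; exists j; split => //; exact: Wcell.
  by left; apply: Wout => j jn cx; apply: h; exists j.
exists W; split.
- have -> : W = fun x => \sum_(j < n) (if (j < n)%N then Wj j x else 0).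
    by apply/funext => x; apply: eq_bigr => i _; rewrite ltn_ord.
  by apply: bm_sum => i; rewrite ltn_ord; have [] := hW i (ltn_ord i).
- by move=> x; apply: sumr_ge0 => i _; have [_ h _ _ _] := hW i (ltn_ord i).
- move=> j jn; have [_ _ _ <- _] := hW j jn.
  by apply: eq_Rintegral => x xc; apply: Wcell => //; exact: set_mem.
- move=> x; have [->|[j [jn cx ->]]] := cases x; first by rewrite expR0 mul1r lerDr.
  by have [_ _ _ _ h] := hW j jn; have [] := h x.
- move=> x; have [->|[j [jn cx ->]]] := cases x; first by left.
  have [_ _ _ _ h] := hW j jn; have [_ [->|[k Kk ck]]] := h x; first by left.
  by right; exists j, k.
Qed.

End weights.

(** * Closed sets that avoid the good arcs *)

Section closed_off_log_good.
Variable R : realType.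
Local Notation leb := (@lebesgue_measure R).
Local Notation fmeas := {finite_measure set (measurableTypeR R) -> \bar R}.
Implicit Types (K : set R) (nu : cmeasure R) (f : R -> R).

(** Domination of [tau] by the measure of density [f] on the circle, tested on nonnegative bounded
    functions, the form in which it is used. *)
Definition dens_bounded (tau : fmeas) f := forall (D : set R) (h : R -> R), measurable D ->
  D `<=` Tpar -> bm h -> (forall x, 0 <= h x) ->
  (\int[tau]_(x in D) (h x)%:E <= \int[leb]_(x in D) (h x * f x)%:E)%E.

Lemma dens_bounded_Rint (tau : fmeas) f (h1 : R -> R) (h10 : forall x, 0 <= h1 x)
    (h1i : leb.-integrable [set: R] (EFin \o h1)) (D : set R) (h G : R -> R) :
  dens_bounded tau f -> measurable_fun [set: R] f -> (forall x, 0 <= f x) ->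
  measurable D -> D `<=` Tpar -> bm h -> bm G ->
  (forall x, 0 <= h x) -> (forall x, 0 <= G x) ->
  (forall x, D x -> h x * f x <= G x * h1 x) ->
  \int[tau]_(x in D) h x <= \int[dens h10 h1i]_(x in D) G x.
Proof.
move=> ht mf f0 mD DT bh bG h0 G0 hG.
have mh1 : measurable_fun [set: R] h1 by apply/measurable_EFinP; exact: (measurable_int leb).
have fin (m : fmeas) (u : R -> R) : bm u -> (\int[m]_(x in D) (u x)%:E)%E \is a fin_num.
  move=> bu; apply: (integrable_fin_num (mu := m)) => //.
  by apply: bm_integrable => //; exact: finite_measure_lty.
rewrite -lee_fin /Rintegral !fineK; [|exact: fin|exact: fin].
apply: le_trans (ht D h mD DT bh h0) _; rewrite integral_dens//.
case: bh => mh _; case: bG => mG _.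
apply: ge0_le_integral => //.
- by move=> x _; rewrite lee_fin mulr_ge0.
- by apply/measurable_EFinP; apply: measurable_funTS; exact: measurable_funM.
- by apply/measurable_EFinP; apply: measurable_funTS; exact: measurable_funM.
Qed.

(** With w0 = W - N 1_K and [lam] of density 1 + f on the circle, exp W * f <= 1 + f bounds the
    integral of exp w0 near [K] by exp (- N) lam(T) plus the [lam] mass of a thin neighbourhood of
    [K] without [K]. The continuous [w] differs from w0 by 1 or more only on a set of small [lam]
    mass, by Markov's inequality and absolute continuity. *)
Lemma cm_re_closed_off nu f K (b : R) : fast_decay nu -> measurable_fun [set: R] f ->
  (forall x, 0 <= f x) -> leb.-integrable [set: R] (EFin \o f) ->
  [/\ dens_bounded (cm1 nu) f, dens_bounded (cm2 nu) f, dens_bounded (cm3 nu) f &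
      dens_bounded (cm4 nu) f] ->
  closed K -> 0 < b <= 1 / 2 -> (forall k, K k -> b <= k <= 1 - b) ->
  (forall n j, (j < n)%N -> log_good f (icell n j) -> K `&` icell n j = set0) ->
  cm_re nu K = 0.
Proof.
move=> hnu mf f0 fi hdom cK b12 Kb Kgood.
have [->|/set0P Kn0] := eqVneq K set0; first by rewrite /cm_re !measure0 subrr.
have mK : measurable K by exact: closed_measurable.
have mT := @measurable_Tpar R.
have KT : K `<=` Tpar.
  move=> x /Kb /andP[x0 x1]; rewrite /Tpar /= in_itv /=.
  by case/andP: b12 => b0 _; apply/andP; split; lra.
pose h1 x := \1_(Tpar : set R) x + f x.
have h10 x : 0 <= h1 x by rewrite addr_ge0.
have h1T x : Tpar x -> h1 x = 1 + f x by move=> Tx; rewrite /h1 indicE mem_set.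
have h1i : leb.-integrable [set: R] (EFin \o h1).
  rewrite (_ : EFin \o h1 = (EFin \o (\1_(Tpar : set R) : R -> R)) \+ (EFin \o f))//.
  apply: integrableD => //; apply/integrableP; split.
    by apply/measurable_EFinP; exact: measurable_indic.
  have -> : (\int[leb]_x `|(EFin \o (\1_(Tpar : set R) : R -> R)) x| =
             \int[leb]_x (\1_(Tpar : set R) x)%:E)%E.
    by apply: eq_integral => x _; rewrite /= ger0_norm.
  by rewrite integral_indic// setIT; exact: leb_Tpar_lty.
pose lam : fmeas := dens h10 h1i.
apply: (cm_re_closed hnu cK b12 Kb) => e /andP[e0 e1].
have E2 := expR_gt0 (2 : R).
(* Chosen so that exp 2 * (a + a) = e / 2; the factor exp 2 comes from exp (w + 1) <= exp 2 * exp w0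
   where |w - w0| < 1. *)
pose a := e / (4 * expR 2).
have a0 : 0 < a by rewrite divr_gt0// mulr_gt0.
pose T := fine (lam Tpar).
have T0 : 0 <= T by exact: fm_ge0.
(* From exp N >= 1 + N it follows that exp (- N) T <= a N / (1 + N) <= a. *)
pose N := T / a.
have N0 : 0 <= N by rewrite divr_ge0// ltW.
have NE : expR (- N) * T <= a.
  rewrite expRN mulrC ler_pdivrMr ?expR_gt0//.
  have := expR_ge1Dx N; have -> : T = a * N by rewrite /N mulrCA mulfV ?mulr1// gt_eqF.
  by move=> h; rewrite ler_pM2l//; move: h; clear; lra.
have [d0 d00 hd0] := nbK_tail cK Kn0 KT (finite_measure_lty lam mT) a0.
exists N, d0; split => // d dd.
have d_gt0 : 0 < d by case/andP: dd.
have d4 : 0 < d / 4 by rewrite divr_gt0.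
have [n1 hn1] := exists_invn_le d4.
exists n1.+1 => n n1n eta eta0.
have n0 : (0 < n)%N by exact: leq_trans n1n.
have n0' : (0 : R) < n%:R by rewrite ltr0n.
have nd : n%:R^-1 <= d / 4 :> R.
  by apply: le_trans hn1; rewrite lef_pV2 ?posrE// ler_nat.
have [W [bW W0 WI We Wc]] := cell_weights mf f0 n0 mK N0 (fun j => @Kgood n j).
have [M M0 hM] := bm_bound bW.
have WM y : 0 <= W y <= M by rewrite W0 -[W y]ger0_norm ?hM.
have Wd y : d / 4 < distK K y -> W y = 0.
  move=> h; have [//|[j [k [cy Kk ck]]]] := Wc y.
  have := le_trans (le_trans (distK_le Kn0 y Kk) (cell_dist n0 cy ck)) nd.
  by rewrite leNgt h.
pose Mw : R := M + N + 1.
have Mw0 : 0 < Mw by rewrite ltr_wpDl// addr_ge0// ltW.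
(* Where |w - w0| >= 1, exp (w + 1) is only bounded by exp (Mw + 1), so this is the [lam] mass
   allowed there. As [Mw] does not depend on the smoothing, [delta] can be fixed before [w]. *)
have ce : 0 < e / (2 * expR (Mw + 1)) by rewrite divr_gt0// mulr_gt0// expR_gt0.
have [delta delta0 hdelta] := abs_continuous_dens h10 h1i ce.
have eta'0 : 0 < Num.min eta (delta / 2) by rewrite lt_min eta0 divr_gt0.
have [w [cw wM wd wJ]] := smooth_weight cK Kn0 KT bW WM N0 d_gt0 eta'0 Wd.
pose w0 y := W y - N * \1_K y.
have bK : bm (fun y => N * (\1_K y : R)) by apply: bmM; [exact: bm_cst|exact: bm_indic].
have bw0 : bm w0 by exact: bmB.
have bw : bm w by apply: bm_continuous => //; exists (M + N).
exists w, w0, Mw; split.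
- split => // y; apply: le_trans (wM y) _; by rewrite lerDl.
- move=> y hy; split; first exact: wd.
  have dy : d / 4 < distK K y by apply: lt_le_trans hy; move: d_gt0; clear; lra.
  rewrite /w0 Wd// indicE memNset ?mulr0 ?subr0// => Ky.
  by move: dy; rewrite distK_mem// ltNge (ltW d4).
- by apply: le_trans wJ _; rewrite ge_min lexx.
- move=> j jn; have mc := @measurable_cell R n j.
  have fc := @leb_cell_lty R n j n0.
  have IK : \int[leb]_(y in cell n j) (N * \1_K y) = N * fine (leb (K `&` cell n j)).
    by rewrite bm_RintZl ?Rint_indic//; exact: bm_indic.
  split.
  + by rewrite /w0 bm_RintB// IK WI// subrr.
  + apply: le_trans (_ : \int[leb]_(y in cell n j) (W y + N * \1_K y) <= _).
      apply: bm_le_Rint => //; [exact: bm_norm|exact: bmD|].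
      move=> y _; apply: le_trans (ler_normB _ _) _.
      by rewrite (ger0_norm (W0 y)) ger0_norm// mulr_ge0.
    rewrite bm_RintD// IK WI//.
    have : fine (leb (K `&` cell n j)) <= n%:R^-1.
      have -> : n%:R^-1 = fine (leb (cell n j)) :> R.
        by apply: etrans (esym (congr1 fine (leb_cell R j n0))).
      apply: fine_le; rewrite ?ge0_fin_numE//.
        apply: le_lt_trans fc; apply: le_measure; rewrite ?inE//; exact: measurableI.
      by apply: le_measure; rewrite ?inE//; exact: measurableI.
    by move=> /(ler_wpM2l N0); clear; lra.
  + have [[k Kk ck]|nk] := pselect (exists2 k, K k & cell n j k); first by right; exists k.
    left => y cy; rewrite /w0 indicE memNset ?mulr0 ?subr0; last by move=> Ky; apply: nk; exists y.
    have [//|[i [k [ci Kk ck]]]] := Wc y; case: nk; exists k => //.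
    by rewrite (cell_inj n0 cy ci).
pose V := nbK K d.
have mV : measurable V by exact: measurable_nbK.
have VT : V `<=` Tpar by exact: nbK_sub.
have KV : K `<=` V by exact: sub_nbK.
have mVK : measurable (V `\` K) by exact: measurableD.
pose EV := V `&` [set y | 1 <= `|w y - w0 y|].
have bww : bm (fun y => w y - w0 y) by exact: bmB.
have mEV : measurable EV.
  apply: measurableI => //.
  rewrite (_ : [set y | _] = (fun y => `|w y - w0 y|) @^-1` `[1, +oo[); last first.
    by apply/seteqP; split => y /=; rewrite in_itv /= andbT.
  rewrite -[X in measurable X]setTI; have [mn _] := bm_norm bww; apply: mn => //.
have lamEV : fine (lam EV) <= e / (2 * expR (Mw + 1)).
  apply: ltW; apply: hdelta => //.
  have fEV : leb EV \is a fin_num.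
    rewrite ge0_fin_numE//; apply: le_lt_trans (@leb_Tpar_lty R).
    by apply: le_measure; rewrite ?inE// => x [/VT].
  suff : fine (leb EV) < delta.
    by rewrite -lte_fin => h; apply: le_lt_trans h; rewrite fineK.
  apply: le_lt_trans (_ : delta / 2 < _); last by move: delta0; clear; lra.
  apply: le_trans (leb_markov mEV _ bww _) _; [by move=> x [/VT]|by move=> x []|].
  by apply: le_trans wJ _; rewrite ge_min lexx orbT.
have lamVK : fine (lam (V `\` K)) <= a by exact: hd0.
have lamV : fine (lam V) <= T by exact: le_fm.
have bG : bm (fun y => expR (- N) + \1_(V `\` K) y).
  by apply: bmD; [exact: bm_cst|exact: bm_indic].
have bound (tau : fmeas) : dens_bounded tau f ->
    \int[tau]_(y in V) expR (w y + 1) <= e.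
  move=> ht; have fV := finite_measure_lty tau mV; have fL := finite_measure_lty lam mV.
  have bE : bm (fun y => expR (w0 y)) by exact: bm_expR.
  have X1 : \int[tau]_(y in V) expR (w0 y) <= expR (- N) * T + a.
    apply: le_trans (dens_bounded_Rint h10 h1i ht mf f0 mV VT bE bG _ _ _) _.
    - by move=> x; exact: expR_ge0.
    - by move=> x; rewrite addr_ge0 ?expR_ge0.
    - move=> x Vx; have Tx := VT _ Vx; rewrite h1T//.
      have h := We x; rewrite /w0; have [Kx|nKx] := pselect (K x).
        rewrite !indicE (mem_set Kx) memNset; last by case.
        by rewrite mulr1 addr0 expRD mulrAC mulrC ler_wpM2l ?expR_ge0.
      rewrite !indicE (memNset nKx) mulr0 subr0 mem_set//.
      apply: le_trans h _; rewrite mulrDl mul1r lerDr.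
      by rewrite mulr_ge0 ?expR_ge0 ?addr_ge0.
    rewrite -/lam bm_RintD ?Rintegral_cst//; [|exact: bm_cst|exact: bm_indic].
    rewrite Rint_indic_fm//.
    by apply: lerD => //; rewrite ler_wpM2l ?expR_ge0.
  have X2 : fine (tau EV) <= e / (2 * expR (Mw + 1)).
    apply: le_trans lamEV; have b1 := @bm_cst R 1.
    have EVT : EV `<=` Tpar by move=> x [/VT].
    have := @dens_bounded_Rint tau f h1 h10 h1i EV (fun=> 1) (fun=> 1) ht mf f0 mEV EVT b1 b1.
    rewrite !Rintegral_cst// !mul1r; apply => // x /EVT Tx.
    by rewrite !mul1r h1T// lerDr.
  apply: le_trans (_ : \int[tau]_(y in V) (expR 2 * expR (w0 y) + expR (Mw + 1) * \1_EV y) <= _).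
    apply: bm_le_Rint => //.
    - by apply/bm_expR/bmD => //; exact: bm_cst.
    - by apply: bmD; [apply: bmM => //; exact: bm_cst|apply: bmM; [exact: bm_cst|exact: bm_indic]].
    move=> y Vy; have [Ey|nEy] := pselect (EV y).
      rewrite indicE (mem_set Ey) mulr1 -[leLHS]add0r lerD ?mulr_ge0 ?expR_ge0//.
      rewrite ler_expR lerD2r (le_trans (ler_norm _))// (le_trans (wM y))// /Mw.
      by rewrite lerDl.
    rewrite indicE (memNset nEy) mulr0 addr0 -expRD ler_expR.
    have : `|w y - w0 y| < 1 by rewrite ltNge; apply/negP => h; apply: nEy; split.
    by rewrite ltr_norml => /andP[_]; clear; lra.
  have bE2 : bm (fun y => expR 2 * expR (w0 y)) by apply: bmM => //; exact: bm_cst.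
  have bI : bm (\1_EV : R -> R) by exact: bm_indic.
  rewrite bm_RintD//; last by apply: bmM => //; exact: bm_cst.
  rewrite !bm_RintZl// Rint_indic_fm//; last by move=> x [].
  have g1 := ler_wpM2l (ltW E2) X1.
  have g2 := ler_wpM2l (expR_ge0 (Mw + 1)) X2.
  have g3 : expR 2 * (expR (- N) * T + a) <= e / 2.
    apply: le_trans (ler_wpM2l (ltW E2) (lerD NE (lexx a))) _.
    rewrite le_eqVlt; apply/orP; left; apply/eqP; rewrite /a; field.
    by rewrite gt_eqF.
  have g4 : expR (Mw + 1) * (e / (2 * expR (Mw + 1))) = e / 2.
    by field; rewrite gt_eqF ?expR_gt0.
  by rewrite g4 in g2; move: (le_trans g1 g3) g2; clear; lra.
split; case: hdom => *; exact: bound.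
Qed.

End closed_off_log_good.

(** * Arbitrary measurable sets that avoid the good arcs *)

Section off_log_good.
Variable R : realType.
Local Notation leb := (@lebesgue_measure R).
Local Notation fmeas := {finite_measure set (measurableTypeR R) -> \bar R}.
Implicit Types (A : set R) (nu : cmeasure R) (f g : R -> R).

Definition pospart g x : R := Num.max (g x) 0 * \1_(Tpar : set R) x.

Lemma pospart_ge0 g x : 0 <= pospart g x.
Proof. by rewrite mulr_ge0// le_max lexx orbT. Qed.

Lemma pospart_le g x : pospart g x <= `|g x|.
Proof.
rewrite /pospart indicE; case: (x \in _); rewrite ?mulr1 ?mulr0//.
by rewrite ge_max ler_norm normr_ge0.
Qed.

Lemma pospart_out g x : ~ Tpar x -> pospart g x = 0.
Proof. by move=> nT; rewrite /pospart indicE memNset// mulr0. Qed.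

Lemma pospartB g x : Tpar x -> pospart g x - pospart (fun y => - g y) x = g x.
Proof.
move=> Tx; rewrite /pospart indicE mem_set// !mulr1.
have [h|h] := leP (g x) 0.
  by rewrite max_l ?oppr_ge0// opprK add0r.
by rewrite max_r ?subr0// oppr_le0 ltW.
Qed.

Section pospart_measure.
Variable g : R -> R.
Hypothesis gi : leb.-integrable [set: R] (EFin \o g).

Lemma measurable_pospart : measurable_fun [set: R] (pospart g).
Proof.
apply: measurable_funM; last by have [] := bm_indic (@measurable_Tpar R).
apply: measurable_maxr; last exact: measurable_cst.
by apply/measurable_EFinP; exact: (measurable_int leb).
Qed.

Lemma integrable_pospart : leb.-integrable [set: R] (EFin \o pospart g).
Proof.
apply: (le_integrable measurableT _ _ gi).
  by apply/measurable_EFinP; exact: measurable_pospart.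
move=> x _; rewrite lee_fin (ger0_norm (pospart_ge0 g x)); exact: pospart_le.
Qed.

End pospart_measure.

Lemma integrableN_fun g : leb.-integrable [set: R] (EFin \o g) ->
  leb.-integrable [set: R] (EFin \o (fun x => - g x)).
Proof. by move=> gi; exact: (integrableN gi). Qed.

Definition dens_pos g (gi : leb.-integrable [set: R] (EFin \o g)) : fmeas :=
  dens (pospart_ge0 g) (integrable_pospart gi).

Lemma dens_pos_supp g gi : @dens_pos g gi (~` Tpar) = 0%E.
Proof. by apply: integral0_eq => x Tx; rewrite pospart_out. Qed.

Lemma dens_posB g gi gi' A : measurable A -> A `<=` Tpar ->
  fine (@dens_pos g gi A) - fine (@dens_pos (fun x => - g x) gi' A) =
  \int[leb]_(x in A) g x.
Proof.
move=> mA AT.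
have iA h : leb.-integrable [set: R] (EFin \o h) -> leb.-integrable A (EFin \o h).
  by apply: integrableS.
have : \int[leb]_(x in A) (pospart g x - pospart (fun y => - g y) x) =
    \int[leb]_(x in A) g x.
  by apply: eq_Rintegral => x xA; apply: pospartB; apply: AT; exact: set_mem.
by rewrite RintegralB//; apply: iA; exact: integrable_pospart.
Qed.

Lemma dens_bounded_pos g gi f : measurable_fun [set: R] f ->
  (forall x, `|g x| <= f x) -> dens_bounded (@dens_pos g gi) f.
Proof.
move=> mf gf D h mD _ bh h0; rewrite integral_dens//; case: bh => mh _.
apply: ge0_le_integral => //.
- by move=> x _; rewrite lee_fin mulr_ge0// pospart_ge0.
- apply/measurable_EFinP; apply: measurable_funTS; apply: measurable_funM => //.
  exact: measurable_pospart.
- by apply/measurable_EFinP; apply: measurable_funTS; exact: measurable_funM.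
- by move=> x _; rewrite lee_fin ler_wpM2l// (le_trans (pospart_le g x)).
Qed.

(** The measures [cm1], ..., [cm4] of [nu] can have large common parts, even singular ones, which
    [f] does not control. They are exchanged for the positive and negative parts of g1 and g2, which
    [f] dominates; the complex measure and its Fourier coefficients stay the same. *)
Lemma cm_re_off_log_good nu g1 g2 f A : fast_decay nu ->
  leb.-integrable [set: R] (EFin \o g1) -> leb.-integrable [set: R] (EFin \o g2) ->
  (forall B : set R, measurable B -> B `<=` Tpar ->
    cm_re nu B = \int[leb]_(x in B) g1 x /\ cm_im nu B = \int[leb]_(x in B) g2 x) ->
  measurable_fun [set: R] f -> leb.-integrable [set: R] (EFin \o f) ->
  (forall x, `|g1 x| <= f x) -> (forall x, `|g2 x| <= f x) ->
  measurable A -> A `<=` Tpar ->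
  (forall n j, (j < n)%N -> log_good f (icell n j) -> A `&` icell n j = set0) ->
  cm_re nu A = 0.
Proof.
move=> hnu i1 i2 hd mf fi f1 f2 mA AT Ag.
have f0 x : 0 <= f x by exact: le_trans (f1 x).
have j1 := integrableN_fun i1; have j2 := integrableN_fun i2.
pose nu' := CMeasure (dens_pos_supp i1) (dens_pos_supp j1) (dens_pos_supp i2) (dens_pos_supp j2).
have re' B : measurable B -> B `<=` Tpar -> cm_re nu B = cm_re nu' B.
  by move=> mB BT; have [-> _] := hd B mB BT; rewrite /cm_re /= dens_posB.
have im' B : measurable B -> B `<=` Tpar -> cm_im nu B = cm_im nu' B.
  by move=> mB BT; have [_ ->] := hd B mB BT; rewrite /cm_im /= dens_posB.
have hnu' : fast_decay nu'.
  case: hnu => c [c0 [C hC]]; exists c; split => //; exists C => n.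
  suff <- : fcoef_abs nu n = fcoef_abs nu' n by [].
  have bc : bm (ccos n : R -> R) by exact: bm_cos.
  have bs : bm (csin n : R -> R) by exact: bm_sin.
  by rewrite /fcoef_abs /fcoef_re /fcoef_im (eq_rint_diff bc re') (eq_rint_diff bs re')
    (eq_rint_diff bc im') (eq_rint_diff bs im').
rewrite re'//; apply: cm_re_inner => //; first exact: cm_re_at0.
move=> K b cK KA b12 Kb.
apply: (cm_re_closed_off hnu' mf f0 fi _ cK b12 Kb).
  by split; apply: dens_bounded_pos => // x; rewrite normrN.
move=> n j jn /(Ag n j jn) E; apply/seteqP; split => // x [/KA Ax ix].
by rewrite -E.
Qed.

End off_log_good.

(** * The open set of points with locally integrable logarithm *)

Section log_good_set.
Variable R : realType.
Local Notation leb := (@lebesgue_measure R).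
Implicit Types (f : R -> R).

Lemma floor_Tpar (x : R) : Tpar x -> Num.floor x = 0.
Proof.
by rewrite /Tpar /= in_itv /= => /andP[x0 x1]; apply: floor_def; rewrite x0 add0r.
Qed.

Lemma frac_Tpar (x : R) : Tpar x -> Defs.frac x = x.
Proof. by move=> Tx; rewrite /Defs.frac floor_Tpar// subr0. Qed.

Lemma frac_preimage_itv (a b : R) : 0 <= a -> b <= 1 ->
  Defs.frac @^-1` `]a, b[ = \bigcup_(k in [set: int]) [set` `](k%:~R + a : R), k%:~R + b[].
Proof.
move=> a0 b1; apply/seteqP; split => x /=.
  rewrite /Defs.frac in_itv /= => /andP[h1 h2]; exists (Num.floor x) => //=.
  by rewrite in_itv /=; apply/andP; split; lra.
move=> [k _]; rewrite /= in_itv /= => /andP[h1 h2].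
have -> : Defs.frac x = x - k%:~R.
  rewrite /Defs.frac (floor_def (m := k))// intrD.
  by apply/andP; split; lra.
by rewrite in_itv /=; apply/andP; split; lra.
Qed.

Lemma Tarc_Tpar (a b : R) : 0 <= a -> b <= 1 -> Tarc a b = [set` `]a, b[].
Proof.
move=> a0 b1; have T x : x \in `]a, b[ -> Defs.frac x = x.
  rewrite in_itv /= => /andP[h1 h2]; apply: frac_Tpar.
  by rewrite /Tpar /= in_itv /=; apply/andP; split; lra.
apply/seteqP; split => x; first by move=> [y /= hy <-]; rewrite T.
by move=> hx; exists x => //; exact: T.
Qed.

Lemma icell_bounds n j : (j < n)%N ->
  [/\ 0 <= j%:R / n%:R :> R, j%:R / n%:R < j.+1%:R / n%:R :> R & j.+1%:R / n%:R <= 1 :> R].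
Proof.
move=> jn; have n0 : (0 : R) < n%:R by rewrite ltr0n (leq_ltn_trans _ jn).
split; first by rewrite divr_ge0.
- by rewrite ltr_pM2r ?invr_gt0// ltr_nat.
- by rewrite ler_pdivrMr// mul1r ler_nat.
Qed.

(** Only arcs between consecutive multiples of 1 / n are used: being countably many, their null sets
    of zeros of [f] add up to a null set. All [n] occur because the balancing off this set takes
    place on arbitrarily fine partitions. *)
Definition good_set f : set R :=
  \bigcup_(p in [set p : nat * nat | (p.2 < p.1)%N /\ log_good f (icell p.1 p.2)])
    icell p.1 p.2.

Lemma T_open_good_set f : T_open (good_set f).
Proof.
split.
  move=> x [[n j] /= [jn _]]; rewrite /icell /Tpar /= !in_itv /= => /andP[h1 h2].
  by have [a b c] := icell_bounds jn; apply/andP; split; lra.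
rewrite /good_set preimage_bigcup; apply: bigcup_open => -[n j] /= [jn _].
have [a _ c] := icell_bounds jn; rewrite /icell frac_preimage_itv//.
by apply: bigcup_open => k _; exact: interval_open.
Qed.

Lemma open_good_set f : open (good_set f).
Proof. by apply: bigcup_open => -[n j] _; exact: interval_open. Qed.

Lemma null_subset (mu : {measure set (measurableTypeR R) -> \bar R}) (A B : set R) :
  measurable A -> measurable B -> A `<=` B -> mu B = 0%E -> mu A = 0%E.
Proof.
move=> mA mB AB B0; apply/eqP; rewrite -measure_le0 -B0.
by apply: le_measure; rewrite ?inE.
Qed.

Lemma null_setU (mu : {measure set (measurableTypeR R) -> \bar R}) (A B : set R) :
  measurable A -> measurable B -> mu A = 0%E -> mu B = 0%E -> mu (A `|` B) = 0%E.
Proof.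
move=> mA mB A0 B0; apply: measure_negligible; first exact: measurableU.
by apply: negligibleU; apply/negligibleP.
Qed.

Lemma null_good_set (mu : {measure set (measurableTypeR R) -> \bar R}) f (Z : set R) :
  measurable Z ->
  (forall n j, (j < n)%N -> log_good f (icell n j) -> mu (icell n j `&` Z) = 0%E) ->
  mu (good_set f `&` Z) = 0%E.
Proof.
move=> mZ H; pose F n j : set R := if `[< (j < n)%N /\ log_good f (icell n j) >] then
  icell n j `&` Z else set0.
have sub : good_set f `&` Z `<=` \bigcup_n \bigcup_j F n j.
  move=> x [[[n j] /= h ix] zx]; exists n => //; exists j => //.
  by rewrite /F asboolT.
have mUZ : measurable (good_set f `&` Z).
  by apply: measurableI => //; apply: open_measurable; exact: open_good_set.
have [B [mB B0 FB]] : mu.-negligible (\bigcup_n \bigcup_j F n j).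
  apply: negligible_bigcup => n; apply: negligible_bigcup => j.
  rewrite /F; case: asboolP => [[jn h]|_]; last exact: negligible_set0.
  apply/negligibleP; last exact: H.
  by apply: measurableI => //; exact: measurable_itv.
exact: null_subset mUZ mB (subset_trans sub FB) B0.
Qed.

Lemma good_set_arc f x : good_set f x -> exists a b : R,
  [/\ a < b, b <= a + 1, Tarc a b x, Tarc a b `<=` good_set f &
      (\int[leb]_(t in Tarc a b) (ln (f t))%:E > -oo)%E].
Proof.
move=> [[n j] /= [jn gn] ix]; have [a b c] := icell_bounds jn.
exists (j%:R / n%:R), (j.+1%:R / n%:R); rewrite Tarc_Tpar//; split => //.
- by lra.
- by move=> y iy; exists (n, j).
- by case: gn.
Qed.

End log_good_set.

(** * The modulus of a complex density *)

Section modulus.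
Variable R : realType.
Local Notation leb := (@lebesgue_measure R).
Variables g1 g2 : R -> R.
Hypotheses (i1 : leb.-integrable [set: R] (EFin \o g1))
  (i2 : leb.-integrable [set: R] (EFin \o g2)).

Lemma cabs_ge_l x : `|g1 x| <= cabs g1 g2 x.
Proof. by rewrite -sqrtr_sqr ler_wsqrtr// lerDl sqr_ge0. Qed.

Lemma cabs_ge_r x : `|g2 x| <= cabs g1 g2 x.
Proof. by rewrite -sqrtr_sqr ler_wsqrtr// lerDr sqr_ge0. Qed.

Lemma cabs_le x : cabs g1 g2 x <= `|g1 x| + `|g2 x|.
Proof.
rewrite -[leRHS]ger0_norm ?addr_ge0// -sqrtr_sqr ler_wsqrtr//.
rewrite sqrrD !real_normK ?num_real// lerD2r lerDl.
by rewrite mulrn_wge0 ?mulr_ge0.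
Qed.

Lemma cabs_eq0 x : g1 x = 0 -> g2 x = 0 -> cabs g1 g2 x = 0.
Proof. by move=> h1 h2; rewrite /cabs h1 h2 expr0n /= addr0 sqrtr0. Qed.

Lemma measurable_cabs : measurable_fun [set: R] (cabs g1 g2).
Proof.
have m1 : measurable_fun [set: R] g1 by apply/measurable_EFinP; exact: (measurable_int leb).
have m2 : measurable_fun [set: R] g2 by apply/measurable_EFinP; exact: (measurable_int leb).
apply: (@measurableT_comp _ _ _ _ _ _ (@Num.sqrt R)).
  by apply: continuous_measurable_fun; exact: sqrt_continuous.
by apply: measurable_funD; exact: measurable_funX.
Qed.

Lemma integrable_cabs : leb.-integrable [set: R] (EFin \o cabs g1 g2).
Proof.
have i12 := integrableD measurableT (integrable_norm i1) (integrable_norm i2).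
apply: (le_integrable measurableT _ _ i12).
  by apply/measurable_EFinP; exact: measurable_cabs.
move=> x _ /=; rewrite lee_fin ger0_norm ?sqrtr_ge0//.
by rewrite ger0_norm ?addr_ge0//; exact: cabs_le.
Qed.

End modulus.

Theorem theoremC (R : realType) (nu : cmeasure R) :
  (exists c : R, 0 < c /\ exists C : R,
     forall n : nat, fcoef_abs nu n * expR (c * Num.sqrt n%:R) <= C) ->
  exists g1 g2 : R -> R,
    [/\ lebesgue_measure.-integrable Tpar (EFin \o g1),
        lebesgue_measure.-integrable Tpar (EFin \o g2),
        (forall A : set R, measurable A -> A `<=` Tpar ->
           (cm_re nu A)%:E = (\int[lebesgue_measure]_(t in A) (g1 t)%:E)%E /\
           (cm_im nu A)%:E = (\int[lebesgue_measure]_(t in A) (g2 t)%:E)%E) &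
        exists U : set R,
          [/\ T_open U,
              lebesgue_measure
                ((U `\` [set t | Tpar t /\ 0 < cabs g1 g2 t]) `|`
                 ([set t | Tpar t /\ 0 < cabs g1 g2 t] `\` U)) = 0%E &
              forall x, U x -> exists a b : R,
                [/\ a < b, b <= a + 1, Tarc a b x, Tarc a b `<=` U &
                    (\int[lebesgue_measure]_(t in Tarc a b) (ln (cabs g1 g2 t))%:E
                       > -oo)%E]]].
Proof.
move=> hnu; have hnu' : fast_decay (cm_mulI nu) by exact: fast_decay_mulI.
have mT := @measurable_Tpar R.
have [g1 [i1 e1]] : exists g : R -> R, lebesgue_measure.-integrable [set: R] (EFin \o g) /\
    forall A : set R, measurable A ->
    (cm_re nu A)%:E = (\int[lebesgue_measure]_(x in A) (g x)%:E)%E.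
  apply: exists_density; [exact: cm_supp1|exact: cm_supp2|].
  by move=> A mA AT A0; exact: (cm_re_null hnu).
have [g2 [i2 e2]] : exists g : R -> R, lebesgue_measure.-integrable [set: R] (EFin \o g) /\
    forall A : set R, measurable A ->
    (cm_im nu A)%:E = (\int[lebesgue_measure]_(x in A) (g x)%:E)%E.
  apply: exists_density; [exact: cm_supp3|exact: cm_supp4|].
  move=> A mA AT A0; apply: oppr_inj; rewrite oppr0 -/(cm_im nu A) -cm_re_mulI.
  exact: (cm_re_null hnu').
exists g1, g2; split.
- by apply: (integrableS measurableT); [exact: mT|exact: subsetT|exact: i1].
- by apply: (integrableS measurableT); [exact: mT|exact: subsetT|exact: i2].
- by move=> A mA _; split; [exact: e1|exact: e2].
pose f := cabs g1 g2; pose U := good_set f.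
have f0 x : 0 <= f x by exact: sqrtr_ge0.
have mf : measurable_fun [set: R] f by exact: measurable_cabs.
have fi := integrable_cabs i1 i2.
have [UT oU] := T_open_good_set f.
have mU : measurable U by apply: open_measurable; exact: open_good_set.
pose P := [set t | Tpar t /\ 0 < f t].
have mP : measurable P.
  rewrite (_ : P = Tpar `&` f @^-1` `]0, +oo[); last first.
    by apply/seteqP; split => x /=; rewrite in_itv /= andbT.
  by apply: measurableI => //; rewrite -[X in measurable X]setTI; apply: mf.
exists U; split; [exact: T_open_good_set| |exact: good_set_arc].
have mB : measurable (Tpar `\` U) by exact: measurableD.
have r1 A : measurable A -> cm_re nu A = \int[lebesgue_measure]_(x in A) g1 x.
  by move=> mA; rewrite /Rintegral -e1.
have r2 A : measurable A -> cm_im nu A = \int[lebesgue_measure]_(x in A) g2 x.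
  by move=> mA; rewrite /Rintegral -e2.
have offU A : A `<=` Tpar `\` U -> forall n j, (j < n)%N -> log_good f (icell n j) ->
    A `&` icell n j = set0.
  move=> AB n j jn gn; apply/seteqP; split => // x [/AB[_ nU] ix]; apply: nU.
  by exists (n, j).
have z1 A : measurable A -> A `<=` Tpar `\` U -> cm_re nu A = 0.
  move=> mA AB; apply: (cm_re_off_log_good hnu i1 i2 _ mf fi) => //.
  - by move=> B mB' _; rewrite r1// r2.
  - exact: cabs_ge_l.
  - exact: cabs_ge_r.
  - by move=> x /AB[].
  - exact: offU.
have z2 A : measurable A -> A `<=` Tpar `\` U -> cm_im nu A = 0.
  move=> mA AB; apply: oppr_inj; rewrite oppr0 -cm_re_mulI.
  (* The densities of i nu are - g2 and g1, whose moduli are still bounded by [f]. *)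
  apply: (cm_re_off_log_good hnu' (integrableN_fun i2) i1 _ mf fi) => //.
  - move=> B mB' _; split; last by rewrite /cm_im /= -/(cm_re nu B) r1.
    rewrite cm_re_mulI r2// -mulN1r -RintegralZl//.
      by apply: eq_Rintegral => x _; rewrite mulN1r.
    by apply: (integrableS measurableT); [exact: mB'|exact: subsetT|exact: i2].
  - by move=> x; rewrite normrN; exact: cabs_ge_r.
  - exact: cabs_ge_l.
  - by move=> x /AB[].
  - exact: offU.
(* An integrable function whose integral vanishes over every measurable subset of T \ U is zero
   almost everywhere there; [Z] collects the exceptions. *)
have ae0 g : lebesgue_measure.-integrable [set: R] (EFin \o g) ->
    (forall A : set R, measurable A -> A `<=` Tpar `\` U ->
      \int[lebesgue_measure]_(x in A) (g x)%:E = 0)%E ->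
    exists Z : set R, [/\ measurable Z, lebesgue_measure Z = 0%E &
      forall x, (Tpar `\` U) x -> g x != 0 -> Z x].
  move=> gi h.
  have : ae_eq lebesgue_measure (Tpar `\` U) (EFin \o g) (cst 0%E).
    apply: integral_ae_eq => //.
    - exact: (integrableS measurableT).
    - by move=> E EB mE; rewrite h// integral0.
  move=> [Z [mZ Z0 sub]]; exists Z; split => // x Bx gx; apply: sub => /= E.
  by move/eqP: gx; apply; have [] := E Bx.
have [Z1 [mZ1 Z10 hZ1]] := ae0 g1 i1 (fun A mA AB => etrans (esym (e1 A mA)) (congr1 EFin (z1 A mA AB))).
have [Z2 [mZ2 Z20 hZ2]] := ae0 g2 i2 (fun A mA AB => etrans (esym (e2 A mA)) (congr1 EFin (z2 A mA AB))).
have mz := measurable_zeros mf.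
have mGZ : measurable (U `&` zeros f) by exact: measurableI.
(* The symmetric difference is covered by three null sets: the zeros of [f] inside [U], and two
   containing the points off [U] where g1, respectively g2, is nonzero. *)
apply: (@null_subset R lebesgue_measure _ ((U `&` zeros f) `|` (Z1 `|` Z2))).
- by apply: measurableU; exact: measurableD.
- by apply: measurableU => //; exact: measurableU.
- move=> x [[Ux nP]|[[Tx fx] nU]].
    left; split => //; apply/eqP; rewrite eq_le f0 andbT leNgt; apply/negP => fx.
    by apply: nP; split => //; exact: UT.
  right; have [h1|h1] := eqVneq (g1 x) 0; last by left; apply: hZ1.
  have [h2|h2] := eqVneq (g2 x) 0; last by right; apply: hZ2.
  by move: fx; rewrite cabs_eq0// ltxx.
apply: null_setU => //; last by apply: null_setU.
- by apply: measurableU.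
- by apply: null_good_set => // n j _ [].
Qed.
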